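(* Let $\varphi:X\to Y$ be a morphism of locally Noetherian schemes, let $n\ge1$ be an integer, and let $x\in X$ and $y=\varphi(x)$ be such that $\operatorname{Der}^n_{(Y,y)}(X,x)$ has locally finite Gorenstein dimension on $\operatorname{Ass}_{\mathcal{O}_{X,x}}(\mathcal{O}_{X,x})$. Then the following conditions on the $\mathcal{O}_{X,x}$-module $\Omega^{(n)}_{(X,x)/(Y,y)}$ are equivalent: (1) $\Omega^{(n)}_{(X,x)/(Y,y)}$ is $1$-torsionfree. (2) $\Omega^{(n)}_{(X,x)/(Y,y)}$ is a $1$-syzygy. (3) $\Omega^{(n)}_{(X,x)/(Y,y)}$ satisfies $(\widetilde{S}_1)$.
   Context: Kähler differentials: with $\Delta:X\to X\times_YX$ the diagonal and $\mathcal{I}$ the kernel of $\Delta^{\#}:\mathcal{O}_{X\times_YX}\to\Delta_*\mathcal{O}_X$, set $\Omega^{(1)}_{X/Y}=\Delta^*(\mathcal{I}/\mathcal{I}^2)$, $\Omega^{(n)}_{X/Y}=\bigwedge^n\Omega^{(1)}_{X/Y}$ for $n\ge1$, and $\mathcal{D}er^n_Y(X)=\mathcal{H}om_{\mathcal{O}_X}(\Omega^{(n)}_{X/Y},\mathcal{O}_X)$. Standing assumptions: $\Omega^{(n)}_{X/Y}$ and $\mathcal{D}er^n_Y(X)$ are non-zero coherent $\mathcal{O}_X$-modules (this coherence holds e.g. if $\varphi$ is locally of finite type), with non-zero stalks at the point $x$ considered. Their stalks at $x$ are denoted $\Omega^{(n)}_{(X,x)/(Y,y)}$ and $\operatorname{Der}^n_{(Y,y)}(X,x)\cong\operatorname{Hom}_{\mathcal{O}_{X,x}}(\Omega^{(n)}_{(X,x)/(Y,y)},\mathcal{O}_{X,x})$;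 these are finitely generated modules over the Noetherian local ring $\mathcal{O}_{X,x}$. For a Noetherian ring $R$ and a finitely generated $R$-module $M$, with $M^\ast=\operatorname{Hom}_R(M,R)$: $N$ has locally finite Gorenstein dimension on a set of primes if $\operatorname{G-dim}_{R_\mathfrak{p}}(N_\mathfrak{p})<\infty$ for all $\mathfrak{p}$ in it. $\operatorname{Tr}(M)$ is the cokernel of $P_0^\ast\to P_1^\ast$ for a projective presentation $P_1\to P_0\to M\to0$; $M$ is $1$-torsionfree if $\operatorname{Ext}^1_R(\operatorname{Tr}(M),R)=0$. $M$ is a $1$-syzygy if there is an exact sequence $0\to M\to P_0$ with $P_0$ projective. $M$ satisfies $(\widetilde{S}_1)$ if $\operatorname{depth}_{R_\mathfrak{p}}(M_\mathfrak{p})\ge\min\{1,\operatorname{depth}_{R_\mathfrak{p}}(R_\mathfrak{p})\}$ for all primes $\mathfrak{p}$ (the zero module has depth $+\infty$). $G$ is totally reflexive if it is reflexive and $\operatorname{Ext}_R^i(G,R)=\operatorname{Ext}_R^i(G^\ast,R)=0$ for all $i>0$; $\operatorname{G-dim}_R(N)$ is the infimum of $m\ge0$ such that there is an exact sequence $0\to G_m\to\cdots\to G_0\to N\to0$ with all $G_i$ totally reflexive. *)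

(* Defs.v *)
From HB Require Import structures.
From mathcomp Require Import all_boot all_order all_algebra generic_quotient.
From mathcomp Require Import boolp classical_sets constructive_ereal.
From mathcomp Require Import topology_structure.
From mathcomp Require Import ring.
Set Implicit Arguments. Unset Strict Implicit. Unset Printing Implicit Defensive.
Import Order.TTheory GRing.Theory.
Local Open Scope classical_set_scope.
Local Open Scope ring_scope.
Local Open Scope quotient_scope.
Section PropQuotient.
Variables (T : Type) (r : T -> T -> Prop).
Hypotheses (r_refl : forall x, r x x) (r_sym : forall x y, r x y -> r y x).
Hypothesis r_trans : forall x y z, r x y -> r y z -> r x z.

Let rb : rel {classic T} := fun x y => `[< r x y >].

Fact prop_refl : reflexive rb.
Proof. by move=> x; apply/asboolP. Qed.
Fact prop_sym : symmetric rb.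
Proof. by move=> x y; apply: asbool_equiv_eq; split; apply: r_sym. Qed.
Fact prop_trans : transitive rb.
Proof.
by move=> y x z /asboolP xy /asboolP yz; apply/asboolP/(r_trans xy yz).
Qed.

Definition prop_equiv : equiv_rel {classic T} :=
  EquivRel rb prop_refl prop_sym prop_trans.

Definition prop_quot := {eq_quot prop_equiv}.

Definition prop_pi (x : T) : prop_quot := \pi_prop_quot (x : {classic T}).

Definition prop_repr (x : prop_quot) : T := repr x.

Lemma prop_reprK x : prop_pi (prop_repr x) = x.
Proof. exact: reprK. Qed.

Lemma prop_quotP (x y : T) : prop_pi x = prop_pi y <-> r x y.
Proof. by split=> [/eqmodP/asboolP | xy] //; apply/eqmodP/asboolP. Qed.

End PropQuotient.

Section Rings.
Variable R : comPzRingType.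

Definition is_unit (a : R) : Prop := exists b, a * b = 1.

Definition is_local : Prop :=
  ~ is_unit 0 /\ forall a b : R, is_unit (a + b) -> is_unit a \/ is_unit b.

Definition is_ideal (I : set R) : Prop :=
  [/\ I 0, forall a b, I a -> I b -> I (a + b) & forall a b, I b -> I (a * b)].

Definition noetherian : Prop := forall I : set R, is_ideal I ->
  exists k (g : 'I_k -> R),
    I = [set a | exists c : 'I_k -> R, a = \sum_(i < k) c i * g i].

Record prime_ideal := PrimeIdeal {
  pset :> set R;
  pset_ideal : is_ideal pset;
  pset1 : ~ pset 1;
  psetM : forall a b, pset (a * b) -> pset a \/ pset b }.

Definition Ass : set prime_ideal :=
  [set p | exists a : R, pset p = [set b | b * a = 0]].

Lemma prime_ideal_eq (p q : prime_ideal) : pset p = pset q -> p = q.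
Proof.
case: p q => [p p1 p2 p3] [q q1 q2 q3] /= e; move: p1 p2 p3; rewrite e.
by move=> p1 p2 p3; congr PrimeIdeal; apply: Prop_irrelevance.
Qed.

Lemma pset_mulN (p : prime_ideal) a b : ~ pset p a -> ~ pset p b -> ~ pset p (a * b).
Proof. by move=> na nb /psetM[]. Qed.

End Rings.

Arguments noetherian : clear implicits.
Arguments is_local : clear implicits.
Arguments prime_ideal : clear implicits.
Arguments Ass : clear implicits.

Section Localization.
Variables (R : comPzRingType) (p : prime_ideal R).

Section Module.
Variable M : lmodType R.

Record fraction := Fraction { fnum : M; fden : R; fdenP : ~ pset p fden }.
Arguments fdenP : clear implicits.

Definition frac_rel (x y : fraction) : Prop :=
  exists2 u, ~ pset p u & u *: (fden y *: fnum x) = u *: (fden x *: fnum y).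

Fact frac_refl x : frac_rel x x.
Proof. by exists 1 => //; apply: pset1. Qed.
Fact frac_sym x y : frac_rel x y -> frac_rel y x.
Proof. by case=> u nu e; exists u. Qed.
Fact frac_trans x y z : frac_rel x y -> frac_rel y z -> frac_rel x z.
Proof.
case: x y z => [m s hs] [n t ht] [q w hw] [u nu /= e1] [v nv /= e2].
exists (u * v * t) => /=; first by do 2?apply: pset_mulN.
have -> : (u * v * t) *: (w *: m) = (v * w) *: (u *: (t *: m)).
  by rewrite !scalerA; congr (_ *: _); ring.
have -> : (u * v * t) *: (s *: q) = (u * s) *: (v *: (t *: q)).
  by rewrite !scalerA; congr (_ *: _); ring.
by rewrite e1 -e2 !scalerA; congr (_ *: _); ring.
Qed.

Definition loc := prop_quot frac_refl frac_sym frac_trans.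
HB.instance Definition _ := Choice.on loc.

Definition mkfrac (m : M) (s : R) (hs : ~ pset p s) : loc :=
  prop_pi _ _ _ (Fraction m hs).

Lemma mkfrac_eq m n s t (hs : ~ pset p s) (ht : ~ pset p t) :
  mkfrac m hs = mkfrac n ht <->
  exists2 u, ~ pset p u & u *: (t *: m) = u *: (s *: n).
Proof. exact: prop_quotP. Qed.

Lemma mkfrac_ind (P : loc -> Prop) :
  (forall m s hs, P (@mkfrac m s hs)) -> forall x, P x.
Proof. by move=> h; move=> x; rewrite -[x]prop_reprK; case: (prop_repr x) => m s hs; exact: h. Qed.

Lemma mkfrac_expand m s (hs : ~ pset p s) t (ht : ~ pset p t)
  (hts : ~ pset p (t * s)) : mkfrac m hs = mkfrac (t *: m) hts.
Proof.
apply/mkfrac_eq; exists 1; first exact: pset1.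
by congr (_ *: _); rewrite scalerA mulrC.
Qed.

Lemma mkfrac_ind2 (P : loc -> loc -> Prop) :
  (forall m n s hs, P (@mkfrac m s hs) (@mkfrac n s hs)) -> forall x y, P x y.
Proof.
move=> h; elim/mkfrac_ind => m s hs; elim/mkfrac_ind => n t ht.
have hts := pset_mulN ht hs; have hst : ~ pset p (s * t) by rewrite mulrC.
rewrite (mkfrac_expand m hs ht hts) (mkfrac_expand n ht hs hst).
by move: hst; rewrite mulrC => hst; rewrite (Prop_irrelevance hst hts).
Qed.

Lemma mkfrac_ind3 (P : loc -> loc -> loc -> Prop) :
  (forall m n q s hs, P (@mkfrac m s hs) (@mkfrac n s hs) (@mkfrac q s hs)) ->
  forall x y z, P x y z.
Proof.
move=> h x y z; move: z x y; elim/mkfrac_ind => q t ht.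
apply: (mkfrac_ind2 (P := fun x y => P x y _)) => m n s hs.
have hts := pset_mulN ht hs; have hst : ~ pset p (s * t) by rewrite mulrC.
rewrite (mkfrac_expand m hs ht hts) (mkfrac_expand n hs ht hts).
rewrite (mkfrac_expand q ht hs hst).
by move: hst; rewrite mulrC => hst; rewrite (Prop_irrelevance hst hts).
Qed.

Definition loc_add (x y : loc) : loc :=
  let f := prop_repr x in let g := prop_repr y in
  mkfrac (fden g *: fnum f + fden f *: fnum g) (pset_mulN (fdenP f) (fdenP g)).
Definition loc_opp (x : loc) : loc :=
  let f := prop_repr x in mkfrac (- fnum f) (fdenP f).
Definition loc_zero : loc := mkfrac 0 (@pset1 R p).

Lemma repr_mkfrac m s (hs : ~ pset p s) : exists n t (ht : ~ pset p t),
  prop_repr (mkfrac m hs) = Fraction n ht /\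
  exists2 u, ~ pset p u & u *: (t *: m) = u *: (s *: n).
Proof.
move e: (prop_repr (mkfrac m hs)) => x; case: x e => n t ht e.
exists n, t, ht; split=> //; apply/(mkfrac_eq _ _ hs ht).
by rewrite -[LHS]prop_reprK e.
Qed.

Lemma loc_addE m n s (hs : ~ pset p s) :
  loc_add (mkfrac m hs) (mkfrac n hs) = mkfrac (m + n) hs.
Proof.
rewrite /loc_add.
have [m' [t [ht [-> [u nu e]]]]] := repr_mkfrac m hs.
have [n' [w [hw [-> [v nv e']]]]] := repr_mkfrac n hs.
apply/mkfrac_eq; exists (u * v) => /=; first exact: pset_mulN.
rewrite !scalerDr !scalerA.
have -> : (u * v * s * w) *: m' = (v * w) *: (u *: (s *: m')).
  by rewrite !scalerA; congr (_ *: _); ring.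
have -> : (u * v * s * t) *: n' = (u * t) *: (v *: (s *: n')).
  by rewrite !scalerA; congr (_ *: _); ring.
by rewrite -e -e' !scalerA; congr (_ *: _ + _ *: _); ring.
Qed.

Lemma loc_oppE m s (hs : ~ pset p s) : loc_opp (mkfrac m hs) = mkfrac (- m) hs.
Proof.
rewrite /loc_opp; have [m' [t [ht [-> [u nu e]]]]] := repr_mkfrac m hs.
by apply/mkfrac_eq; exists u => //=; rewrite !scalerN e.
Qed.

Lemma mkfrac0 s (hs : ~ pset p s) : mkfrac 0 hs = loc_zero.
Proof. by apply/mkfrac_eq; exists 1; [apply: pset1 | rewrite !scaler0]. Qed.

Fact loc_addA : associative loc_add.
Proof. by apply: mkfrac_ind3 => m n q s hs; rewrite !loc_addE addrA. Qed.
Fact loc_addC : commutative loc_add.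
Proof. by apply: mkfrac_ind2 => m n s hs; rewrite !loc_addE addrC. Qed.
Fact loc_add0 : left_id loc_zero loc_add.
Proof.
by apply: mkfrac_ind => m s hs; rewrite -(mkfrac0 hs) loc_addE add0r.
Qed.
Fact loc_addN : left_inverse loc_zero loc_opp loc_add.
Proof.
by apply: mkfrac_ind => m s hs; rewrite loc_oppE loc_addE addNr mkfrac0.
Qed.
HB.instance Definition _ :=
  GRing.isZmodule.Build loc loc_addA loc_addC loc_add0 loc_addN.

Lemma mkfracD m n s (hs : ~ pset p s) :
  mkfrac m hs + mkfrac n hs = mkfrac (m + n) hs.
Proof. exact: loc_addE. Qed.

End Module.

Arguments mkfrac {M} m {s} hs.
Arguments fdenP {M} f _.

(** The ring [R_p] is the localization of [R^o], the action on [M_p] being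
    [(a / s) (m / t) = (a m) / (s t)]. *)
Definition loc_ring := loc R^o.
HB.instance Definition _ := GRing.Zmodule.on loc_ring.

Section Scale.
Variable M : lmodType R.

Definition loc_scale (x : loc_ring) (y : loc M) : loc M :=
  let f := prop_repr x in let g := prop_repr y in
  mkfrac ((fnum f : R) *: fnum g) (pset_mulN (fdenP f) (fdenP g)).

Lemma loc_scaleE (a : R) (m : M) s t (hs : ~ pset p s) (ht : ~ pset p t) 
  (hst : ~ pset p (s * t)) :
  loc_scale (mkfrac (a : R^o) hs) (mkfrac m ht) = mkfrac (a *: m) hst.
Proof.
rewrite /loc_scale.
have [b [s' [hs' [-> [u nu e]]]]] := repr_mkfrac (a : R^o) hs.
have [n [t' [ht' [-> [v nv e']]]]] := repr_mkfrac m ht.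
apply/mkfrac_eq; exists (u * v) => /=; first exact: pset_mulN.
move: b e => /= b e; have {}e : u * (s' * a) = u * (s * (b : R)) := e.
have -> : (u * v) *: (s * t *: ((b : R) *: n)) =
    (u * (s * (b : R))) *: (v *: (t *: n)).
  by rewrite !scalerA; congr (_ *: _); ring.
by rewrite -e' -e !scalerA; congr (_ *: _); ring.
Qed.

Definition loc_one : loc_ring := mkfrac (1 : R^o) (@pset1 R p).

Fact loc_scale1 : left_id loc_one loc_scale.
Proof.
apply: mkfrac_ind => m s hs.
have h1s : ~ pset p (1 * s) by rewrite mul1r.
rewrite (loc_scaleE _ _ _ _ h1s) scale1r.
by apply/mkfrac_eq; exists 1; [apply: pset1 | rewrite mul1r].
Qed.

Fact loc_scaleDr : right_distributive loc_scale +%R.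
Proof.
elim/mkfrac_ind => a r hr; apply: mkfrac_ind2 => m n s hs.
have hrs := pset_mulN hr hs.
by rewrite mkfracD !(loc_scaleE _ _ _ _ hrs) mkfracD scalerDr.
Qed.

Fact loc_scaleDl (y : loc M) :
  {morph loc_scale^~ y : a b / a + b}.
Proof.
apply: mkfrac_ind2 => a b r hr; move: y; apply: mkfrac_ind => m s hs.
have hrs := pset_mulN hr hs.
rewrite [X in loc_scale X]mkfracD !(loc_scaleE _ _ _ _ hrs) mkfracD.
by rewrite -scalerDl.
Qed.

End Scale.

Definition loc_mul : loc_ring -> loc_ring -> loc_ring := @loc_scale R^o.

Fact loc_scaleA (M : lmodType R) x y (z : loc M) :
  loc_scale x (loc_scale y z) = loc_scale (loc_mul x y) z.
Proof.
elim/mkfrac_ind: x => a r hr; elim/mkfrac_ind: y => b s hs.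
elim/mkfrac_ind: z => m t ht.
have hrs := pset_mulN hr hs; have hst := pset_mulN hs ht.
have h1 := pset_mulN hrs ht; have h2 : ~ pset p (r * (s * t)) by rewrite mulrA.
rewrite (loc_scaleE _ _ _ _ hst) (loc_scaleE _ _ _ _ h2).
rewrite /loc_mul (loc_scaleE _ _ _ _ hrs) (loc_scaleE _ _ _ _ h1).
apply/mkfrac_eq; exists 1; first exact: pset1.
rewrite !scalerA; congr (_ *: _).
have -> : a *: b = (a : R) * (b : R) :> R by [].
by rewrite -!mulrA.
Qed.

Fact loc_mulC : commutative loc_mul.
Proof.
apply: mkfrac_ind2 => a b s hs; have hss := pset_mulN hs hs.
by rewrite /loc_mul !(loc_scaleE _ _ _ _ hss); congr (mkfrac _ hss); apply: mulrC.
Qed.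

Fact loc_mulA : associative loc_mul.
Proof. by move=> x y z; apply: loc_scaleA. Qed.

Fact loc_mulDl : left_distributive loc_mul +%R.
Proof. by move=> x y z; apply: loc_scaleDl. Qed.

HB.instance Definition _ := GRing.Zmodule_isComPzRing.Build loc_ring
  loc_mulA loc_mulC (@loc_scale1 R^o) loc_mulDl.

HB.instance Definition _ (M : lmodType R) :=
  GRing.Zmodule_isLmodule.Build loc_ring (loc M)
    (@loc_scaleA M) (@loc_scale1 M) (@loc_scaleDr M) (@loc_scaleDl M).

End Localization.

Arguments mkfrac {R p M} m {s} hs.

Section Hom.
Variables (R : comPzRingType) (M N : lmodType R).

Definition hom := {linear M -> N}.
Identity Coercion linear_of_hom : hom >-> GRing.Linear.type.
HB.instance Definition _ := gen_eqMixin hom.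
HB.instance Definition _ := gen_choiceMixin hom.

Lemma hom_ext (f g : hom) : f =1 g -> f = g.
Proof.
case: f g => [f cf] [g cg] /= /funext e; move: cg; rewrite -e => cg.
congr GRing.Linear.Pack; case: cf cg => -[a1] [b1] [[a2] [b2]].
by rewrite (Prop_irrelevance a1 a2) (Prop_irrelevance b1 b2).
Qed.

Definition hom_add (f g : hom) : hom := f \+ g.
Definition hom_opp (f : hom) : hom := \- f.
Definition hom_zero : hom := \0.
Definition hom_scale (a : R) (f : hom) : hom := a \*: f.

Fact hom_addA : associative hom_add.
Proof. by move=> f g h; apply: hom_ext => x /=; rewrite addrA. Qed.
Fact hom_addC : commutative hom_add.
Proof. by move=> f g; apply: hom_ext => x /=; rewrite addrC. Qed.
Fact hom_add0 : left_id hom_zero hom_add.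
Proof. by move=> f; apply: hom_ext => x /=; rewrite add0r. Qed.
Fact hom_addN : left_inverse hom_zero hom_opp hom_add.
Proof. by move=> f; apply: hom_ext => x /=; rewrite addNr. Qed.
HB.instance Definition _ :=
  GRing.isZmodule.Build hom hom_addA hom_addC hom_add0 hom_addN.

Fact hom_scaleA a b f : hom_scale a (hom_scale b f) = hom_scale (a * b) f.
Proof. by apply: hom_ext => x /=; rewrite scalerA. Qed.
Fact hom_scale1 : left_id 1 hom_scale.
Proof. by move=> f; apply: hom_ext => x /=; rewrite scale1r. Qed.
Fact hom_scaleDr : right_distributive hom_scale +%R.
Proof. by move=> a f g; apply: hom_ext => x /=; rewrite scalerDr. Qed.
Fact hom_scaleDl f : {morph hom_scale^~ f : a b / a + b}.
Proof. by move=> a b; apply: hom_ext => x /=; rewrite scalerDl. Qed.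
HB.instance Definition _ := GRing.Zmodule_isLmodule.Build R hom
  hom_scaleA hom_scale1 hom_scaleDr hom_scaleDl.

End Hom.

Notation dual M := (hom M (GRing.regular _)).

Section Dual.
Variable R : comPzRingType.

Section DualMap.
Variables (M N : lmodType R) (f : hom M N).

Definition dual_fun (u : dual N) : dual M := u \o f.

Fact dual_fun_linear : linear dual_fun.
Proof. by move=> a u v; apply: hom_ext. Qed.
HB.instance Definition _ :=
  GRing.isLinear.Build R (dual N) (dual M) *:%R dual_fun dual_fun_linear.

Definition dual_map : hom (dual N) (dual M) := dual_fun.

End DualMap.

Section Bidual.
Variable M : lmodType R.

Definition eval_at (x : M) (u : dual M) : R^o := u x.

Fact eval_at_linear x : linear (eval_at x).
Proof. by []. Qed.
HB.instance Definition _ x :=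
  GRing.isLinear.Build R (dual M) R^o *:%R (eval_at x) (eval_at_linear x).

Definition bidual (x : M) : dual (dual M) := eval_at x.

End Bidual.
End Dual.

Section Homological.
Variable R : comPzRingType.
Implicit Types M N P T : lmodType R.

Definition fin_gen M : Prop := exists k (g : 'I_k -> M),
  forall x, exists c : 'I_k -> R, x = \sum_(i < k) c i *: g i.

Definition surjective (A B : Type) (f : A -> B) : Prop :=
  forall y, exists x, f x = y.

Definition exact_at M N P (f : M -> N) (g : N -> P) : Prop :=
  forall y, g y = 0 <-> exists x, f x = y.

Definition projective P : Prop :=
  forall M N (g : hom M N) (f : hom P N), surjective g ->
    exists h : hom P M, forall x, g (h x) = f x.

(** Exact sequences [... -> G_2 -> G_1 -> G_0 -> N -> 0]; a bounded one has
    [G_i = 0] for large [i]. *)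
Record left_resolution N := LeftResolution {
  res_mod : nat -> lmodType R;
  res_d : forall i, hom (res_mod i.+1) (res_mod i);
  res_aug : hom (res_mod 0) N;
  res_aug_surj : surjective res_aug;
  res_exact0 : exact_at (res_d 0) res_aug;
  res_exact : forall i, exact_at (res_d i.+1) (res_d i) }.

(** [Ext^i(T, N) = 0]: the [i]-th cohomology of [Hom(P, N)] vanishes for every
    projective resolution [P] of [T]. *)
Definition Ext_vanish (i : nat) T N : Prop :=
  forall P : left_resolution T, (forall j, projective (res_mod P j)) ->
  forall u : hom (res_mod P i) N, (forall x, u (res_d P i x) = 0) ->
  match i return hom (res_mod P i) N -> Prop with
  | 0 => fun u => forall x, u x = 0
  | j.+1 => fun u => exists v : hom (res_mod P j) N,
      forall x, u x = v (res_d P j x)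
  end u.

Definition reflexive_module M : Prop := bijective (@bidual R M).

Definition totally_reflexive M : Prop :=
  [/\ fin_gen M, reflexive_module M &
    forall i, (0 < i)%N ->
      Ext_vanish i M R^o /\ Ext_vanish i (dual M) R^o].

Definition Gdim_le N (m : nat) : Prop :=
  exists G : left_resolution N,
    (forall i, totally_reflexive (res_mod G i)) /\
    (forall i, (m < i)%N -> forall x : res_mod G i, x = 0).

(** Infimum of the lengths of resolutions by totally reflexive modules. *)
Definition Gdim N : \bar int :=
  xget +oo%E [set (m%:Z)%:E | m in
    [set m | Gdim_le N m /\ forall k, Gdim_le N k -> (m <= k)%N]].

Definition is_transpose M T : Prop :=
  exists (P1 P0 : lmodType R) (d : hom P1 P0) (aug : hom P0 M)
         (q : hom (dual P1) T),
    [/\ projective P1 /\ fin_gen P1, projective P0 /\ fin_gen P0,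
        surjective aug /\ exact_at d aug &
        surjective q /\ exact_at (dual_map d) q].

(** [Tr M] is only defined up to projective summands, which do not affect
    [Ext^1(Tr M, R)]. *)
Definition torsionfree1 M : Prop :=
  exists2 T, is_transpose M T & Ext_vanish 1 T R^o.

Definition syzygy1 M : Prop :=
  exists (P0 : lmodType R) (f : hom M P0), projective P0 /\ injective f.

(** For a local ring [R] with maximal ideal its set of non-units; for [M = 0]
    every sequence is regular in this sense, so that the depth is [+oo]. *)
Definition regular_seq M k (x : 'I_k -> R) : Prop :=
  forall (i : 'I_k) (m : M),
    let xM (m : M) := exists c : 'I_k -> M,
      m = \sum_(j < k | (j < i)%N) x j *: c j in
    xM (x i *: m) -> xM m.

Definition depth_ge M (k : nat) : Prop :=
  exists x : 'I_k -> R, (forall i, ~ is_unit (x i)) /\ regular_seq M x.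

(** Supremum of the lengths of regular sequences of non-units. *)
Definition depth M : \bar int :=
  xget +oo%E [set (k%:Z)%:E | k in
    [set k | depth_ge M k /\ forall l, depth_ge M l -> (l <= k)%N]].

End Homological.

Section LocalConditions.
Variable R : comPzRingType.

Definition locally_finite_Gdim_on (S : set (prime_ideal R)) (N : lmodType R)
  : Prop := forall p, S p -> (Gdim (loc p N) < +oo)%E.

Definition S1_tilde (M : lmodType R) : Prop := forall p : prime_ideal R,
  (Order.min 1%:E (depth (loc_ring p)^o) <= depth (loc p M))%E.

End LocalConditions.

Section Presented.
Variables (R : comPzRingType) (G : Type).

Inductive lterm :=
| LZero | LAdd of lterm & lterm | LOpp of lterm | LScale of R & lterm
| LGen of G.

Variable rel : lterm -> lterm -> Prop.

(** The least congruence containing [rel] and the module axioms, so that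
    [presented] is the module with generators [G] and relations [rel]. *)
Inductive lcong : lterm -> lterm -> Prop :=
| LRel t u : rel t u -> lcong t u
| LRefl t : lcong t t
| LSym t u : lcong t u -> lcong u t
| LTrans t u v : lcong t u -> lcong u v -> lcong t v
| LAddCong t t' u u' :
    lcong t t' -> lcong u u' -> lcong (LAdd t u) (LAdd t' u')
| LOppCong t t' : lcong t t' -> lcong (LOpp t) (LOpp t')
| LScaleCong a t t' : lcong t t' -> lcong (LScale a t) (LScale a t')
| LAddA t u v : lcong (LAdd t (LAdd u v)) (LAdd (LAdd t u) v)
| LAddC t u : lcong (LAdd t u) (LAdd u t)
| LAdd0 t : lcong (LAdd LZero t) t
| LAddN t : lcong (LAdd (LOpp t) t) LZero
| LScaleA a b t : lcong (LScale a (LScale b t)) (LScale (a * b) t)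
| LScale1 t : lcong (LScale 1 t) t
| LScaleDr a t u : lcong (LScale a (LAdd t u)) (LAdd (LScale a t) (LScale a u))
| LScaleDl a b t :
    lcong (LScale (a + b) t) (LAdd (LScale a t) (LScale b t)).

Definition presented := prop_quot LRefl LSym LTrans.
HB.instance Definition _ := Choice.on presented.

Definition pterm (t : lterm) : presented := prop_pi LRefl LSym LTrans t.
Definition pgen (g : G) : presented := pterm (LGen g).

Lemma pterm_eq t u : pterm t = pterm u <-> lcong t u.
Proof. exact: prop_quotP. Qed.

Lemma pterm_ind (P : presented -> Prop) :
  (forall t, P (pterm t)) -> forall x, P x.
Proof. by move=> h x; rewrite -[x]prop_reprK; apply: h. Qed.

Lemma prepr t : lcong (prop_repr (pterm t)) t.
Proof. by apply/pterm_eq; apply: prop_reprK. Qed.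

Definition padd (x y : presented) := pterm (LAdd (prop_repr x) (prop_repr y)).
Definition popp (x : presented) := pterm (LOpp (prop_repr x)).
Definition pscale a (x : presented) := pterm (LScale a (prop_repr x)).

Fact paddE t u : padd (pterm t) (pterm u) = pterm (LAdd t u).
Proof. by apply/pterm_eq; apply: LAddCong; apply: prepr. Qed.
Fact poppE t : popp (pterm t) = pterm (LOpp t).
Proof. by apply/pterm_eq; apply: LOppCong; apply: prepr. Qed.
Fact pscaleE a t : pscale a (pterm t) = pterm (LScale a t).
Proof. by apply/pterm_eq; apply: LScaleCong; apply: prepr. Qed.

Fact paddA : associative padd.
Proof.
elim/pterm_ind=> t; elim/pterm_ind=> u; elim/pterm_ind=> v.
by rewrite !paddE; apply/pterm_eq/LAddA.
Qed.
Fact paddC : commutative padd.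
Proof.
elim/pterm_ind=> t; elim/pterm_ind=> u.
by rewrite !paddE; apply/pterm_eq/LAddC.
Qed.
Fact padd0 : left_id (pterm LZero) padd.
Proof. by elim/pterm_ind=> t; rewrite paddE; apply/pterm_eq/LAdd0. Qed.
Fact paddN : left_inverse (pterm LZero) popp padd.
Proof. by elim/pterm_ind=> t; rewrite poppE paddE; apply/pterm_eq/LAddN. Qed.
HB.instance Definition _ := GRing.isZmodule.Build presented
  paddA paddC padd0 paddN.

Fact pscaleA a b x : pscale a (pscale b x) = pscale (a * b) x.
Proof. by elim/pterm_ind: x => t; rewrite !pscaleE; apply/pterm_eq/LScaleA. Qed.
Fact pscale1 : left_id 1 pscale.
Proof. by elim/pterm_ind=> t; rewrite pscaleE; apply/pterm_eq/LScale1. Qed.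
Fact pscaleDr : right_distributive pscale +%R.
Proof.
move=> a; elim/pterm_ind=> t; elim/pterm_ind=> u.
rewrite [pterm t + _]paddE !pscaleE [RHS]paddE.
by apply/pterm_eq/LScaleDr.
Qed.
Fact pscaleDl x : {morph pscale^~ x : a b / a + b}.
Proof.
move=> a b; elim/pterm_ind: x => t; rewrite !pscaleE [RHS]paddE.
by apply/pterm_eq/LScaleDl.
Qed.
HB.instance Definition _ := GRing.Zmodule_isLmodule.Build R presented
  pscaleA pscale1 pscaleDr pscaleDl.

Lemma pterm_add t u : pterm (LAdd t u) = pterm t + pterm u.
Proof. by rewrite -paddE. Qed.
Lemma pterm_scale a t : pterm (LScale a t) = a *: pterm t.
Proof. by rewrite -pscaleE. Qed.
Lemma pterm_opp t : pterm (LOpp t) = - pterm t.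
Proof. by rewrite -poppE. Qed.

End Presented.

Arguments LZero {R G}.
Arguments LGen {R G} _.
Arguments pgen {R G} rel g.

(** Functoriality along a ring morphism [r] and a map [g] of generators. *)
Section PresentedMap.
Variables (R S : comPzRingType) (r : {rmorphism R -> S}) (G H : Type).
Variables (g : G -> H).

Fixpoint lterm_map (t : lterm R G) : lterm S H :=
  match t with
  | LZero => LZero
  | LAdd t u => LAdd (lterm_map t) (lterm_map u)
  | LOpp t => LOpp (lterm_map t)
  | LScale a t => LScale (r a) (lterm_map t)
  | LGen x => LGen (g x)
  end.

Variables (relG : lterm R G -> lterm R G -> Prop).
Variables (relH : lterm S H -> lterm S H -> Prop).
Hypothesis g_rel :
  forall t u, relG t u -> lcong relH (lterm_map t) (lterm_map u).

Lemma lcong_map t u : lcong relG t u -> lcong relH (lterm_map t) (lterm_map u).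
Proof.
elim=> {t u}.
- exact: g_rel.
- by move=> *; apply: LRefl.
- by move=> *; apply: LSym.
- by move=> t u v _ tu _ uv; apply: LTrans tu uv.
- by move=> *; apply: LAddCong.
- by move=> *; apply: LOppCong.
- by move=> *; apply: LScaleCong.
- by move=> *; apply: LAddA.
- by move=> *; apply: LAddC.
- by move=> *; apply: LAdd0.
- by move=> *; apply: LAddN.
- by move=> * /=; rewrite rmorphM; apply: LScaleA.
- by move=> * /=; rewrite rmorph1; apply: LScale1.
- by move=> *; apply: LScaleDr.
- by move=> * /=; rewrite rmorphD; apply: LScaleDl.
Qed.

Definition pres_map (x : presented relG) : presented relH :=
  pterm relH (lterm_map (prop_repr x)).

Lemma pres_mapE t : pres_map (pterm relG t) = pterm relH (lterm_map t).
Proof. by apply/pterm_eq/lcong_map/prepr. Qed.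

Lemma pres_mapD x y : pres_map (x + y) = pres_map x + pres_map y.
Proof.
elim/pterm_ind: x => t; elim/pterm_ind: y => u.
by rewrite -pterm_add !pres_mapE -pterm_add.
Qed.

Lemma pres_mapZ a x : pres_map (a *: x) = r a *: pres_map x.
Proof.
by elim/pterm_ind: x => t; rewrite -pterm_scale !pres_mapE -pterm_scale.
Qed.

End PresentedMap.

Section ExteriorPower.
Variables (R : comPzRingType) (n : nat) (M : lmodType R).

Definition upd (v : 'I_n -> M) (i : 'I_n) (x : M) : 'I_n -> M :=
  fun j => if j == i then x else v j.

Inductive ext_rel : lterm R ('I_n -> M) -> lterm R ('I_n -> M) -> Prop :=
| ExtAdd v i x y : ext_rel (LGen (upd v i (x + y)))
    (LAdd (LGen (upd v i x)) (LGen (upd v i y)))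
| ExtScale v i a x : ext_rel (LGen (upd v i (a *: x)))
    (LScale a (LGen (upd v i x)))
| ExtAlt v i j : i != j -> v i = v j -> ext_rel (LGen v) LZero.

Definition ext_power := presented ext_rel.
HB.instance Definition _ := GRing.Lmodule.on ext_power.

End ExteriorPower.

Section ExteriorPowerMap.
Variables (R S : comPzRingType) (r : {rmorphism R -> S}) (n : nat).
Variables (M : lmodType R) (N : lmodType S) (f : M -> N).
Hypotheses (fD : forall x y, f (x + y) = f x + f y).
Hypotheses (fZ : forall a x, f (a *: x) = r a *: f x).

Fact ext_map_rel t u : @ext_rel R n M t u ->
  lcong (@ext_rel S n N) (lterm_map r (fun v : 'I_n -> M => f \o v) t)
                         (lterm_map r (fun v : 'I_n -> M => f \o v) u).
Proof.
have updf v i x : f \o upd v i x = @upd S n N (f \o v) i (f x).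
  by apply: funext => j; rewrite /upd /=; case: eqP.
case=> [v i x y|v i a x|v i j ij vij] /=; apply: LRel.
- by rewrite !updf fD; apply: ExtAdd.
- by rewrite !updf fZ; apply: ExtScale.
- by apply: (ExtAlt ij); rewrite /= vij.
Qed.

Definition ext_map : ext_power n M -> ext_power n N :=
  @pres_map R S r _ _ (fun v : 'I_n -> M => f \o v) (@ext_rel R n M) (@ext_rel S n N).

Lemma ext_mapE t :
  ext_map (pterm _ t) = pterm _ (lterm_map r (fun v : 'I_n -> M => f \o v) t).
Proof. exact: (pres_mapE ext_map_rel). Qed.

Lemma ext_mapD x y : ext_map (x + y) = ext_map x + ext_map y.
Proof. exact: (pres_mapD ext_map_rel). Qed.

Lemma ext_mapZ a x : ext_map (a *: x) = r a *: ext_map x.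
Proof. exact: (pres_mapZ ext_map_rel). Qed.

End ExteriorPowerMap.

Record opens (X : topologicalType) := Opens { oset :> set X; oP : open oset }.

Definition opensI (X : topologicalType) (U V : opens X) : opens X :=
  Opens (openI (oP U) (oP V)).

Lemma opensIl (X : topologicalType) (U V : opens X) : opensI U V `<=` U.
Proof. exact: subIsetl. Qed.
Lemma opensIr (X : topologicalType) (U V : opens X) : opensI U V `<=` V.
Proof. exact: subIsetr. Qed.

Definition opensT (X : topologicalType) : opens X := Opens (@openT X).

Record ringedSpace := RingedSpace {
  rs_space :> topologicalType;
  sec : opens rs_space -> comPzRingType;
  restr : forall U V : opens rs_space, V `<=` U -> {rmorphism sec U -> sec V};
  restr_id : forall (U : opens rs_space) (h : U `<=` U) s, restr h s = s;
  restr_comp : forall (U V W : opens rs_space) (h : V `<=` U) (k : W `<=` V)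
    (l : W `<=` U) s, restr k (restr h s) = restr l s;
  sec_glue : forall (U : opens rs_space) (I : Type) (V : I -> opens rs_space)
    (hV : forall i, V i `<=` U), U `<=` \bigcup_i V i ->
    forall t : forall i, sec (V i),
    (forall i j (W : opens rs_space) (hi : W `<=` V i) (hj : W `<=` V j),
       restr hi (t i) = restr hj (t j)) ->
    exists! s : sec U, forall i, restr (hV i) s = t i }.

Arguments restr {r U V} _.
Arguments restr_comp {r U V W} h k l s.

Record presheafMod (X : ringedSpace) := PresheafMod {
  msec : forall U : opens X, lmodType (sec U);
  mres : forall U V : opens X, V `<=` U -> msec U -> msec V;
  mresD : forall (U V : opens X) (h : V `<=` U) s t,
    mres h (s + t) = mres h s + mres h t;
  mresZ : forall (U V : opens X) (h : V `<=` U) a s,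
    mres h (a *: s) = restr h a *: mres h s;
  mres_id : forall (U : opens X) (h : U `<=` U) s, mres h s = s;
  mres_comp : forall (U V W : opens X) (h : V `<=` U) (k : W `<=` V)
    (l : W `<=` U) s, mres k (mres h s) = mres l s }.

Arguments mres {X} p {U V} _ _.
Arguments mres_comp {X p U V W} h k l s.

Section Mres.
Variables (X : ringedSpace) (F : presheafMod X) (U V : opens X).
Variable h : V `<=` U.

Lemma mres0 : mres F h 0 = 0.
Proof. by have := mresZ (p := F) h 0 0; rewrite scaler0 rmorph0 scale0r. Qed.
Lemma mresN s : mres F h (- s) = - mres F h s.
Proof.
by have := mresZ (p := F) h (-1) s; rewrite scaleN1r rmorphN1 scaleN1r.
Qed.

End Mres.

Definition structureMod (X : ringedSpace) : presheafMod X :=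
  @PresheafMod X (fun U => (sec U)^o) (fun U V h => restr h)
    (fun U V h => rmorphD (restr h)) (fun U V h => rmorphM (restr h))
    (@restr_id X) (@restr_comp X).

Section Stalk.
Variables (X : ringedSpace) (x : X).

Section Module.
Variable F : presheafMod X.

Record local_sec := LocalSec {
  ls_open : opens X; ls_in : oset ls_open x; ls_sec : msec F ls_open }.

Definition germ_rel (a b : local_sec) : Prop :=
  exists (W : opens X) (ha : W `<=` ls_open a) (hb : W `<=` ls_open b),
    oset W x /\ mres F ha (ls_sec a) = mres F hb (ls_sec b).

Fact germ_refl a : germ_rel a a.
Proof.
by exists (ls_open a), (@subset_refl _ _), (@subset_refl _ _); split=> //; case: a.
Qed.
Fact germ_sym a b : germ_rel a b -> germ_rel b a.
Proof. by move=> [W [ha [hb [hW e]]]]; exists W, hb, ha. Qed.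
Fact germ_trans a b c : germ_rel a b -> germ_rel b c -> germ_rel a c.
Proof.
move=> [W [ha [hb [hW e]]]] [V [kb [kc [hV e']]]].
have hWV1 : opensI W V `<=` W by move=> y [].
have hWV2 : opensI W V `<=` V by move=> y [].
exists (opensI W V), (subset_trans hWV1 ha), (subset_trans hWV2 kc).
split; first by [].
rewrite -(mres_comp ha hWV1) e -(mres_comp kc hWV2) -e'.
by rewrite !(mres_comp _ _ (subset_trans hWV1 hb)).
Qed.

Definition stalk_mod := prop_quot germ_refl germ_sym germ_trans.
HB.instance Definition _ := Choice.on stalk_mod.

Definition germ (U : opens X) (hU : oset U x) (s : msec F U) : stalk_mod :=
  prop_pi germ_refl germ_sym germ_trans (LocalSec hU s).

Lemma germ_eq U V (hU : oset U x) (hV : oset V x) s t :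
  germ hU s = germ hV t <->
  exists (W : opens X) (kU : W `<=` U) (kV : W `<=` V),
    oset W x /\ mres F kU s = mres F kV t.
Proof. exact: prop_quotP. Qed.

Lemma germ_res (U V : opens X) (h : V `<=` U) (hU : oset U x) (hV : oset V x) s :
  germ hV (mres F h s) = germ hU s.
Proof.
apply/germ_eq; exists V, (@subset_refl _ _), h; split=> //.
exact: mres_id.
Qed.

Lemma germ_ind (P : stalk_mod -> Prop) :
  (forall U (hU : oset U x) s, P (germ hU s)) -> forall a, P a.
Proof.
by move=> h a; rewrite -[a]prop_reprK; case: (prop_repr a) => U hU s; apply: h.
Qed.

Lemma germ_ind2 (P : stalk_mod -> stalk_mod -> Prop) :
  (forall U (hU : oset U x) s t, P (germ hU s) (germ hU t)) ->
  forall a b, P a b.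
Proof.
move=> h; elim/germ_ind=> U hU s; elim/germ_ind=> V hV t.
have kU : opensI U V `<=` U by move=> y [].
have kV : opensI U V `<=` V by move=> y [].
have hW : oset (opensI U V) x by [].
by rewrite -(germ_res kU hU hW) -(germ_res kV hV hW).
Qed.

Lemma germ_ind3 (P : stalk_mod -> stalk_mod -> stalk_mod -> Prop) :
  (forall U (hU : oset U x) s t u, P (germ hU s) (germ hU t) (germ hU u)) ->
  forall a b c, P a b c.
Proof.
move=> h a b c; move: c a b; elim/germ_ind => V hV u.
apply: (germ_ind2 (P := fun a b => P a b _)) => U hU s t.
have kU : opensI U V `<=` U by move=> y [].
have kV : opensI U V `<=` V by move=> y [].
have hW : oset (opensI U V) x by [].
by rewrite -!(germ_res kU hU hW) -(germ_res kV hV hW).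
Qed.

Lemma repr_germ U (hU : oset U x) s :
  exists (V : opens X) (hV : oset V x) t (W : opens X) (kU : W `<=` U)
    (kV : W `<=` V), prop_repr (germ hU s) = LocalSec hV t /\
    (oset W x /\ mres F kU s = mres F kV t).
Proof.
move e: (prop_repr (germ hU s)) => c; case: c e => V hV t e.
have : germ hU s = germ hV t by rewrite -[LHS]prop_reprK e.
by move/germ_eq=> [W [kU [kV h]]]; exists V, hV, t, W, kU, kV.
Qed.

Definition stalk_add (a b : stalk_mod) : stalk_mod :=
  let a := prop_repr a in let b := prop_repr b in
  germ (U := opensI (ls_open a) (ls_open b)) (conj (ls_in a) (ls_in b))
    (mres F (@opensIl _ _ _) (ls_sec a) + mres F (@opensIr _ _ _) (ls_sec b)).
Definition stalk_opp (a : stalk_mod) : stalk_mod :=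
  let a := prop_repr a in germ (ls_in a) (- ls_sec a).
Definition stalk_zero : stalk_mod := germ (U := opensT X) I 0.

Lemma stalk_addE U (hU : oset U x) s t :
  stalk_add (germ hU s) (germ hU t) = germ hU (s + t).
Proof.
rewrite /stalk_add.
have [V [hV [s' [W [kU [kV [-> [hW e]]]]]]]] := repr_germ hU s.
have [V' [hV' [t' [W' [kU' [kV' [-> [hW' e']]]]]]]] := repr_germ hU t.
have l1 : opensI W W' `<=` W by move=> y [].
have l2 : opensI W W' `<=` W' by move=> y [].
have l3 : opensI W W' `<=` opensI V V' by move=> y [/kV ? /kV' ?].
have l4 : opensI W W' `<=` U by move=> y [/kU].
apply/germ_eq; exists (opensI W W'), l3, l4; split=> //=.
rewrite !mresD; congr (_ + _).
  by rewrite (mres_comp _ _ (subset_trans l1 kV)) -(mres_comp kV l1) -e mres_comp.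
by rewrite (mres_comp _ _ (subset_trans l2 kV')) -(mres_comp kV' l2) -e' mres_comp.
Qed.

Lemma stalk_oppE U (hU : oset U x) s : stalk_opp (germ hU s) = germ hU (- s).
Proof.
rewrite /stalk_opp.
have [V [hV [s' [W [kU [kV [-> [hW e]]]]]]]] := repr_germ hU s.
by apply/germ_eq; exists W, kV, kU; split=> //=; rewrite !mresN e.
Qed.

Lemma germ0 U (hU : oset U x) : germ hU 0 = stalk_zero.
Proof.
have h : U `<=` opensT X by [].
by apply/germ_eq; exists U, (@subset_refl _ _), h; rewrite !mres0.
Qed.

Fact stalk_addA : associative stalk_add.
Proof. by apply: germ_ind3 => U hU s t u; rewrite !stalk_addE addrA. Qed.
Fact stalk_addC : commutative stalk_add.
Proof. by apply: germ_ind2 => U hU s t; rewrite !stalk_addE addrC. Qed.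
Fact stalk_add0 : left_id stalk_zero stalk_add.
Proof. by apply: germ_ind => U hU s; rewrite -(germ0 hU) stalk_addE add0r. Qed.
Fact stalk_addN : left_inverse stalk_zero stalk_opp stalk_add.
Proof.
by apply: germ_ind => U hU s; rewrite stalk_oppE stalk_addE addNr germ0.
Qed.
HB.instance Definition _ := GRing.isZmodule.Build stalk_mod
  stalk_addA stalk_addC stalk_add0 stalk_addN.

Lemma germD U (hU : oset U x) s t : germ hU s + germ hU t = germ hU (s + t).
Proof. exact: stalk_addE. Qed.

End Module.

Arguments germ {F U} hU s.

Definition stalk := stalk_mod (structureMod X).
HB.instance Definition _ := GRing.Zmodule.on stalk.

Definition rgerm (U : opens X) (hU : oset U x) (a : sec U) : stalk :=
  germ (F := structureMod X) hU a.

Lemma rgerm_res (U V : opens X) (h : V `<=` U) (hU : oset U x) (hV : oset V x)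
  (a : sec U) : rgerm hV (restr h a) = rgerm hU a.
Proof. exact: (@germ_res (structureMod X) U V h hU hV a). Qed.

Lemma rgerm_ind (P : stalk -> Prop) :
  (forall U (hU : oset U x) a, P (rgerm hU a)) -> forall a, P a.
Proof. exact: (@germ_ind (structureMod X) P). Qed.

Section Scale.
Variable F : presheafMod X.

Definition stalk_scale (a : stalk) (m : stalk_mod F) : stalk_mod F :=
  let a := prop_repr a in let m := prop_repr m in
  germ (U := opensI (ls_open a) (ls_open m)) (conj (ls_in a) (ls_in m))
    (restr (@opensIl _ _ _) (ls_sec a : sec _) *:
     mres F (@opensIr _ _ _) (ls_sec m)).

Lemma stalk_scaleE U (hU : oset U x) (a : sec U) (m : msec F U) :
  stalk_scale (rgerm hU a) (germ hU m) = germ hU (a *: m).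
Proof.
rewrite /stalk_scale.
have [V [hV [s' [W [kU [kV [-> [hW e]]]]]]]] := repr_germ (F := structureMod X) hU a.
have [V' [hV' [t' [W' [kU' [kV' [-> [hW' e']]]]]]]] := repr_germ hU m.
have l1 : opensI W W' `<=` W by move=> y [].
have l2 : opensI W W' `<=` W' by move=> y [].
have l3 : opensI W W' `<=` opensI V V' by move=> y [/kV ? /kV' ?].
have l4 : opensI W W' `<=` U by move=> y [/kU].
apply/germ_eq; exists (opensI W W'), l3, l4; split=> //=.
rewrite !mresZ; congr (_ *: _).
  rewrite (restr_comp _ _ (subset_trans l1 kV)) -(restr_comp kV l1).
  by move: e => /= <-; rewrite restr_comp.
by rewrite (mres_comp _ _ (subset_trans l2 kV')) -(mres_comp kV' l2) -e' mres_comp.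
Qed.

Definition stalk_one : stalk := rgerm (U := opensT X) I 1.

Lemma rgerm1 U (hU : oset U x) : rgerm hU 1 = stalk_one.
Proof.
have h : U `<=` opensT X by [].
apply/germ_eq; exists U, (@subset_refl _ _), h; split=> //=.
by rewrite !rmorph1.
Qed.

Fact stalk_scale1 : left_id stalk_one stalk_scale.
Proof.
by apply: germ_ind => U hU s; rewrite -(rgerm1 hU) stalk_scaleE scale1r.
Qed.

Lemma stalk_sec_ind (P : stalk -> stalk_mod F -> Prop) :
  (forall U (hU : oset U x) a s, P (rgerm hU a) (germ hU s)) ->
  forall a b, P a b.
Proof.
move=> h; elim/germ_ind=> U hU s; elim/germ_ind=> V hV t.
have kU : opensI U V `<=` U by move=> y [].
have kV : opensI U V `<=` V by move=> y [].
have hW : oset (opensI U V) x by [].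
by rewrite -(germ_res kU hU hW) -(germ_res kV hV hW); apply: h.
Qed.

Fact stalk_scaleDr : right_distributive stalk_scale +%R.
Proof.
move=> a b c; move: b c a; apply: germ_ind2 => U hU s t; elim/germ_ind=> V hV a.
have kU : opensI U V `<=` U by move=> y [].
have kV : opensI U V `<=` V by move=> y [].
have hW : oset (opensI U V) x by [].
rewrite -!(germ_res kU hU hW) -(germ_res kV hV hW).
rewrite germD !(stalk_scaleE hW) [RHS]germD.
by rewrite -scalerDr.
Qed.

Fact stalk_scaleDl (m : stalk_mod F) : {morph stalk_scale^~ m : a b / a + b}.
Proof.
apply: germ_ind2 => U hU s t; elim/germ_ind: m => V hV a.
have kU : opensI U V `<=` U by move=> y [].
have kV : opensI U V `<=` V by move=> y [].
have hW : oset (opensI U V) x by [].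
rewrite -!(germ_res (F := structureMod X) kU hU hW) -(germ_res kV hV hW).
rewrite [X in stalk_scale X]germD !(stalk_scaleE hW) germD.
by rewrite -scalerDl.
Qed.

End Scale.

Definition stalk_mul : stalk -> stalk -> stalk := @stalk_scale (structureMod X).

Fact stalk_scaleA F a b (m : stalk_mod F) :
  stalk_scale a (stalk_scale b m) = stalk_scale (stalk_mul a b) m.
Proof.
move: b m a; apply: stalk_sec_ind => U hU b m; elim/rgerm_ind=> V hV a.
have kU : opensI U V `<=` U by move=> y [].
have kV : opensI U V `<=` V by move=> y [].
have hW : oset (opensI U V) x by [].
rewrite -(rgerm_res kU hU hW) -(germ_res kU hU hW).
rewrite -(rgerm_res kV hV hW) !(stalk_scaleE hW).
by rewrite /stalk_mul (stalk_scaleE hW) (stalk_scaleE hW) scalerA.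
Qed.

Fact stalk_mulC : commutative stalk_mul.
Proof.
apply: germ_ind2 => U hU a b.
by rewrite /stalk_mul !(stalk_scaleE hU); congr (germ hU _); apply: mulrC.
Qed.

Fact stalk_mulA : associative stalk_mul.
Proof. by move=> a b c; apply: stalk_scaleA. Qed.

Fact stalk_mulDl : left_distributive stalk_mul +%R.
Proof. by move=> a b c; apply: stalk_scaleDl. Qed.

HB.instance Definition _ := GRing.Zmodule_isComPzRing.Build stalk
  stalk_mulA stalk_mulC (@stalk_scale1 (structureMod X)) stalk_mulDl.

HB.instance Definition _ (F : presheafMod X) :=
  GRing.Zmodule_isLmodule.Build stalk (stalk_mod F)
    (@stalk_scaleA F) (@stalk_scale1 F) (@stalk_scaleDr F) (@stalk_scaleDl F).

Lemma germZ (F : presheafMod X) U (hU : oset U x) a (m : msec F U) :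
  rgerm hU a *: germ hU m = germ hU (a *: m).
Proof. exact: stalk_scaleE. Qed.

End Stalk.

Arguments germ {X x F U} hU s.
Arguments rgerm {X x U} hU a.
Arguments stalk_mod {X} x F.
Arguments stalk {X} x.

Lemma rgermD (X : ringedSpace) (x : X) U (hU : oset U x) a b :
  rgerm hU (a + b) = rgerm hU a + rgerm hU b.
Proof. by symmetry; exact: (germD (F := structureMod X)). Qed.

Lemma rgermM (X : ringedSpace) (x : X) U (hU : oset U x) a b :
  rgerm hU (a * b) = rgerm hU a * rgerm hU b.
Proof. by symmetry; exact: (germZ (F := structureMod X)). Qed.

Lemma rgerm_one (X : ringedSpace) (x : X) U (hU : oset U x) : rgerm hU 1 = 1.
Proof. exact: rgerm1. Qed.

Section Sheafification.
Variables (X : ringedSpace) (F : presheafMod X).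

Section Sections.
Variable U : opens X.

Definition stalk_family : Type := forall y, oset U y -> stalk_mod y F.
HB.instance Definition _ := gen_eqMixin stalk_family.
HB.instance Definition _ := gen_choiceMixin stalk_family.

Lemma family_ext (f g : stalk_family) : (forall y hy, f y hy = g y hy) -> f = g.
Proof. by move=> e; apply: functional_extensionality_dep => y; apply: funext. Qed.

Definition family_add (f g : stalk_family) : stalk_family :=
  fun y hy => f y hy + g y hy.
Definition family_opp (f : stalk_family) : stalk_family := fun y hy => - f y hy.
Definition family_zero : stalk_family := fun y hy => 0.
Definition family_scale (a : sec U) (f : stalk_family) : stalk_family :=
  fun y hy => rgerm hy a *: f y hy.

Fact family_addA : associative family_add.
Proof. by move=> f g h; apply: family_ext => y hy; apply: addrA. Qed.
Fact family_addC : commutative family_add.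
Proof. by move=> f g; apply: family_ext => y hy; apply: addrC. Qed.
Fact family_add0 : left_id family_zero family_add.
Proof. by move=> f; apply: family_ext => y hy; apply: add0r. Qed.
Fact family_addN : left_inverse family_zero family_opp family_add.
Proof. by move=> f; apply: family_ext => y hy; apply: addNr. Qed.
HB.instance Definition _ := GRing.isZmodule.Build stalk_family
  family_addA family_addC family_add0 family_addN.

Fact family_scaleA a b f :
  family_scale a (family_scale b f) = family_scale (a * b) f.
Proof.
by apply: family_ext => y hy; rewrite /family_scale scalerA rgermM.
Qed.
Fact family_scale1 : left_id 1 family_scale.
Proof.
by move=> f; apply: family_ext => y hy; rewrite /family_scale rgerm_one scale1r.
Qed.
Fact family_scaleDr : right_distributive family_scale +%R.
Proof. by move=> a f g; apply: family_ext => y hy; apply: scalerDr. Qed.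
Fact family_scaleDl f : {morph family_scale^~ f : a b / a + b}.
Proof.
move=> a b; apply: family_ext => y hy; rewrite /family_scale rgermD.
exact: scalerDl.
Qed.
HB.instance Definition _ := GRing.Zmodule_isLmodule.Build (sec U) stalk_family
  family_scaleA family_scale1 family_scaleDr family_scaleDl.

Definition locally_section (f : stalk_family) : Prop :=
  forall y, oset U y -> exists (V : opens X) (hV : V `<=` U) (s : msec F V),
    oset V y /\ forall z (hz : oset V z), f z (hV z hz) = germ hz s.

Definition sheaf_pred : {pred stalk_family} := fun f => `[< locally_section f >].

Fact sheaf_submod_closed : submod_closed sheaf_pred.
Proof.
split=> [|a f g /asboolP hf /asboolP hg]; apply/asboolP => y hy.
  exists U, (@subset_refl _ _), 0; split=> // z hz.
  by rewrite germ0.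
have [V [hV [s [Vy es]]]] := hf y hy; have [W [hW [t [Wy et]]]] := hg y hy.
have k : opensI V W `<=` U by move=> z [/hV].
exists (opensI V W), k,
  (restr k a *: mres F (@opensIl _ _ _) s + mres F (@opensIr _ _ _) t).
split=> // z hz.
rewrite -germD -germZ (rgerm_res k (k z hz)).
rewrite (germ_res _ (opensIl hz)) (germ_res _ (opensIr hz)) -es -et.
congr (_ + _); last by congr (g z _); apply: Prop_irrelevance.
by congr (_ *: f z _); apply: Prop_irrelevance.
Qed.
HB.instance Definition _ :=
  GRing.isSubmodClosed.Build (sec U) stalk_family sheaf_pred sheaf_submod_closed.

Record sheaf_sec := SheafSec {
  sheaf_val : stalk_family; sheaf_valP : sheaf_val \in sheaf_pred }.
HB.instance Definition _ := [isSub for sheaf_val].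
HB.instance Definition _ := [Choice of sheaf_sec by <:].
HB.instance Definition _ := [SubChoice_isSubLmodule of sheaf_sec by <:].

End Sections.

Arguments sheaf_val {U} s y hy.

Lemma sheaf_sec_ext U (s t : sheaf_sec U) :
  (forall y (hy : oset U y), sheaf_val s y hy = sheaf_val t y hy) -> s = t.
Proof. by move=> e; apply: val_inj; apply: family_ext. Qed.

Definition family_res (U V : opens X) (h : V `<=` U) (f : stalk_family U) :
  stalk_family V := fun y hy => f y (h y hy).

Fact family_resP (U V : opens X) (h : V `<=` U) (f : sheaf_sec U) :
  family_res h (sheaf_val f) \in @sheaf_pred V.
Proof.
apply/asboolP => y hy; have /asboolP/(_ y (h y hy)) := sheaf_valP f.
move=> [W [hW [s [Wy es]]]].
exists (opensI V W), (@opensIl _ _ _), (mres F (@opensIr _ _ _) s); split=> //.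
move=> z hz; rewrite (germ_res _ (opensIr hz)) -es /family_res.
by congr (sheaf_val f z _); apply: Prop_irrelevance.
Qed.

Definition sheaf_res (U V : opens X) (h : V `<=` U) (f : sheaf_sec U) :
  sheaf_sec V := SheafSec (family_resP h f).

Fact sheaf_resD (U V : opens X) (h : V `<=` U) f g :
  sheaf_res h (f + g) = sheaf_res h f + sheaf_res h g.
Proof. exact: sheaf_sec_ext. Qed.

Fact sheaf_resZ (U V : opens X) (h : V `<=` U) a f :
  sheaf_res h (a *: f) = restr h a *: sheaf_res h f.
Proof.
apply: sheaf_sec_ext => y hy; rewrite /= /family_res.
by rewrite -[RHS]/(rgerm hy (restr h a) *: _) (rgerm_res h (h y hy)).
Qed.

Fact sheaf_res_id (U : opens X) (h : U `<=` U) f : sheaf_res h f = f.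
Proof.
apply: sheaf_sec_ext => y hy.
by congr (sheaf_val f y _); apply: Prop_irrelevance.
Qed.

Fact sheaf_res_comp (U V W : opens X) (h : V `<=` U) (k : W `<=` V)
  (l : W `<=` U) f : sheaf_res k (sheaf_res h f) = sheaf_res l f.
Proof.
apply: sheaf_sec_ext => y hy.
by congr (sheaf_val f y _); apply: Prop_irrelevance.
Qed.

Definition sheafify : presheafMod X := @PresheafMod X (fun U => sheaf_sec U)
  sheaf_res sheaf_resD sheaf_resZ sheaf_res_id sheaf_res_comp.

End Sheafification.

Section SheafHom.
Variables (X : ringedSpace) (F G : presheafMod X).

Section Sections.
Variable U : opens X.

Record shom := Shom {
  shom_map : forall V : opens X, V `<=` U -> msec F V -> msec G V;
  shom_linear : forall V hV a s t,
    @shom_map V hV (a *: s + t) = a *: @shom_map V hV s + @shom_map V hV t;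
  shom_res : forall (V W : opens X) (h : W `<=` V) hV hW s,
    @shom_map W hW (mres F h s) = mres G h (@shom_map V hV s) }.
HB.instance Definition _ := gen_eqMixin shom.
HB.instance Definition _ := gen_choiceMixin shom.

Lemma shom_ext (f g : shom) :
  (forall V hV s, @shom_map f V hV s = @shom_map g V hV s) -> f = g.
Proof.
case: f g => [f f1 f2] [g g1 g2] /= e.
have {}e : f = g.
  apply: functional_extensionality_dep => V; apply: funext => hV.
  by apply: funext => s; apply: e.
by subst g; congr Shom; apply: Prop_irrelevance.
Qed.

Section Operations.
Variables (a : sec U) (f g : shom).

Let addm (V : opens X) (hV : V `<=` U) s := shom_map f hV s + shom_map g hV s.
Let oppm (V : opens X) (hV : V `<=` U) s := - shom_map f hV s.
Let zerom (V : opens X) (hV : V `<=` U) (s : msec F V) : msec G V := 0.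
Let scalem (V : opens X) (hV : V `<=` U) s := restr hV a *: shom_map f hV s.

Fact shom_addL V hV b s t : @addm V hV (b *: s + t) = b *: addm hV s + addm hV t.
Proof. by rewrite /addm !shom_linear scalerDr addrACA. Qed.
Fact shom_addR (V W : opens X) (h : W `<=` V) hV hW s :
  @addm W hW (mres F h s) = mres G h (@addm V hV s).
Proof. by rewrite /addm mresD -!(shom_res _ h hV hW). Qed.
Definition shom_add : shom := Shom shom_addL shom_addR.

Fact shom_oppL V hV b s t : @oppm V hV (b *: s + t) = b *: oppm hV s + oppm hV t.
Proof. by rewrite /oppm shom_linear opprD scalerN. Qed.
Fact shom_oppR (V W : opens X) (h : W `<=` V) hV hW s :
  @oppm W hW (mres F h s) = mres G h (@oppm V hV s).
Proof. by rewrite /oppm mresN (shom_res _ h hV hW). Qed.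
Definition shom_opp : shom := Shom shom_oppL shom_oppR.

Fact shom_zeroL V hV b s t :
  @zerom V hV (b *: s + t) = b *: zerom hV s + zerom hV t.
Proof. by rewrite /zerom scaler0 addr0. Qed.
Fact shom_zeroR (V W : opens X) (h : W `<=` V) hV hW s :
  @zerom W hW (mres F h s) = mres G h (@zerom V hV s).
Proof. by rewrite /zerom mres0. Qed.
Definition shom_zero : shom := Shom shom_zeroL shom_zeroR.

Fact shom_scaleL V hV b s t :
  @scalem V hV (b *: s + t) = b *: scalem hV s + scalem hV t.
Proof. by rewrite /scalem shom_linear scalerDr !scalerA mulrC. Qed.
Fact shom_scaleR (V W : opens X) (h : W `<=` V) hV hW s :
  @scalem W hW (mres F h s) = mres G h (@scalem V hV s).
Proof.
by rewrite /scalem mresZ (shom_res _ h hV hW) (restr_comp _ _ hW).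
Qed.
Definition shom_scale : shom := Shom shom_scaleL shom_scaleR.

End Operations.

Fact shom_addA : associative shom_add.
Proof. by move=> f g h; apply: shom_ext => V hV s; apply: addrA. Qed.
Fact shom_addC : commutative shom_add.
Proof. by move=> f g; apply: shom_ext => V hV s; apply: addrC. Qed.
Fact shom_add0 : left_id shom_zero shom_add.
Proof. by move=> f; apply: shom_ext => V hV s; apply: add0r. Qed.
Fact shom_addN : left_inverse shom_zero shom_opp shom_add.
Proof. by move=> f; apply: shom_ext => V hV s; apply: addNr. Qed.
HB.instance Definition _ := GRing.isZmodule.Build shom
  shom_addA shom_addC shom_add0 shom_addN.

Fact shom_scaleA a b f : shom_scale a (shom_scale b f) = shom_scale (a * b) f.
Proof. by apply: shom_ext => V hV s /=; rewrite scalerA rmorphM. Qed.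
Fact shom_scale1 : left_id 1 shom_scale.
Proof. by move=> f; apply: shom_ext => V hV s /=; rewrite rmorph1 scale1r. Qed.
Fact shom_scaleDr : right_distributive shom_scale +%R.
Proof. by move=> a f g; apply: shom_ext => V hV s; apply: scalerDr. Qed.
Fact shom_scaleDl f : {morph shom_scale^~ f : a b / a + b}.
Proof.
by move=> a b; apply: shom_ext => V hV s /=; rewrite rmorphD; apply: scalerDl.
Qed.
HB.instance Definition _ := GRing.Zmodule_isLmodule.Build (sec U) shom
  shom_scaleA shom_scale1 shom_scaleDr shom_scaleDl.

End Sections.

Definition shom_restr (U V : opens X) (h : V `<=` U) (f : shom U) : shom V :=
  @Shom V (fun W hW => shom_map f (subset_trans hW h))
    (fun W hW => @shom_linear U f W (subset_trans hW h))
    (fun W W' k hW hW' => shom_res f k (subset_trans hW h) (subset_trans hW' h)).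

Fact shom_restrD (U V : opens X) (h : V `<=` U) f g :
  shom_restr h (f + g) = shom_restr h f + shom_restr h g.
Proof. exact: shom_ext. Qed.
Fact shom_restrZ (U V : opens X) (h : V `<=` U) a f :
  shom_restr h (a *: f) = restr h a *: shom_restr h f.
Proof.
apply: shom_ext => W hW s.
by rewrite /= (restr_comp _ _ (subset_trans hW h)).
Qed.
Fact shom_restr_id (U : opens X) (h : U `<=` U) f : shom_restr h f = f.
Proof.
apply: shom_ext => V hV s /=; congr (shom_map f _ s); exact: Prop_irrelevance.
Qed.
Fact shom_restr_comp (U V W : opens X) (h : V `<=` U) (k : W `<=` V)
  (l : W `<=` U) f : shom_restr k (shom_restr h f) = shom_restr l f.
Proof.
apply: shom_ext => T hT s /=; congr (shom_map f _ s); exact: Prop_irrelevance.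
Qed.

Definition sheafHom : presheafMod X := @PresheafMod X (fun U => shom U)
  shom_restr shom_restrD shom_restrZ shom_restr_id shom_restr_comp.

End SheafHom.

Section Coherence.
Variables (X : ringedSpace) (F : presheafMod X).

(** [F] need not be given as a sheaf: generation is only required locally. *)
Definition finite_type : Prop := forall x : X,
  exists (U : opens X) (k : nat) (g : 'I_k -> msec F U), oset U x /\
  forall (V : opens X) (hV : V `<=` U) (s : msec F V) (y : X), oset V y ->
  exists (W : opens X) (hW : W `<=` V) (hWU : W `<=` U) (c : 'I_k -> sec W),
    oset W y /\ mres F hW s = \sum_(i < k) c i *: mres F hWU (g i).

(** The kernel of the morphism [O_U^m -> F|_U] given by [m] sections of [F]
    over [U] is of finite type. *)
Definition relations_finite_type (U : opens X) (m : nat) (g : 'I_m -> msec F U)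
  : Prop := forall x, oset U x ->
  exists (V : opens X) (hV : V `<=` U) (k : nat) (r : 'I_k -> 'I_m -> sec V),
  [/\ oset V x,
    forall j, \sum_(i < m) r j i *: mres F hV (g i) = 0 &
    forall (W : opens X) (hW : W `<=` V) (hWU : W `<=` U) (a : 'I_m -> sec W),
      \sum_(i < m) a i *: mres F hWU (g i) = 0 ->
      forall y, oset W y ->
      exists (T : opens X) (hT : T `<=` W) (hTV : T `<=` V)
        (c : 'I_k -> sec T), oset T y /\
        forall i, restr hT (a i) = \sum_(j < k) c j * restr hTV (r j i)].

Definition coherent : Prop := finite_type /\
  forall (U : opens X) (m : nat) (g : 'I_m -> msec F U),
    relations_finite_type g.

End Coherence.

Lemma lterm_map_id (R : comPzRingType) (r : {rmorphism R -> R}) (G : Type)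
  (g : G -> G) : r =1 id -> g =1 id -> lterm_map r g =1 id.
Proof.
move=> er eg; elim=> //= [t -> u ->|t ->|a t ->|x] //.
  by rewrite er.
by rewrite eg.
Qed.

Lemma lterm_map_comp (R S T : comPzRingType) (r : {rmorphism R -> S})
  (q : {rmorphism S -> T}) (l : {rmorphism R -> T}) (G H K : Type) (g : G -> H)
  (h : H -> K) (k : G -> K) : (forall a, q (r a) = l a) ->
  (forall x, h (g x) = k x) ->
  forall t, lterm_map q h (lterm_map r g t) = lterm_map l k t.
Proof.
move=> er eg; elim=> //= [t -> u ->|t ->|a t ->|x] //.
  by rewrite er.
by rewrite eg.
Qed.

Section PresentedPresheaf.
Variables (X : ringedSpace) (G : opens X -> Type).
Variable rel : forall U, lterm (sec U) (G U) -> lterm (sec U) (G U) -> Prop.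
Variable g : forall U V : opens X, V `<=` U -> G U -> G V.
Hypothesis g_rel : forall (U V : opens X) (h : V `<=` U) t u, rel t u ->
  lcong (@rel V) (lterm_map (restr h) (g h) t) (lterm_map (restr h) (g h) u).
Hypothesis g_id : forall (U : opens X) (h : U `<=` U) x, g h x = x.
Hypothesis g_comp : forall (U V W : opens X) (h : V `<=` U) (k : W `<=` V)
  (l : W `<=` U) x, g k (g h x) = g l x.

Definition pres_res (U V : opens X) (h : V `<=` U) :
  presented (@rel U) -> presented (@rel V) :=
  @pres_map _ _ (restr h) _ _ (g h) (@rel U) (@rel V).

Fact pres_resD (U V : opens X) (h : V `<=` U) s t :
  pres_res h (s + t) = pres_res h s + pres_res h t.
Proof. exact: (pres_mapD (@g_rel U V h)). Qed.

Fact pres_resZ (U V : opens X) (h : V `<=` U) a s :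
  pres_res h (a *: s) = restr h a *: pres_res h s.
Proof. exact: (pres_mapZ (@g_rel U V h)). Qed.

Fact pres_res_id (U : opens X) (h : U `<=` U) s : pres_res h s = s.
Proof.
elim/pterm_ind: s => t; rewrite [LHS](pres_mapE (@g_rel U U h)).
by rewrite (lterm_map_id (restr_id h) (@g_id U h)).
Qed.

Fact pres_res_comp (U V W : opens X) (h : V `<=` U) (k : W `<=` V)
  (l : W `<=` U) s : pres_res k (pres_res h s) = pres_res l s.
Proof.
elim/pterm_ind: s => t; rewrite /pres_res (pres_mapE (@g_rel U V h)).
rewrite (pres_mapE (@g_rel V W k)) (pres_mapE (@g_rel U W l)).
congr pterm; apply: lterm_map_comp; first exact: restr_comp.
exact: g_comp.
Qed.

Definition presentedMod : presheafMod X :=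
  @PresheafMod X (fun U => presented (@rel U))
    pres_res pres_resD pres_resZ pres_res_id pres_res_comp.

End PresentedPresheaf.

(** The exterior power of an [O_X]-module is the sheaf associated with
    [U |-> ext_power n (F U)]. *)
Section ExteriorPowerSheaf.
Variables (X : ringedSpace) (n : nat) (F : presheafMod X).

Fact ext_pre_id (U : opens X) (h : U `<=` U) (v : 'I_n -> msec F U) :
  mres F h \o v = v.
Proof. by apply: funext => i; apply: mres_id. Qed.

Fact ext_pre_comp (U V W : opens X) (h : V `<=` U) (k : W `<=` V)
  (l : W `<=` U) (v : 'I_n -> msec F U) :
  mres F k \o (mres F h \o v) = mres F l \o v.
Proof. by apply: funext => i; apply: mres_comp. Qed.

Definition exteriorPresheaf : presheafMod X :=
  presentedMod (fun U V h => ext_map_rel (r := restr h) (f := mres F h)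
                               (mresD h) (mresZ h))
    ext_pre_id ext_pre_comp.

Definition exteriorPower : presheafMod X := sheafify exteriorPresheaf.

End ExteriorPowerSheaf.

Definition preim (X Y : topologicalType) (f : X -> Y) (cf : continuous f)
  (V : opens Y) : opens X :=
  Opens (open_comp (fun x _ => cf x) (oP V)).

Record rsMorphism (X Y : ringedSpace) := RsMorphism {
  mfun :> X -> Y;
  mcont : continuous mfun;
  msharp : forall V : opens Y, {rmorphism sec V -> sec (preim mcont V)};
  msharp_nat : forall (V W : opens Y) (h : W `<=` V)
    (k : preim mcont W `<=` preim mcont V) s,
    restr k (msharp V s) = msharp W (restr h s) }.

Arguments msharp {X Y} r {V}.
Arguments mcont : clear implicits.
Arguments mcont {X Y} r.

(** Equality of morphisms, the two sections [f^# s] and [g^# s] being compared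
    on the open sets where both are defined. *)
Definition mor_eq (X Y : ringedSpace) (f g : rsMorphism X Y) : Prop :=
  f =1 g /\ forall (V : opens Y) (s : sec V) (W : opens X)
    (hf : W `<=` preim (mcont f) V) (hg : W `<=` preim (mcont g) V),
    restr hf (msharp f s) = restr hg (msharp g s).

Section IdMorphism.
Variable X : ringedSpace.

Fact id_cont : continuous (@id X).
Proof. by move=> x. Qed.

Fact id_preim (V : opens X) : preim id_cont V `<=` V.
Proof. by []. Qed.

Fact id_nat (V W : opens X) (h : W `<=` V)
  (k : preim id_cont W `<=` preim id_cont V) (s : sec V) :
  restr k (restr (@id_preim V) s) = restr (@id_preim W) (restr h s).
Proof.
by rewrite !(restr_comp _ _ (subset_trans (@id_preim W) h)).
Qed.

Definition id_mor : rsMorphism X X := RsMorphism id_nat.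

End IdMorphism.

Section CompMorphism.
Variables (X Y Z : ringedSpace) (g : rsMorphism Y Z) (f : rsMorphism X Y).

Fact comp_cont : continuous (g \o f).
Proof. by move=> x; apply: continuous_comp; apply: mcont. Qed.

Fact comp_preim (V : opens Z) :
  preim comp_cont V `<=` preim (mcont f) (preim (mcont g) V).
Proof. by []. Qed.

Definition comp_sharp (V : opens Z) : {rmorphism sec V -> sec (preim comp_cont V)}
  := restr (@comp_preim V) \o (msharp f \o msharp g).

Fact comp_nat (V W : opens Z) (h : W `<=` V)
  (k : preim comp_cont W `<=` preim comp_cont V) (s : sec V) :
  restr k (comp_sharp V s) = comp_sharp W (restr h s).
Proof.
have kg : preim (mcont g) W `<=` preim (mcont g) V by move=> y /h.
have kf : preim (mcont f) (preim (mcont g) W) `<=`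
          preim (mcont f) (preim (mcont g) V) by move=> y /h.
rewrite /= -(msharp_nat h kg) -(msharp_nat kg kf).
by rewrite !(restr_comp _ _ (subset_trans (@comp_preim W) kf)).
Qed.

Definition comp_mor : rsMorphism X Z := RsMorphism comp_nat.

End CompMorphism.

Section Pullback.
Variables (X Y : ringedSpace) (f : rsMorphism X Y) (F : presheafMod Y).

Record pull_gen (U : opens X) := PullGen {
  pg_open : opens Y; pg_sub : U `<=` preim (mcont f) pg_open;
  pg_sec : msec F pg_open }.

(** Generators and relations for the [O_X(U)]-module
    [colim_(V >= f(U)) O_X(U) (x)_(O_Y(V)) F(V)], whose associated sheaf is
    [f^* F = O_X (x)_(f^-1 O_Y) f^-1 F]. *)
Inductive pull_rel (U : opens X) :
  lterm (sec U) (pull_gen U) -> lterm (sec U) (pull_gen U) -> Prop :=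
| PullAdd V (h : U `<=` preim (mcont f) V) s t :
    pull_rel (LGen (PullGen h (s + t)))
      (LAdd (LGen (PullGen h s)) (LGen (PullGen h t)))
| PullScale V (h : U `<=` preim (mcont f) V) a s :
    pull_rel (LGen (PullGen h (a *: s)))
      (LScale (restr h (msharp f a)) (LGen (PullGen h s)))
| PullRes (V W : opens Y) (k : W `<=` V) (h : U `<=` preim (mcont f) V)
    (h' : U `<=` preim (mcont f) W) s :
    pull_rel (LGen (PullGen h' (mres F k s))) (LGen (PullGen h s)).

Definition pull_res (U V : opens X) (h : V `<=` U) (x : pull_gen U) : pull_gen V
  := PullGen (subset_trans h (@pg_sub U x)) (pg_sec x).

Fact pull_res_rel (U V : opens X) (h : V `<=` U) t u : pull_rel t u ->
  lcong (@pull_rel V) (lterm_map (restr h) (pull_res h) t)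
                      (lterm_map (restr h) (pull_res h) u).
Proof.
case=> [W k s t'|W k a s|W W' k l l' s] /=; apply: LRel; rewrite /pull_res /=.
- exact: PullAdd.
- by rewrite (restr_comp _ _ (subset_trans h k)); apply: PullScale.
- exact: PullRes.
Qed.

Fact pull_res_id (U : opens X) (h : U `<=` U) x : pull_res h x = x.
Proof.
by case: x => V k s; congr PullGen; apply: Prop_irrelevance.
Qed.

Fact pull_res_comp (U V W : opens X) (h : V `<=` U) (k : W `<=` V)
  (l : W `<=` U) x : pull_res k (pull_res h x) = pull_res l x.
Proof. by congr PullGen; apply: Prop_irrelevance. Qed.

Definition pullback : presheafMod X :=
  sheafify (presentedMod pull_res_rel pull_res_id pull_res_comp).

End Pullback.

Section Conormal.
Variables (X Y : ringedSpace) (f : rsMorphism X Y).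

Section Kernel.
Variable U : opens Y.

Definition ker_pred : {pred (sec U)^o} := fun a => msharp f (a : sec U) == 0.

Fact ker_submod_closed : submod_closed ker_pred.
Proof.
split=> [|a s t /eqP hs /eqP ht]; first by rewrite unfold_in /ker_pred rmorph0.
rewrite unfold_in /ker_pred rmorphD [a *: s]/(a * (s : sec U)) rmorphM hs ht.
by rewrite mulr0 addr0.
Qed.
HB.instance Definition _ :=
  GRing.isSubmodClosed.Build (sec U) (sec U)^o ker_pred ker_submod_closed.

Record ker_sec := KerSec { ker_val : (sec U)^o; ker_valP : ker_val \in ker_pred }.
HB.instance Definition _ := [isSub for ker_val].
HB.instance Definition _ := [Choice of ker_sec by <:].
HB.instance Definition _ := [SubChoice_isSubLmodule of ker_sec by <:].

(** Presents [I(U) / I(U)^2], where [I] is the kernel of [f^#]. *)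
Inductive conormal_rel : lterm (sec U) ker_sec -> lterm (sec U) ker_sec -> Prop :=
| ConAdd a b : conormal_rel (LGen (a + b)) (LAdd (LGen a) (LGen b))
| ConScale c a : conormal_rel (LGen (c *: a)) (LScale c (LGen a))
| ConSquare a b : conormal_rel (LGen ((ker_val a : sec U) *: b)) LZero.

End Kernel.

Fact ker_resP (U V : opens Y) (h : V `<=` U) (a : ker_sec U) :
  restr h (ker_val a) \in @ker_pred V.
Proof.
have k : preim (mcont f) V `<=` preim (mcont f) U by move=> x /h.
have /eqP e := ker_valP a.
by rewrite unfold_in /ker_pred -(msharp_nat h k) e rmorph0.
Qed.

Definition ker_res (U V : opens Y) (h : V `<=` U) (a : ker_sec U) : ker_sec V :=
  KerSec (ker_resP h a).

Fact ker_res_rel (U V : opens Y) (h : V `<=` U) t u : conormal_rel t u ->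
  lcong (@conormal_rel V) (lterm_map (restr h) (ker_res h) t)
                          (lterm_map (restr h) (ker_res h) u).
Proof.
case=> [a b|c a|a b] /=; apply: LRel.
- have -> : ker_res h (a + b) = ker_res h a + ker_res h b.
    by apply: val_inj; apply: rmorphD.
  exact: ConAdd.
- have -> : ker_res h (c *: a) = restr h c *: ker_res h a.
    by apply: val_inj; apply: rmorphM.
  exact: ConScale.
- have -> : ker_res h ((ker_val a : sec U) *: b) =
            (ker_val (ker_res h a) : sec V) *: ker_res h b.
    by apply: val_inj; apply: rmorphM.
  exact: ConSquare.
Qed.

Fact ker_res_id (U : opens Y) (h : U `<=` U) x : ker_res h x = x.
Proof. by apply: val_inj; apply: restr_id. Qed.

Fact ker_res_comp (U V W : opens Y) (h : V `<=` U) (k : W `<=` V)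
  (l : W `<=` U) x : ker_res k (ker_res h x) = ker_res l x.
Proof. by apply: val_inj; apply: restr_comp. Qed.

Definition conormal : presheafMod Y :=
  sheafify (presentedMod ker_res_rel ker_res_id ker_res_comp).

End Conormal.

Section Zariski.
Variable A : comPzRingType.

HB.instance Definition _ := gen_eqMixin (prime_ideal A).
HB.instance Definition _ := gen_choiceMixin (prime_ideal A).

Definition zariski_open : set_system (prime_ideal A) :=
  [set U | exists I : set A, U = [set p | ~ I `<=` pset p]].

Fact zariski_openT : zariski_open setT.
Proof.
exists setT; apply/seteqP; split=> // p _ /(_ 1 Logic.I); exact: pset1.
Qed.

Fact zariski_openI : setI_closed zariski_open.
Proof.
move=> _ _ [I ->] [J ->].
exists [set c | exists a b, [/\ I a, J b & c = a * b]].
apply/seteqP; split=> [p [hI hJ] h|p h].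
  apply: hI => a Ia; apply: contrapT => na; apply: hJ => b Jb.
  by have [|] // := @psetM _ p a b (h _ (ex_intro _ a (ex_intro _ b (And3 Ia Jb erefl)))).
have [_ _ pM] := pset_ideal p.
split=> k; apply: h => _ [a [b [Ia Jb ->]]]; last by apply: pM; apply: k.
by rewrite mulrC; apply: pM; apply: k.
Qed.

Fact zariski_open_bigU (T : Type) (f : T -> set (prime_ideal A)) :
  (forall i, zariski_open (f i)) -> zariski_open (\bigcup_i f i).
Proof.
move=> /choice[I fE]; exists (\bigcup_i I i); apply/seteqP; split=> p.
  by move=> [i _]; rewrite fE => h k; apply: h => a Ia; apply: k; exists i.
move=> h; apply: contrapT => k; apply: h => a [i _ Ia].
apply: contrapT => na; apply: k; exists i => //; rewrite fE => h.
exact/na/h.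
Qed.

HB.instance Definition _ := isOpenTopological.Build (prime_ideal A)
  zariski_openT zariski_openI zariski_open_bigU.

End Zariski.

Section Spec.
Variable A : comPzRingType.

Section Sections.
Variable U : opens (prime_ideal A).

Definition prime_family : Type := forall p, oset U p -> loc_ring p.
HB.instance Definition _ := gen_eqMixin prime_family.
HB.instance Definition _ := gen_choiceMixin prime_family.

Lemma prime_family_ext (f g : prime_family) :
  (forall p hp, f p hp = g p hp) -> f = g.
Proof. by move=> e; apply: functional_extensionality_dep => p; apply: funext. Qed.

Definition pfam_add (f g : prime_family) : prime_family :=
  fun p hp => f p hp + g p hp.
Definition pfam_opp (f : prime_family) : prime_family := fun p hp => - f p hp.
Definition pfam_zero : prime_family := fun p hp => 0.
Definition pfam_mul (f g : prime_family) : prime_family :=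
  fun p hp => f p hp * g p hp.
Definition pfam_one : prime_family := fun p hp => 1.

Fact pfam_addA : associative pfam_add.
Proof. by move=> f g h; apply: prime_family_ext => p hp; apply: addrA. Qed.
Fact pfam_addC : commutative pfam_add.
Proof. by move=> f g; apply: prime_family_ext => p hp; apply: addrC. Qed.
Fact pfam_add0 : left_id pfam_zero pfam_add.
Proof. by move=> f; apply: prime_family_ext => p hp; apply: add0r. Qed.
Fact pfam_addN : left_inverse pfam_zero pfam_opp pfam_add.
Proof. by move=> f; apply: prime_family_ext => p hp; apply: addNr. Qed.
HB.instance Definition _ := GRing.isZmodule.Build prime_family
  pfam_addA pfam_addC pfam_add0 pfam_addN.

Fact pfam_mulA : associative pfam_mul.
Proof. by move=> f g h; apply: prime_family_ext => p hp; apply: mulrA. Qed.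
Fact pfam_mulC : commutative pfam_mul.
Proof. by move=> f g; apply: prime_family_ext => p hp; apply: mulrC. Qed.
Fact pfam_mul1 : left_id pfam_one pfam_mul.
Proof. by move=> f; apply: prime_family_ext => p hp; apply: mul1r. Qed.
Fact pfam_mulDl : left_distributive pfam_mul +%R.
Proof. by move=> f g h; apply: prime_family_ext => p hp; apply: mulrDl. Qed.
HB.instance Definition _ := GRing.Zmodule_isComPzRing.Build prime_family
  pfam_mulA pfam_mulC pfam_mul1 pfam_mulDl.

Definition locally_fraction (f : prime_family) : Prop :=
  forall p, oset U p -> exists (V : opens (prime_ideal A)) (hV : V `<=` U)
    (a b : A), oset V p /\
    forall q (hq : oset V q), exists hb : ~ pset q b,
      f q (hV q hq) = mkfrac (a : A^o) hb.

Definition spec_pred : {pred prime_family} := fun f => `[< locally_fraction f >].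

Lemma spec_pred2 (f g h : prime_family) : f \in spec_pred -> g \in spec_pred ->
  (forall a b c d : A, exists e k : A, forall q hq
    (hb : ~ pset q b) (hd : ~ pset q d),
    f q hq = mkfrac (a : A^o) hb -> g q hq = mkfrac (c : A^o) hd ->
    exists hk : ~ pset q k, h q hq = mkfrac (e : A^o) hk) ->
  h \in spec_pred.
Proof.
move=> /asboolP hf /asboolP hg H; apply/asboolP => p hp.
have [V [hV [a [b [Vp ef]]]]] := hf p hp.
have [W [hW [c [d [Wp eg]]]]] := hg p hp.
have [e [k ek]] := H a b c d.
have l : opensI V W `<=` U by move=> q [/hV].
exists (opensI V W), l, e, k; split=> // q hq.
have [hb {}ef] := ef q (opensIl hq); have [hd {}eg] := eg q (opensIr hq).
apply: (ek q (l q hq) hb hd); [rewrite -ef|rewrite -eg].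
  by congr (f q _); apply: Prop_irrelevance.
by congr (g q _); apply: Prop_irrelevance.
Qed.

Fact spec_subring_closed : subring_closed spec_pred.
Proof.
split=> [|f g hf hg|f g hf hg].
- apply/asboolP => p hp; exists U, (@subset_refl _ _), 1, 1; split=> // q hq.
  by exists (@pset1 _ q).
- apply: (spec_pred2 hf hg) => a b c d.
  exists (d * a - b * c), (d * b) => q hq hb hd ef eg.
  have hdb := pset_mulN hd hb; have hbd : ~ pset q (b * d) by rewrite mulrC.
  exists hdb; rewrite [LHS]/(f q hq - g q hq) ef eg.
  rewrite (mkfrac_expand _ hb hd hdb) (mkfrac_expand _ hd hb hbd).
  have -> : mkfrac (b *: (c : A^o)) hbd = mkfrac (b *: (c : A^o)) hdb.
    by move: hbd; rewrite mulrC => hbd; congr mkfrac; apply: Prop_irrelevance.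
  by apply: etrans (mkfracD _ _ hdb); congr (_ + _); apply: loc_oppE.
- apply: (spec_pred2 hf hg) => a b c d.
  exists (a * c), (b * d) => q hq hb hd ef eg.
  exists (pset_mulN hb hd); rewrite [LHS]/(f q hq * g q hq) ef eg.
  exact: loc_scaleE.
Qed.
HB.instance Definition _ :=
  GRing.isSubringClosed.Build prime_family spec_pred spec_subring_closed.

Record spec_sec := SpecSec {
  spec_val : prime_family; spec_valP : spec_val \in spec_pred }.
HB.instance Definition _ := [isSub for spec_val].
HB.instance Definition _ := [Choice of spec_sec by <:].
HB.instance Definition _ := GRing.SubChoice_isSubComPzRing.Build
  prime_family spec_pred spec_sec spec_subring_closed.

End Sections.

Arguments spec_val {U} s p hp.

Lemma spec_sec_ext U (s t : spec_sec U) :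
  (forall p (hp : oset U p), spec_val s p hp = spec_val t p hp) -> s = t.
Proof. by move=> e; apply: val_inj; apply: prime_family_ext. Qed.

Definition prime_family_res (U V : opens (prime_ideal A)) (h : V `<=` U)
  (f : prime_family U) : prime_family V := fun p hp => f p (h p hp).

Fact spec_resP (U V : opens (prime_ideal A)) (h : V `<=` U) (f : spec_sec U) :
  prime_family_res h (spec_val f) \in @spec_pred V.
Proof.
apply/asboolP => p hp; have /asboolP/(_ p (h p hp)) := spec_valP f.
move=> [W [hW [a [b [Wp ef]]]]].
exists (opensI V W), (@opensIl _ _ _), a, b; split=> // q hq.
have [hb {}ef] := ef q (opensIr hq); exists hb; rewrite -ef.
by congr (spec_val f q _); apply: Prop_irrelevance.
Qed.

Section Restriction.
Variables (U V : opens (prime_ideal A)) (h : V `<=` U).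

Definition spec_res (f : spec_sec U) : spec_sec V := SpecSec (spec_resP h f).

Fact spec_res_zmod : zmod_morphism spec_res.
Proof. by move=> f g; apply: spec_sec_ext. Qed.
Fact spec_res_monoid : monoid_morphism spec_res.
Proof. by split=> [|f g]; apply: spec_sec_ext. Qed.
HB.instance Definition _ :=
  GRing.isZmodMorphism.Build _ _ spec_res spec_res_zmod.
HB.instance Definition _ :=
  GRing.isMonoidMorphism.Build _ _ spec_res spec_res_monoid.

End Restriction.

Fact spec_res_id (U : opens (prime_ideal A)) (h : U `<=` U) f :
  spec_res h f = f.
Proof.
apply: spec_sec_ext => p hp.
by congr (spec_val f p _); apply: Prop_irrelevance.
Qed.

Fact spec_res_comp (U V W : opens (prime_ideal A)) (h : V `<=` U) (k : W `<=` V)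
  (l : W `<=` U) f : spec_res k (spec_res h f) = spec_res l f.
Proof.
apply: spec_sec_ext => p hp.
by congr (spec_val f p _); apply: Prop_irrelevance.
Qed.

Fact spec_glue (U : opens (prime_ideal A)) (I : Type)
  (V : I -> opens (prime_ideal A)) (hV : forall i, V i `<=` U) :
  U `<=` \bigcup_i V i -> forall t : forall i, spec_sec (V i),
  (forall i j (W : opens (prime_ideal A)) (hi : W `<=` V i) (hj : W `<=` V j),
     spec_res hi (t i) = spec_res hj (t j)) ->
  exists! s : spec_sec U, forall i, spec_res (hV i) s = t i.
Proof.
move=> cov t agree.
have idx p (hp : oset U p) : {i | oset (V i) p}.
  by apply: cid; have [i _ hi] := cov p hp; exists i.
pose f : prime_family U := fun p hp => spec_val (t (sval (idx p hp))) p (svalP (idx p hp)).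
have fE i p (hp : oset U p) (hi : oset (V i) p) : f p hp = spec_val (t i) p hi.
  rewrite /f; case: (idx p hp) => j hj /=.
  have := agree j i (opensI (V j) (V i)) (@opensIl _ _ _) (@opensIr _ _ _).
  move=> /(congr1 (fun s : spec_sec (opensI (V j) (V i)) => spec_val s p (conj hj hi))).
  rewrite /= /prime_family_res => e.
  transitivity (spec_val (t j) p (opensIl (conj hj hi))).
    by congr (spec_val (t j) p _); apply: Prop_irrelevance.
  by rewrite e; congr (spec_val (t i) p _); apply: Prop_irrelevance.
have fP : f \in @spec_pred U.
  apply/asboolP => p hp; have [i _ hi] := cov p hp.
  have /asboolP/(_ p hi)[W [hW [a [b [Wp ef]]]]] := spec_valP (t i).
  exists W, (subset_trans hW (hV i)), a, b; split=> // q hq.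
  by have [hb {}ef] := ef q hq; exists hb; rewrite (fE i q _ (hW q hq)).
exists (SpecSec fP); split=> [i|s hs].
  by apply: spec_sec_ext => p hp; apply: fE.
apply: spec_sec_ext => p hp; have [i _ hi] := cov p hp.
rewrite [LHS](fE i p hp hi) -hs /= /prime_family_res.
by congr (spec_val s p _); apply: Prop_irrelevance.
Qed.

Definition Spec : ringedSpace := @RingedSpace (prime_ideal A)
  (fun U => spec_sec U) spec_res spec_res_id spec_res_comp spec_glue.

End Spec.

(** [f] is an isomorphism of ringed spaces onto an open subspace. *)
Definition open_immersion (X Y : ringedSpace) (f : rsMorphism X Y) : Prop :=
  [/\ injective f,
      forall U : opens X, open (f @` U) &
      forall V : opens Y, V `<=` range f -> bijective (@msharp _ _ f V)].

Record scheme := Scheme {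
  sch_space :> ringedSpace;
  sch_local : forall x : sch_space, is_local (stalk x);
  sch_affine : forall x : sch_space, exists (A : comPzRingType)
    (j : rsMorphism (Spec A) sch_space), open_immersion j /\ range j x }.

Definition locally_noetherian (X : scheme) : Prop := forall x : X,
  exists (A : comPzRingType) (j : rsMorphism (Spec A) X),
    [/\ noetherian A, open_immersion j & range j x].

(** Morphisms of schemes: the maps induced on stalks are local. *)
Definition local_mor (X Y : ringedSpace) (f : rsMorphism X Y) : Prop :=
  forall (x : X) (V : opens Y) (hV : oset V (f x)) (s : sec V),
    is_unit (rgerm (U := preim (mcont f) V) hV (msharp f s)) ->
    is_unit (rgerm hV s).

Record schMorphism (X Y : scheme) := SchMorphism {
  sch_mor :> rsMorphism X Y; sch_morP : local_mor sch_mor }.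

Section SchemeCategory.

Lemma is_unit_morph (R S : comPzRingType) (f : {rmorphism R -> S}) a :
  is_unit a -> is_unit (f a).
Proof. by move=> [b e]; exists (f b); rewrite -rmorphM e rmorph1. Qed.

Fact id_local (X : ringedSpace) : local_mor (@id_mor X).
Proof. by move=> x V hV s; rewrite (rgerm_res _ hV). Qed.

Definition sch_id (X : scheme) : schMorphism X X := SchMorphism (@id_local X).

Fact comp_local (X Y Z : ringedSpace) (g : rsMorphism Y Z) (f : rsMorphism X Y) :
  local_mor g -> local_mor f -> local_mor (comp_mor g f).
Proof.
move=> hg hf x V hV s; rewrite /= rgerm_res // => u.
exact/hg/hf.
Qed.

Definition sch_comp (X Y Z : scheme) (g : schMorphism Y Z) (f : schMorphism X Y) :
  schMorphism X Z := SchMorphism (comp_local (sch_morP (s := g)) (sch_morP (s := f))).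

End SchemeCategory.

Record fiberProduct (X Y S : scheme) (f : schMorphism X S) (g : schMorphism Y S)
  := FiberProduct {
  fp_obj :> scheme;
  fp_fst : schMorphism fp_obj X;
  fp_snd : schMorphism fp_obj Y;
  fp_comm : mor_eq (sch_comp f fp_fst) (sch_comp g fp_snd);
  fp_univ : forall (T : scheme) (a : schMorphism T X) (b : schMorphism T Y),
    mor_eq (sch_comp f a) (sch_comp g b) ->
    exists c : schMorphism T fp_obj,
      [/\ mor_eq (sch_comp fp_fst c) a, mor_eq (sch_comp fp_snd c) b &
        forall d : schMorphism T fp_obj,
          mor_eq (sch_comp fp_fst d) a -> mor_eq (sch_comp fp_snd d) b ->
          mor_eq d c] }.

Lemma mor_eq_refl (X Y : ringedSpace) (f : rsMorphism X Y) : mor_eq f f.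
Proof. by split=> // V s W h k; rewrite (Prop_irrelevance h k). Qed.

Section Kahler.
Variables (X Y : scheme) (phi : schMorphism X Y) (P : fiberProduct phi phi).

Definition diagonal : schMorphism X P :=
  projT1 (cid (fp_univ P (mor_eq_refl (sch_comp phi (sch_id X))))).

Definition Omega1 : presheafMod X := pullback diagonal (conormal diagonal).

Definition Omega (n : nat) : presheafMod X := exteriorPower n Omega1.

Definition Der (n : nat) : presheafMod X := sheafHom (Omega n) (structureMod X).

End Kahler.

(* Main.v *)
(* Every stalk of [Omega] is a finitely presented module [M] over the Noetherian
   local ring [R] of [x], and a presentation [R^a -> R^k -> M -> 0] by local
   sections identifies the stalk of [Der] with the kernel of the transposed map
   [R^k -> R^a], that is with [M^*].  The three conditions are shown to be
   equivalent to the injectivity of [M -> M^**].  The only hard implication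
   starts from (S1~).  If [x] in the kernel of [M -> M^**] has a prime
   annihilator [q], then [M_q], and hence [R_q], has depth 0, so that [q] is
   associated to [R] and [M^*_q] has finite Gorenstein dimension.  Over a ring
   of depth 0 a module with zero dual is zero, from which one sees that the
   cokernel of an injection of (almost) totally reflexive modules is again of
   this kind; so [M^*_q] is, and dualizing [0 -> M^* -> R^k -> R^a] at [q] shows
   that the image of [x] in [M_q] is zero. *)
From HB Require Import structures.
From mathcomp Require Import all_boot all_order all_algebra.
From mathcomp Require Import boolp classical_sets topology_structure constructive_ereal.
Require Import Defs.
Set Implicit Arguments. Unset Strict Implicit. Unset Printing Implicit Defensive.
Import Order.TTheory GRing.Theory.
Local Open Scope classical_set_scope.
Local Open Scope ring_scope.

(** * Modules *)

(** At a prime where the ring has depth 0, the Auslander-Bridger formula would say that finite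
    G-dimension means G-dimension 0. Climbing the resolution from its vanishing end takes the place
    of that formula: every syzygy is the cokernel of an injection. The dual of such a cokernel C of
    Z -> B is the kernel of B^* -> Z^*, and the vanishing of Ext has to pass to it. This needs a
    piece of the long exact sequence, obtained below from fibre products of covers. Several usual
    identifications are avoided. The localization of M^* is not compared with the dual of M_q, nor
    the localization of R^k with row vectors over R_q, nor a stalk of the structure sheaf with a
    localization of a ring. An exact sequence 0 -> M^* -> R^k -> R^a, a dual basis, and a map from
    which all ideals are extended serve instead. *)

Section Hom.
Variable R : comPzRingType.
Implicit Types M N : lmodType R.

Definition mkhom M N (f : M -> N) (hf : linear f) : hom M N :=
  HB.pack f (GRing.isLinear.Build R M N *:%R f hf).

(** Maps out of quotients, images and stalks arise as relations. Subtracting two pairs with the same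
    first entry reduces single-valuedness to the fibre over 0. *)
Lemma graph_hom M N (G : M -> N -> Prop) :
  (forall x, exists y, G x y) ->
  (forall a x y x' y', G x y -> G x' y' -> G (a *: x + x') (a *: y + y')) ->
  (forall y, G 0 y -> y = 0) ->
  exists f : hom M N, forall x y, G x y -> f x = y.
Proof.
move=> tot lin G0.
have fun_ x y y' : G x y -> G x y' -> y = y'.
  move=> h h'; have := lin (-1) _ _ _ _ h' h.
  rewrite !scaleN1r addNr => /G0 /eqP; rewrite addrC subr_eq0.
  by move/eqP.
have [f hf] := choice tot.
have lf : linear f by move=> a x y; apply: fun_ (hf _) _; apply: lin.
by exists (mkhom lf) => x y; apply: fun_; apply: hf.
Qed.

Lemma hom_factor M N P (g : hom M N) (u : hom M P) : surjective g ->
  (forall x, g x = 0 -> u x = 0) -> exists v : hom N P, forall x, v (g x) = u x.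
Proof.
move=> sg ker.
have [|a _ _ _ _ [x [<- <-]] [x' [<- <-]]|y [x [gx <-]]|v hv] :=
  @graph_hom N P (fun y z => exists x, g x = y /\ u x = z).
- by move=> y; have [x gx] := sg y; exists (u x), x.
- by exists (a *: x + x'); rewrite !linearP.
- exact: ker.
- by exists v => x; apply: hv; exists x.
Qed.

End Hom.

Section Submodule.
Variables (R : comPzRingType) (M : lmodType R).

Record submodule := Submodule {
  smem :> M -> Prop;
  smem0 : smem 0;
  smemP : forall a x y, smem x -> smem y -> smem (a *: x + y) }.

Variable K : submodule.

Definition smem_pred : {pred M} := fun x => `[< K x >].

Fact smem_submod_closed : submod_closed smem_pred.
Proof.
split; first by apply/asboolP/smem0.
by move=> a x y /asboolP hx /asboolP hy; apply/asboolP/smemP.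
Qed.
HB.instance Definition _ :=
  GRing.isSubmodClosed.Build R M smem_pred smem_submod_closed.

Record subm := Subm { subm_val : M; subm_valP : subm_val \in smem_pred }.
HB.instance Definition _ := [isSub for subm_val].
HB.instance Definition _ := [Choice of subm by <:].
HB.instance Definition _ := [SubChoice_isSubLmodule of subm by <:].

Lemma subm_val_linear : linear subm_val. Proof. by []. Qed.

(* Opaque, so that simplification keeps the inclusion folded. *)
Fact subm_incl_subproof : {f : hom subm M | f =1 subm_val}.
Proof. by exists (mkhom subm_val_linear). Qed.

Definition subm_incl : hom subm M := sval subm_incl_subproof.

Lemma subm_inclE : subm_incl =1 subm_val.
Proof. exact: (svalP subm_incl_subproof). Qed.

Lemma subm_incl_inj : injective subm_incl.
Proof. by move=> x y; rewrite !subm_inclE; apply: val_inj. Qed.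

Lemma subm_incl_mem x : K (subm_incl x).
Proof. by rewrite subm_inclE; case: x => x /= /asboolP. Qed.

Lemma subm_inclP y : K y -> exists x, subm_incl x = y.
Proof. by move=> /asboolP h; exists (Subm h); rewrite subm_inclE. Qed.

Lemma subm_lift (N : lmodType R) (f : hom N M) : (forall x, K (f x)) ->
  exists g : hom N subm, forall x, subm_incl (g x) = f x.
Proof.
move=> h; have fP x : f x \in smem_pred by apply/asboolP.
have lg : linear (fun x => Subm (fP x)).
  by move=> a x y; apply: val_inj; rewrite /= linearP.
by exists (mkhom lg) => x; rewrite subm_inclE.
Qed.

End Submodule.

Section Kernels.
Variable R : comPzRingType.
Implicit Types M N : lmodType R.

Fact kerP M N (f : hom M N) a x y : f x = 0 -> f y = 0 -> f (a *: x + y) = 0.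
Proof. by move=> fx fy; rewrite linearP fx fy scaler0 addr0. Qed.

Definition ker M N (f : hom M N) : submodule M :=
  Submodule (linear0 f) (kerP (f := f)).

Fact imP M N (f : hom M N) a x y : (exists t, f t = x) -> (exists t, f t = y) ->
  exists t, f t = a *: x + y.
Proof. by move=> [t <-] [t' <-]; exists (a *: t + t'); rewrite linearP. Qed.

Definition im M N (f : hom M N) : submodule N :=
  Submodule (ex_intro _ 0 (linear0 f)) (imP (f := f)).

Definition ses (A B C : lmodType R) (f : hom A B) (g : hom B C) : Prop :=
  [/\ injective f, surjective g & exact_at f g].

Lemma ker_exact M N (f : hom M N) : exact_at (subm_incl (ker f)) f.
Proof.
move=> y; split=> [h|[x <-]]; last exact: (@subm_incl_mem _ _ (ker f) x).
exact: (subm_inclP (K := ker f)).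
Qed.

Lemma ker_ses M N (f : hom M N) : surjective f ->
  ses (subm_incl (ker f)) f.
Proof. by move=> sf; split=> //; [apply: subm_incl_inj | apply: ker_exact]. Qed.

Lemma inj_ker0 M N (f : hom M N) : injective f <-> forall x, f x = 0 -> x = 0.
Proof.
split=> [inj x fx|h x y e]; first by apply: inj; rewrite fx linear0.
by apply/eqP; rewrite -subr_eq0; apply/eqP/h; rewrite linearB e subrr.
Qed.

Definition idh M : hom M M := idfun.
Definition comph M N P (g : hom N P) (f : hom M N) : hom M P := g \o f.

End Kernels.

Section Products.
Variable R : comPzRingType.
Variables M N P : lmodType R.

Lemma sndh_linear : linear (@snd M N). Proof. by []. Qed.
Definition sndh : hom (M * N)%type N := mkhom sndh_linear.

Lemma pairh_linear (f : hom P M) (g : hom P N) : linear (fun x => (f x, g x)).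
Proof. by move=> a x y; rewrite !linearP. Qed.
Definition pairh f g : hom P (M * N)%type := mkhom (pairh_linear f g).
Lemma copairh_linear (f : hom M P) (g : hom N P) :
  linear (fun x : M * N => f x.1 + g x.2).
Proof. by move=> a x y /=; rewrite !linearP /= scalerDr addrACA. Qed.
Definition copairh f g : hom (M * N)%type P := mkhom (copairh_linear f g).

End Products.

Lemma projective_prod (R : comPzRingType) (M N : lmodType R) :
  projective M -> projective N -> projective (M * N)%type.
Proof.
move=> pM pN A B g f sg.
have lM : linear (fun x : M => f (x, 0)).
  move=> a x y; rewrite -linearP; congr (f (_, _)) => /=.
  by rewrite scaler0 addr0.
have lN : linear (fun x : N => f (0, x)).
  move=> a x y; rewrite -linearP; congr (f (_, _)) => /=.
  by rewrite scaler0 addr0.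
have [h hE] := pM _ _ g (mkhom lM) sg; have [k kE] := pN _ _ g (mkhom lN) sg.
exists (copairh h k) => -[x y]; rewrite /= linearD hE kE /= -linearD.
by congr (f (_, _)); rewrite /= ?addr0 ?add0r.
Qed.

(** * Free modules and resolutions *)

Section Free.
Variables (R : comPzRingType) (T : Type).

Inductive no_rel : lterm R T -> lterm R T -> Prop := .

(** [T] may be infinite: every module is covered by the free module on its own elements, and both
    [Ext_vanish] and [syzygy1] admit projective modules of any rank. *)
Definition free_module : lmodType R := presented no_rel.

Section Eval.
Variables (N : lmodType R) (v : T -> N).

Fixpoint lterm_eval (t : lterm R T) : N :=
  match t with
  | LZero => 0
  | LAdd t u => lterm_eval t + lterm_eval u
  | LOpp t => - lterm_eval t
  | LScale a t => a *: lterm_eval t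
  | LGen x => v x
  end.

Lemma lterm_eval_cong t u : lcong no_rel t u -> lterm_eval t = lterm_eval u.
Proof.
elim=> {t u} //=.
- by move=> ? ? ? _ -> _ ->.
- by move=> ? ? ? ? _ -> _ ->.
- by move=> ? ? _ ->.
- by move=> ? ? ? _ ->.
- by move=> *; rewrite addrA.
- by move=> *; rewrite addrC.
- by move=> *; rewrite add0r.
- by move=> *; rewrite addNr.
- by move=> *; rewrite scalerA.
- by move=> *; rewrite scale1r.
- by move=> *; rewrite scalerDr.
- by move=> *; rewrite scalerDl.
Qed.

Definition free_eval (x : free_module) : N := lterm_eval (prop_repr x).

Lemma free_evalE t : free_eval (pterm no_rel t) = lterm_eval t.
Proof. by apply/lterm_eval_cong/prepr. Qed.

Fact free_eval_linear : linear free_eval.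
Proof.
move=> a x y; elim/pterm_ind: x => t; elim/pterm_ind: y => u.
by rewrite -pterm_scale -pterm_add !free_evalE.
Qed.

Definition free_hom : hom free_module N := mkhom free_eval_linear.

Lemma free_homE x : free_hom (pgen no_rel x) = v x.
Proof. exact: free_evalE. Qed.

End Eval.

Lemma free_hom_ext (N : lmodType R) (f g : hom free_module N) :
  (forall x, f (pgen no_rel x) = g (pgen no_rel x)) -> f =1 g.
Proof.
move=> e; elim/pterm_ind; elim=> [|t et u eu|t et|a t et|x]; last exact: e.
- by have -> : pterm no_rel LZero = 0 :> free_module; rewrite ?linear0.
- by rewrite pterm_add !linearD et eu.
- by rewrite pterm_opp !linearN et.
- by rewrite pterm_scale !linearZ et.
Qed.

Lemma free_projective : projective free_module.
Proof.
move=> M N g f sg.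
have [v hv] := choice (fun x : T => sg (f (pgen no_rel x))).
exists (free_hom v); apply: (@free_hom_ext _ (comph g (free_hom v)) f) => x /=.
by rewrite free_evalE hv.
Qed.

Definition free_coord (x : T) : dual free_module :=
  free_hom (fun y => (`[< x = y >] : nat)%:R : R^o).

(** Each term involves finitely many generators, so [z] is the finite sum of its coordinates times
    the generators. This makes free modules of any rank torsionless. *)
Lemma free_coord_inj (z : free_module) : (forall x, free_coord x z = 0) -> z = 0.
Proof.
pose dec z (s : seq {classic T}) :=
  z = \sum_(x <- s) (free_coord x z : R) *: pgen no_rel (x : T) :> free_module.
suff [s] : exists s, dec z s.
  by rewrite /dec => e h; rewrite e big1 // => x _; rewrite h scale0r.
(* Every larger list without repetitions is allowed as support, so that the supports of two summands
   can be merged. *)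
have [s hs] : exists s0 : seq {classic T},
    forall s, uniq s -> {subset s0 <= s} -> dec z s.
  elim/pterm_ind: z; elim=> [|t [s hs] u [s' hs']|t [s hs]|a t [s hs]|y].
- exists [::] => s _ _; rewrite /dec.
  have -> : pterm no_rel LZero = 0 :> free_module by [].
  by rewrite big1 // => x _; rewrite linear0 scale0r.
- exists (s ++ s') => r ur sr; rewrite /dec pterm_add.
  under eq_bigr do rewrite linearD scalerDl.
  rewrite big_split; congr (_ + _); [apply: hs|apply: hs'] => // x hx.
    by apply: sr; rewrite mem_cat hx.
  by apply: sr; rewrite mem_cat hx orbT.
- exists s => r ur sr; rewrite /dec pterm_opp.
  under eq_bigr do rewrite linearN scaleNr.
  by rewrite sumrN; congr (- _); apply: hs.
- exists s => r ur sr; rewrite /dec pterm_scale.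
  under eq_bigr do rewrite linearZ /= -scalerA.
  by rewrite -scaler_sumr; congr (_ *: _); apply: hs.
- exists [:: y : {classic T}] => r ur sr; rewrite /dec.
  have yr : (y : {classic T}) \in r by apply: sr; rewrite mem_seq1.
  have cE x : free_coord x (pterm no_rel (LGen y)) = (`[< x = y >] : nat)%:R :> R.
    by rewrite /free_coord /= free_evalE.
  rewrite (big_rem _ yr) cE.
  rewrite asboolT // scale1r big_seq big1 => [|x xr]; first exact: esym (addr0 _).
  rewrite cE; case: asboolP => [xy|_]; last by rewrite scale0r.
  by move: xr; rewrite xy mem_rem_uniqF.
exists (undup s); apply: (hs _ (undup_uniq s)).
by move=> x; rewrite mem_undup.
Qed.

End Free.

Arguments free_module R T : clear implicits.
Arguments free_coord {R T} x.

Section FreeCover.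
Variables (R : comPzRingType) (M : lmodType R).

Definition free_cover : hom (free_module R M) M := free_hom id.

Lemma free_cover_surj : surjective free_cover.
Proof. by move=> x; exists (pgen (@no_rel R M) x); rewrite free_homE. Qed.

Fixpoint res_syz (i : nat) : lmodType R :=
  match i with 0 => M | j.+1 => subm (ker (free_hom (@id (res_syz j)))) end.

(** A condition on all projective resolutions yields something only once one of them is
    available. *)
Lemma free_resolution : exists P : left_resolution M,
  (forall i, res_mod P i = free_module R (res_syz i)) /\
  (forall i, projective (res_mod P i)).
Proof.
pose K i := ker (free_hom (@id (res_syz i))).
pose d i : hom (free_module R (res_syz i.+1)) (free_module R (res_syz i)) :=
  comph (subm_incl (K i)) (free_hom (@id (res_syz i.+1))).
have sur i y : exists x, free_hom (@id (res_syz i)) x = y.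
  by exists (pgen (@no_rel R _) y); rewrite free_homE.
have e0 i : exact_at (d i) (free_hom (@id (res_syz i))).
  move=> y; split=> [h|[x <-]]; last exact: (@subm_incl_mem _ _ (K i)).
  have [z <-] := @subm_inclP _ _ (K i) y h.
  by have [x hx] := sur i.+1 z; exists x; rewrite -hx.
have e1 i : exact_at (d i.+1) (d i).
  move=> y; rewrite -e0; split=> [h|h]; last first.
    by rewrite -[LHS]/(subm_incl (K i) (free_hom id y)) h linear0.
  by apply: (@subm_incl_inj _ _ (K i)); rewrite linear0.
exists (LeftResolution (sur 0) (e0 0) e1).
by split=> // i; apply: free_projective.
Qed.

End FreeCover.

(** * Vanishing of Ext into the base ring *)

Section DualAcyclic.
Variable R : comPzRingType.
Implicit Types A B C D F K N P Q T : lmodType R.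

Definition dual_onto A B (f : hom A B) : Prop :=
  forall u : dual A, exists v : dual B, forall x, v (f x) = u x.

(* [Ext^(i+1)(T, R) = 0] by dimension shifting over all projective covers, which
   makes closure properties provable without comparing resolutions. *)
Fixpoint dual_acyclic (i : nat) T : Prop :=
  match i with
  | 0 => forall A B (f : hom A B) (g : hom B T), ses f g -> dual_onto f
  | j.+1 => forall K F (f : hom K F) (g : hom F T), projective F ->
      ses f g -> dual_acyclic j K
  end.

Lemma exact_lift A B C N (f : hom A B) (g : hom B C) (e : hom N B) :
  injective f -> exact_at f g -> (forall x, g (e x) = 0) ->
  exists e' : hom N A, forall x, f (e' x) = e x.
Proof.
move=> inj ex ge.
have [x|a x y x' y' h h'|y|e' he'] := @graph_hom R N A (fun x a => f a = e x).
- by apply/ex/ge.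
- by rewrite !linearP h h'.
- by rewrite linear0 => h; apply: inj; rewrite h linear0.
- exists e' => x; have [a ha] : exists a, f a = e x by apply/ex/ge.
  by rewrite (he' x a ha).
Qed.

Lemma ses_comp0 A B C (f : hom A B) (g : hom B C) x : ses f g -> g (f x) = 0.
Proof. by move=> [_ _ ex]; apply/ex; exists x. Qed.

(** One projective cover suffices to test all short exact sequences ending in [T]: projectivity
    gives a map from it to any other cover [B], along which extensions are transported. *)
Lemma dual_acyclic0_proj K F T (f : hom K F) (g : hom F T) : projective F ->
  ses f g -> dual_onto f -> dual_acyclic 0 T.
Proof.
move=> pF sfg of_ A B f' g' s'; have [injf sg ex] := sfg.
have [injf' sg' ex'] := s'.
have [h hE] := pF _ _ g' g sg'.
have [k kE] : exists k : hom K A, forall x, f' (k x) = comph h f x.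
  apply: exact_lift ex' _ => // x.
  by rewrite /= hE (ses_comp0 x sfg).
move=> u; have [w wE] := of_ (comph u k).
(* [B] is the pushout of [A] and [F] along [K], and [u] and [w] agree on [K]. *)
have [||v vE] := @hom_factor R _ _ _ (copairh f' h) (copairh u w).
- move=> b; have [x xE] := sg (g' b).
  have [a aE] : exists a, f' a = b - h x.
    by apply/ex'; rewrite linearB hE xE subrr.
  by exists (a, x); rewrite /= aE subrK.
- move=> [a x] /= e.
  have [y yE] : exists y, f y = x.
    apply/ex; rewrite -hE; have := congr1 g' e.
    by rewrite linearD (ses_comp0 a s') add0r linear0.
  have ay : a + k y = 0.
    by apply: injf'; rewrite linear0 linearD kE /= yE.
  by rewrite -yE wE /= -linearD ay linear0.
exists v => a; have := vE (a, 0).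
by rewrite /= !linear0 !addr0.
Qed.

(** [L] is the preimage of [A] in the cover [D] of [B]. It covers [A] with the same kernel [K] and
    is itself the kernel of [D -> C], so a question about [B] splits into one about [A] and one
    about [C]. *)
Lemma ses_pull A B C K D (f : hom A B) (g : hom B C) (k : hom K D) (h : hom D B) :
  ses f g -> ses k h -> exists (L : lmodType R) (k' : hom K L) (h' : hom L A)
    (l : hom L D), [/\ ses k' h', ses l (comph g h) & forall x, l (k' x) = k x].
Proof.
move=> s1 s2; have [injf sg ex] := s1; have [injk sh ex'] := s2.
pose L := ker (comph g h); pose l := subm_incl L.
have [k' k'E] : exists k' : hom K (subm L), forall x, l (k' x) = k x.
  by apply: subm_lift => x /=; rewrite (ses_comp0 x s2) linear0.
have [h' h'E] : exists h' : hom (subm L) A, forall x, f (h' x) = comph h l x.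
  apply: exact_lift ex _ => // x; exact: (@subm_incl_mem _ _ L x).
exists (subm L), k', h', l; split=> //.
- split.
  + by move=> x y e; apply: injk; rewrite -!k'E e.
  + move=> a; have [d dE] := sh (f a).
    have [x xE] : exists x, l x = d.
      by apply: (@subm_inclP _ _ L); rewrite /= dE (ses_comp0 _ s1).
    by exists x; apply: injf; rewrite h'E /= xE dE.
  + move=> y; split=> [h'0|[x <-]].
      have [x xE] : exists x, k x = l y.
        by apply/ex'; rewrite -[LHS]h'E h'0 linear0.
      by exists x; apply: (@subm_incl_inj _ _ L); rewrite k'E.
    by apply: injf; rewrite h'E /= k'E linear0 (ses_comp0 _ s2).
- apply: ker_ses => c; have [b <-] := sg c; have [d <-] := sh b.
  by exists d.
Qed.

(** Adding [F] to a cover [D] of [A] gives a cover of [Q], the direct sum of [A] and [F], with an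
    unchanged kernel. *)
Lemma dual_acyclic_summand i A F Q (s : hom A Q) (t : hom F Q) :
  projective F -> injective (copairh s t) -> surjective (copairh s t) ->
  dual_acyclic i Q -> dual_acyclic i A.
Proof.
move=> pF inj sur.
have key K D (f : hom K D) (g : hom D A) : ses f g ->
    ses (pairh f (\0 : hom K F)) (copairh (comph s g) t).
  move=> sfg; have [injf sg ex] := sfg; split.
  - by move=> x y [] /injf.
  - move=> q; have [[a x] <-] := sur q; have [d <-] := sg a.
    by exists (d, x).
  - move=> [d x]; split=> /= [e|[y [<- <-]]]; last first.
      by rewrite (ses_comp0 _ sfg) !linear0 addr0.
    have [gd ->] : g d = 0 /\ x = 0.
      have /inj[] : copairh s t (g d, x) = copairh s t 0 by rewrite linear0.
      by [].
    by have [y <-] := (ex d).1 gd; exists y.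
case: i => [|i] Y K D f g => [sfg u|pD sfg]; last first.
  by apply: Y (key _ _ _ _ sfg); apply: projective_prod.
have [v vE] := Y _ _ _ _ (key _ _ _ _ sfg) u.
have lv : linear (fun x : D => v (x, 0)).
  move=> a x y; rewrite -linearP; congr (v (_, _)) => /=.
  by rewrite scaler0 addr0.
by exists (mkhom lv) => x; apply: vE.
Qed.

(** The fibre product [Q] of [B] and a free cover of [C] is an extension of [B] by the first syzygy
    of [C], and also the sum of [A] and a free module. Closure under extensions is a hypothesis
    because its own induction step calls this lemma one degree lower. *)
Lemma dual_acyclic_ker_of_ext i :
  (forall A B C (f : hom A B) (g : hom B C), ses f g ->
     dual_acyclic i A -> dual_acyclic i C -> dual_acyclic i B) ->
  forall A B C (f : hom A B) (g : hom B C), ses f g ->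
    dual_acyclic i B -> dual_acyclic i.+1 C -> dual_acyclic i A.
Proof.
move=> ext A B C f g sfg YB YC; have [injf sg ex] := sfg.
pose p := free_cover C; have pC := @free_cover_surj _ C.
have YK : dual_acyclic i (subm (ker p)).
  exact: YC (@free_projective _ _) (ker_ses pC).
pose Q := ker (copairh p (\- g : hom B C)).
have QP x b : Q (x, b) <-> p x = g b.
  by split=> /= [/eqP|->]; rewrite ?subrr // subr_eq0 => /eqP.
have pk x : p (subm_incl (ker p) x) = 0 by apply: (@subm_incl_mem _ _ (ker p)).
have kQ x : Q (pairh (subm_incl (ker p)) (\0 : hom _ B) x).
  by apply/QP; rewrite pk /= linear0.
have [k kE] := subm_lift kQ.
have sQ a : Q (pairh (\0 : hom A (free_module R C)) f a).
  by apply/QP; rewrite linear0 (ses_comp0 _ sfg).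
have [s sE] := subm_lift sQ.
(* The lift [t0] of [p] through [g] splits the projection of [Q] onto the free cover, whose kernel
   is [A]. *)
have [t0 t0E] := @free_projective R C _ _ g p sg.
have tQ x : Q (pairh (idh (free_module R C)) t0 x) by apply/QP; rewrite t0E.
have [t tE] := subm_lift tQ.
have YQ : dual_acyclic i (subm Q).
  apply: (ext _ _ _ k (comph (@sndh _ _ _) (subm_incl Q))) => //; split.
  - move=> x y e; apply: (@subm_incl_inj _ _ (ker p)).
    by have := congr1 (subm_incl Q) e; rewrite !kE => -[].
  - move=> b; have [x xE] := pC (g b).
    have [q qE] := subm_inclP ((QP x b).2 xE).
    by exists q; rewrite /= qE.
  - move=> q; split=> [|[x <-]]; last by rewrite /= kE.
    have := @subm_incl_mem _ _ Q q; case E : (subm_incl Q q) => [x b].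
    rewrite /= E /= => /QP h b0; move: h; rewrite b0 linear0 => h.
    have [y yE] := subm_inclP (K := ker p) h.
    by exists y; apply: (@subm_incl_inj _ _ Q); rewrite kE E /= yE b0.
apply: (@dual_acyclic_summand i A (free_module R C) _ s t _ _ _ YQ).
- exact: free_projective.
- apply/inj_ker0 => -[a x] /(congr1 (subm_incl Q)) /=.
  rewrite linearD linear0 sE tE /= => -[]; rewrite add0r => -> .
  by rewrite linear0 addr0 => fa; congr pair; apply: injf; rewrite fa linear0.
- move=> q; case E : (subm_incl Q q) => [x b].
  have /QP xb : Q (x, b) by rewrite -E; apply: subm_incl_mem.
  have [a aE] : exists a, f a = b - t0 x.
    by apply/ex; rewrite linearB t0E -[X in _ - X]/(p x) xb subrr.
  exists (a, x); apply: (@subm_incl_inj _ _ Q); rewrite linearD sE tE E.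
  by congr pair; rewrite /= ?add0r // aE subrK.
Qed.

(** In degree 0 a functional on [K] is extended first to [L], then to [D]. In higher degrees [L] is
    a first syzygy of [C] and [K] is the kernel of [L -> A]. *)
Lemma dual_acyclic_ext i A B C (f : hom A B) (g : hom B C) : ses f g ->
  dual_acyclic i A -> dual_acyclic i C -> dual_acyclic i B.
Proof.
elim: i A B C f g => [|i IH] A B C f g sfg YA YC K D k h.
  move=> skh u; have [L [k' [h' [l [s1 s2 lE]]]]] := ses_pull sfg skh.
  have [v vE] := YA _ _ _ _ s1 u; have [w wE] := YC _ _ _ _ s2 v.
  by exists w => x; rewrite -lE wE vE.
move=> pD skh; have [L [k' [h' [l [s1 s2 lE]]]]] := ses_pull sfg skh.
exact: (dual_acyclic_ker_of_ext IH s1 (YC _ _ _ _ pD s2) YA).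
Qed.

Lemma dual_acyclic_ker i A B C (f : hom A B) (g : hom B C) : ses f g ->
  dual_acyclic i B -> dual_acyclic i.+1 C -> dual_acyclic i A.
Proof. by apply: dual_acyclic_ker_of_ext; apply: dual_acyclic_ext. Qed.

Lemma res_aug_d T (P : left_resolution T) x : res_aug P (res_d P 0 x) = 0.
Proof. by apply/(@res_exact0 _ _ P _); exists x. Qed.

Lemma res_d_d T (P : left_resolution T) i x :
  res_d P i (res_d P i.+1 x) = 0.
Proof. by apply/(@res_exact _ _ P i _); exists x. Qed.

Lemma Ext_vanish_acyclic0 T : Ext_vanish 1 T R^o -> dual_acyclic 0 T.
Proof.
move=> ET; have [P [_ pP]] := free_resolution T.
pose a := res_aug P; pose d := res_d P 0.
have s := ker_ses (@res_aug_surj _ _ P).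
apply: (dual_acyclic0_proj (pP 0) s) => u.
have [e eE] : exists e : hom (res_mod P 1) (subm (ker a)),
    forall x, subm_incl (ker a) (e x) = d x.
  by apply: subm_lift => x; apply: res_aug_d.
have [x|v vE] := ET P pP (comph u e).
  rewrite /= [e _](_ : _ = 0) ?linear0 //.
  apply: (@subm_incl_inj _ _ (ker a)); rewrite eE linear0.
  exact: res_d_d.
exists v => x; have [y yE] : exists y, d y = subm_incl (ker a) x.
  by apply/(@res_exact0 _ _ P _); apply: (@subm_incl_mem _ _ (ker a)).
rewrite -yE -vE /=; congr (u _).
by apply: (@subm_incl_inj _ _ (ker a)); rewrite eE.
Qed.

(** Splicing a resolution [P] of [K] with [F] resolves [T], and the cocycle [u] then sits one degree
    higher. *)
Lemma Ext_vanish_syzygy i K F T (f : hom K F) (g : hom F T) : projective F ->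
  ses f g -> Ext_vanish i.+2 T R^o -> Ext_vanish i.+1 K R^o.
Proof.
move=> pF sfg ET P pP u ud; have [injf sg ex] := sfg.
pose m j := if j is j'.+1 then res_mod P j' else F.
pose d j : hom (m j.+1) (m j) :=
  match j return hom (m j.+1) (m j) with
  | 0 => comph f (res_aug P) | j'.+1 => res_d P j' end.
have e0 : exact_at (d 0) g.
  move=> y; rewrite ex; split=> [[x <-]|[x <-]]; last by exists (res_aug P x).
  by have [z <-] := @res_aug_surj _ _ P x; exists z.
have e1 j : exact_at (d j.+1) (d j).
  case: j => [|j]; last exact: (@res_exact _ _ P j).
  move=> y; rewrite -(@res_exact0 _ _ P _) /=; split=> [h|->].
    by apply: injf; rewrite h linear0.
  by rewrite linear0.
have pm j : projective (m j) by case: j.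
exact: (ET (LeftResolution sg e0 e1) pm u ud).
Qed.

Lemma Ext_vanish_acyclic T :
  (forall i, Ext_vanish i.+1 T R^o) -> forall i, dual_acyclic i T.
Proof.
move=> ET i; elim: i T ET => [|i IH] T ET; first exact: Ext_vanish_acyclic0.
move=> K F f g pF sfg; apply: IH => j; exact: Ext_vanish_syzygy pF sfg (ET _).
Qed.

(** For any resolution, a 1-cocycle descends to the first syzygy, from where it extends to
    [res_mod P 0]. This is how 1-torsionfreeness gets certified. *)
Lemma acyclic0_Ext_vanish T : dual_acyclic 0 T -> Ext_vanish 1 T R^o.
Proof.
move=> Y P pP u ud.
have s := ker_ses (@res_aug_surj _ _ P).
have [e eE] : exists e : hom (res_mod P 1) (subm (ker (res_aug P))),
    forall x, subm_incl (ker (res_aug P)) (e x) = res_d P 0 x.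
  by apply: subm_lift => x; apply: res_aug_d.
have [||w wE] := @hom_factor R _ _ _ e u.
- move=> y; have [x xE] : exists x, res_d P 0 x = subm_incl (ker (res_aug P)) y.
    apply/(@res_exact0 _ _ P _); apply: (@subm_incl_mem _ _ (ker (res_aug P))).
  exists x; apply: (@subm_incl_inj _ _ (ker (res_aug P))).
  by rewrite eE.
- move=> x ex0; have [y <-] : exists y, res_d P 1 y = x.
    by apply/(@res_exact _ _ P _ _); rewrite -eE ex0 linear0.
  exact: ud.
have [v vE] := Y _ _ _ _ s w.
by exists v => x; rewrite -eE vE wE.
Qed.

End DualAcyclic.

(** * Finitely generated submodules *)

Section SubmoduleSum.
Variables (R : comPzRingType) (M : lmodType R) (L : submodule M) (g : M).

Fact adjoin0 : exists l (a : R), L l /\ 0 = l + a *: g.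
Proof. by exists 0, 0; rewrite scale0r addr0; split=> //; apply: smem0. Qed.

Fact adjoinP a x y : (exists l b, L l /\ x = l + b *: g) ->
  (exists l b, L l /\ y = l + b *: g) ->
  exists l (b : R), L l /\ a *: x + y = l + b *: g.
Proof.
move=> [l [b [Ll ->]]] [l' [b' [Ll' ->]]]; exists (a *: l + l'), (a * b + b').
by split; [apply: smemP | rewrite scalerDr scalerDl scalerA addrACA].
Qed.

Definition adjoin : submodule M := Submodule adjoin0 adjoinP.

End SubmoduleSum.

Section SubmoduleBasics.
Variables (R : comPzRingType) (M : lmodType R).
Implicit Types K L : submodule M.

Lemma smemZ L a x : L x -> L (a *: x).
Proof. by move=> Lx; rewrite -[_ *: _]addr0; apply: smemP => //; apply: smem0. Qed.

Lemma smemD L x y : L x -> L y -> L (x + y).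
Proof. by move=> Lx Ly; rewrite -[x]scale1r; apply: smemP. Qed.

Lemma smemB L x y : L x -> L y -> L (x - y).
Proof. by move=> Lx Ly; rewrite addrC -scaleN1r; apply: smemP. Qed.

Lemma smem_sum L (I : Type) (r : seq I) (P : pred I) (c : I -> R) (f : I -> M) :
  (forall i, L (f i)) -> L (\sum_(i <- r | P i) c i *: f i).
Proof.
by move=> h; elim/big_ind: _ => [|x y|i _]; [apply: smem0|apply: smemD|apply: smemZ].
Qed.

(** Generation is phrased as an induction principle over submodules, which keeps coefficient
    families out of the arguments on lists; [fgE] restores them. *)
Definition fg K : Prop := exists s : seq M, (forall x, x \in s -> K x) /\
  forall L, (forall x, x \in s -> L x) -> forall x, K x -> L x.

Fact lin_comb0 k (g : 'I_k -> M) : exists c : 'I_k -> R, 0 = \sum_i c i *: g i.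
Proof. by exists (fun=> 0); rewrite big1 // => i _; rewrite scale0r. Qed.

Fact lin_combP k (g : 'I_k -> M) a x y : (exists c, x = \sum_i c i *: g i) ->
  (exists c, y = \sum_i c i *: g i) ->
  exists c : 'I_k -> R, a *: x + y = \sum_i c i *: g i.
Proof.
move=> [c ->] [c' ->]; exists (fun i => a * c i + c' i).
under [RHS]eq_bigr do rewrite scalerDl -scalerA.
by rewrite big_split scaler_sumr.
Qed.

Definition span k (g : 'I_k -> M) : submodule M :=
  Submodule (lin_comb0 g) (@lin_combP k g).

Lemma span_gen k (g : 'I_k -> M) i : span g (g i).
Proof.
exists (fun j => (i == j)%:R); rewrite (bigD1 i) //= eqxx scale1r.
rewrite big1 ?addr0 // => j; rewrite eq_sym => /negbTE ->.
by rewrite scale0r.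
Qed.

Lemma fgE K : fg K <-> exists k (g : 'I_k -> M), forall x, K x <-> span g x.
Proof.
split=> [[s [sK h]]|[k [g gK]]].
  exists (size s), (fun i => s`_i) => x; split.
    apply: h => y /(nthP 0)[i si <-].
    exact: (span_gen (fun j : 'I_(size s) => s`_j) (Ordinal si)).
  by move=> [c ->]; apply: smem_sum => i; apply/sK/mem_nth.
exists [seq g i | i <- enum 'I_k]; split=> [x /mapP[i _ ->]|L Ls x].
  by apply/gK/span_gen.
move/gK => [c ->]; apply: smem_sum => i; apply/Ls/map_f.
by rewrite mem_enum.
Qed.

Lemma fin_genP : fin_gen M <-> exists s : seq M, forall L,
  (forall x, x \in s -> L x) -> forall x, L x.
Proof.
pose T := @Submodule R M (fun=> True) I (fun _ _ _ _ _ => I).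
split=> [[k [g gM]]|[s h]].
  have /fgE [s [_ h]] : exists k (g : 'I_k -> M), forall x, T x <-> span g x.
    by exists k, g => x; split=> // _; apply: gM.
  by exists s => L /h k' x; apply: k'.
have /fgE [k [g gM]] : fg T by exists s; split=> // L /h.
by exists k, g => x; apply/gM.
Qed.

End SubmoduleBasics.

Section Noetherian.
Variable R : comPzRingType.
Hypothesis noeR : noetherian R.

Lemma fg_ideal (K : submodule R^o) : fg K.
Proof.
have /noeR [k [g gE]] : is_ideal (fun a : R => K a).
  split=> [|a b|a b Kb]; first exact: (smem0 K).
    exact: smemD.
  exact: (smemZ (a : R) Kb).
apply/fgE; exists k, g => x.
by have /= -> := congr1 (fun I : set R => I x) gE.
Qed.

(** [K] is filtered by the number of leading zero coordinates; each graded piece is an ideal of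
    [R]. *)
Lemma fg_rV n (K : submodule 'rV[R]_n) : fg K.
Proof.
have filt j : exists Kj : submodule 'rV[R]_n,
    forall x, Kj x <-> K x /\ forall i : 'I_n, (i < j)%N -> x 0 i = 0.
  have h0 : K 0 /\ forall i : 'I_n, (i < j)%N -> (0 : 'rV[R]_n) 0 i = 0.
    by split=> [|i _]; [apply: smem0 | rewrite mxE].
  have hP a (x y : 'rV[R]_n) : K x /\ (forall i : 'I_n, (i < j)%N -> x 0 i = 0) ->
      K y /\ (forall i : 'I_n, (i < j)%N -> y 0 i = 0) ->
      K (a *: x + y) /\ forall i : 'I_n, (i < j)%N -> (a *: x + y) 0 i = 0.
    move=> [Kx x0] [Ky y0]; split=> [|i ij]; first exact: smemP.
    by rewrite !mxE x0 // y0 // mulr0 addr0.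
  by exists (Submodule h0 hP).
(* [d] bounds the number of coordinates that may still be nonzero. *)
suff H d : forall j, (n <= j + d)%N -> forall Kj : submodule 'rV[R]_n,
    (forall x, Kj x <-> K x /\ forall i : 'I_n, (i < j)%N -> x 0 i = 0) -> fg Kj.
  have [K0 K0E] := filt 0; have [s [sK h]] := H n 0 (leqnn _) K0 K0E.
  exists s; split=> [x /sK /K0E[] //|L /h k x Kx].
  by apply: k; apply/K0E.
elim: d => [|d IH] j nj Kj KjE.
  exists [::]; split=> // L _ x /KjE[_ x0].
  have -> : x = 0.
    by apply/rowP => i; rewrite mxE x0 // (leq_trans (ltn_ord i)) // -[j]addn0.
  exact: smem0.
have [lt_jn|le_nj] := ltnP j n; last first.
  by apply: (IH j _ Kj KjE); rewrite (leq_trans le_nj) // leq_addr.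
have [K' K'E] := filt j.+1.
have [s' [s'K hs']] := IH j.+1 ltac:(by rewrite addSnnS) K' K'E.
pose o := Ordinal lt_jn.
have cl : linear (fun x : 'rV[R]_n => x 0 o : R^o) by move=> a x y; rewrite !mxE.
(* The coordinates of index [j] of the elements of [Kj] form an ideal, whose generators are then
   lifted to elements [h i] of [Kj]. *)
have i0 : exists x, Kj x /\ mkhom cl x = 0.
  by exists 0; split; [apply: smem0 | apply: linear0].
have iP (a : R) (u v : R^o) : (exists x, Kj x /\ mkhom cl x = u) ->
    (exists x, Kj x /\ mkhom cl x = v) -> exists x, Kj x /\ mkhom cl x = a *: u + v.
  move=> [x [Kx <-]] [y [Ky <-]]; exists (a *: x + y).
  by split; [apply: smemP | rewrite linearP].
have /fgE [k [g gE]] := fg_ideal (Submodule i0 iP).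
have [h hP] := choice (fun i => (gE (g i)).2 (span_gen g i)).
exists (s' ++ [seq h i | i <- enum 'I_k]); split=> [x|L Ls x Kx].
  rewrite mem_cat => /orP[/s'K/K'E[Kx x0]|/mapP[i _ ->]]; last exact: (hP i).1.
  by apply/KjE; split=> // i ij; apply/x0/ltnW.
have [c cE] : span g (x 0 o) by apply/gE; exists x.
have Lh i : L (h i).
  by apply: Ls; rewrite mem_cat map_f ?orbT ?mem_enum.
(* Subtracting a combination of the lifts clears the coordinate [j] and leaves an element of
   [K']. *)
rewrite -[x](subrK (\sum_i c i *: h i)); apply: smemD; last exact: smem_sum.
apply: hs' => [y ys|]; first by apply: Ls; rewrite mem_cat ys.
apply/K'E; have Kd : Kj (x - \sum_i c i *: h i).
  by apply: smemB => //; apply: smem_sum => i; case: (hP i).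
have [KK x0] := (KjE _).1 Kd; split=> // i.
rewrite ltnS leq_eqVlt => /orP[/eqP ij|/x0 //].
have -> : i = o by apply: val_inj.
rewrite !mxE cE summxE; apply/eqP; rewrite subr_eq0; apply/eqP.
apply: eq_bigr => l _; rewrite mxE; congr (_ * _); by case: (hP l).
Qed.

Lemma fin_gen_of_inj n (N : lmodType R) (f : hom N 'rV[R]_n) :
  injective f -> fin_gen N.
Proof.
move=> inj; have /fgE [k [g gE]] := fg_rV (im f).
have [h hE] := choice (fun i => (gE (g i)).2 (span_gen g i)).
exists k, h => x; have [c cE] := (gE (f x)).1 (ex_intro _ x erefl).
exists c; apply: inj; rewrite cE linear_sum.
by apply: eq_bigr => i _; rewrite linearZ hE.
Qed.

Lemma row_hom n (M : lmodType R) (f : 'I_n -> dual M) :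
  exists h : hom M 'rV[R]_n, forall x i, h x 0 i = f i x.
Proof.
have l : linear (fun x => \row_i (f i x : R) : 'rV[R]_n).
  by move=> a x y; apply/rowP => i; rewrite !mxE linearP.
by exists (mkhom l) => x i; rewrite mxE.
Qed.

(** Evaluation at [k] generators of [M] embeds the dual in R^k. *)
Lemma dual_fin_gen (M : lmodType R) : fin_gen M -> fin_gen (dual M).
Proof.
move=> [k [g gM]]; have [h hE] := row_hom (fun i => @bidual R M (g i)).
apply: (@fin_gen_of_inj k _ h); apply/inj_ker0 => f f0; apply: hom_ext => x.
have [c ->] := gM x; rewrite linear_sum big1 // => i _.
have fg0 : f (g i) = 0 by rewrite -[LHS](hE f i) f0 mxE.
by rewrite linearZ /= fg0 scaler0.
Qed.

End Noetherian.

(** * Torsionless modules *)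

Section Quotient.
Variables (R : comPzRingType) (M : lmodType R) (L : submodule M).

Definition quot_rel (x y : M) : Prop := L (x - y).

Fact quot_refl x : quot_rel x x.
Proof. by rewrite /quot_rel subrr; apply: smem0. Qed.
Fact quot_sym x y : quot_rel x y -> quot_rel y x.
Proof. by move=> /(smemZ (-1)); rewrite scaleN1r opprB. Qed.
Fact quot_trans x y z : quot_rel x y -> quot_rel y z -> quot_rel x z.
Proof. by move=> h h'; have := smemD h h'; rewrite addrA subrK. Qed.

Definition quotm := prop_quot quot_refl quot_sym quot_trans.
HB.instance Definition _ := Choice.on quotm.

Definition quot_pi (x : M) : quotm := prop_pi quot_refl quot_sym quot_trans x.

Lemma quot_piP x y : quot_pi x = quot_pi y <-> L (x - y).
Proof. exact: prop_quotP. Qed.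

Lemma quot_ind (P : quotm -> Prop) : (forall x, P (quot_pi x)) -> forall x, P x.
Proof. by move=> h x; rewrite -[x]prop_reprK; apply: h. Qed.

Lemma quot_repr x : L (prop_repr (quot_pi x) - x).
Proof. by apply/quot_piP; apply: prop_reprK. Qed.

Definition quot_add (x y : quotm) := quot_pi (prop_repr x + prop_repr y).
Definition quot_opp (x : quotm) := quot_pi (- prop_repr x).
Definition quot_scale (a : R) (x : quotm) := quot_pi (a *: prop_repr x).

Fact quot_addE x y : quot_add (quot_pi x) (quot_pi y) = quot_pi (x + y).
Proof.
apply/quot_piP; rewrite opprD addrACA.
by apply: smemD; apply: quot_repr.
Qed.
Fact quot_oppE x : quot_opp (quot_pi x) = quot_pi (- x).
Proof.
by apply/quot_piP; rewrite -opprD -[- _]scaleN1r; apply/smemZ/quot_repr.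
Qed.
Fact quot_scaleE a x : quot_scale a (quot_pi x) = quot_pi (a *: x).
Proof. by apply/quot_piP; rewrite -scalerBr; apply/smemZ/quot_repr. Qed.

Fact quot_addA : associative quot_add.
Proof.
elim/quot_ind=> x; elim/quot_ind=> y; elim/quot_ind=> z.
by rewrite !quot_addE addrA.
Qed.
Fact quot_addC : commutative quot_add.
Proof. by elim/quot_ind=> x; elim/quot_ind=> y; rewrite !quot_addE addrC. Qed.
Fact quot_add0 : left_id (quot_pi 0) quot_add.
Proof. by elim/quot_ind=> x; rewrite quot_addE add0r. Qed.
Fact quot_addN : left_inverse (quot_pi 0) quot_opp quot_add.
Proof. by elim/quot_ind=> x; rewrite quot_oppE quot_addE addNr. Qed.
HB.instance Definition _ :=
  GRing.isZmodule.Build quotm quot_addA quot_addC quot_add0 quot_addN.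

Fact quot_scaleA a b x : quot_scale a (quot_scale b x) = quot_scale (a * b) x.
Proof. by elim/quot_ind: x => x; rewrite !quot_scaleE scalerA. Qed.
Fact quot_scale1 : left_id 1 quot_scale.
Proof. by elim/quot_ind=> x; rewrite quot_scaleE scale1r. Qed.
Fact quot_scaleDr : right_distributive quot_scale +%R.
Proof.
move=> a; elim/quot_ind=> x; elim/quot_ind=> y.
by rewrite [quot_pi x + _]quot_addE !quot_scaleE [RHS]quot_addE scalerDr.
Qed.
Fact quot_scaleDl x : {morph quot_scale^~ x : a b / a + b}.
Proof.
move=> a b; elim/quot_ind: x => x.
by rewrite !quot_scaleE [RHS]quot_addE scalerDl.
Qed.
HB.instance Definition _ := GRing.Zmodule_isLmodule.Build R quotm
  quot_scaleA quot_scale1 quot_scaleDr quot_scaleDl.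

Fact quot_pi_linear : linear quot_pi.
Proof.
by move=> a x y; rewrite -quot_addE -quot_scaleE.
Qed.

Definition quot_hom : hom M quotm := mkhom quot_pi_linear.

Lemma quot_hom_surj : surjective quot_hom.
Proof. by elim/quot_ind=> x; exists x. Qed.

Lemma quot_hom0 x : quot_hom x = 0 <-> L x.
Proof. by rewrite -[x in L x]subr0 -quot_piP. Qed.

End Quotient.

Section Torsionless.
Variable R : comPzRingType.
Implicit Types M N P : lmodType R.

Definition torsionless M : Prop := forall x, (forall f : dual M, f x = 0) -> x = 0.

Definition bidual_onto M : Prop :=
  forall w : dual (dual M), exists x, forall f, w f = f x.

Lemma reflexiveP M : reflexive_module M <-> torsionless M /\ bidual_onto M.
Proof.
split=> [[h bh hb]|[tl bo]].
  split=> [x x0|w]; last first.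
    exists (h w) => f.
    exact: (congr1 (fun v : dual (dual M) => v f) (esym (hb w))).
  rewrite -[x]bh -[0]bh; congr h; apply: hom_ext => f.
  by rewrite -[LHS]/(f x) -[RHS]/(f 0) x0 linear0.
have [h hE] := choice bo.
exists h => [x|w]; last by apply: hom_ext => f; rewrite [RHS]hE.
apply/eqP; rewrite -subr_eq0; apply/eqP/tl => f.
by rewrite linearB -hE subrr.
Qed.

Lemma torsionless_inj M N (f : hom M N) : injective f -> torsionless N ->
  torsionless M.
Proof.
move=> /inj_ker0 inj tl x x0; apply: inj; apply: tl => g.
exact: (x0 (comph g f)).
Qed.

Lemma free_torsionless T : torsionless (free_module R T).
Proof. by move=> z h; apply: free_coord_inj => x; apply: h. Qed.

Lemma projective_torsionless P : projective P -> torsionless P.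
Proof.
move=> pP; have [s sE] := pP _ _ (free_cover P) (idh P) (@free_cover_surj _ P).
apply: (@torsionless_inj _ _ s) (@free_torsionless P).
by move=> x y e; rewrite -[x]/(idh P x) -sE e sE.
Qed.

Lemma syzygy1_torsionless M : syzygy1 M -> torsionless M.
Proof.
by move=> [P [f [pP injf]]]; apply: torsionless_inj injf (projective_torsionless pP).
Qed.

Lemma lin_comb_linear n M (g : 'I_n -> M) :
  linear (fun x : 'rV[R]_n => \sum_i x 0 i *: g i).
Proof.
move=> a x y; rewrite scaler_sumr -big_split; apply: eq_bigr => i _ /=.
by rewrite !mxE scalerDl scalerA.
Qed.

Definition lin_comb n M (g : 'I_n -> M) : hom 'rV[R]_n M :=
  mkhom (lin_comb_linear g).

Lemma lin_combE n M (g : 'I_n -> M) x : lin_comb g x = \sum_i x 0 i *: g i.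
Proof. by []. Qed.

Lemma lin_comb_delta n M (g : 'I_n -> M) i : lin_comb g (delta_mx 0 i) = g i.
Proof.
rewrite /= (bigD1 i) //= mxE !eqxx scale1r big1 ?addr0 // => j ji.
by rewrite mxE (negbTE ji) andbF scale0r.
Qed.

Lemma rV_hom_ext n M (f g : hom 'rV[R]_n M) :
  (forall i, f (delta_mx 0 i) = g (delta_mx 0 i)) -> f =1 g.
Proof.
move=> e x; rewrite (row_sum_delta x) !linear_sum; apply: eq_bigr => i _.
by rewrite !linearZ e.
Qed.

Lemma projective_rV n : projective 'rV[R]_n.
Proof.
move=> M N g f sg.
have [h hE] := choice (fun i => sg (f (delta_mx 0 i))).
exists (lin_comb h); apply: (@rV_hom_ext n N (comph g (lin_comb h)) f) => i.
by rewrite -[LHS]/(g (lin_comb h _)) lin_comb_delta.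
Qed.

Lemma fin_gen_rV n : fin_gen 'rV[R]_n.
Proof.
by exists n, (fun i => delta_mx 0 i) => x; exists (fun i => x 0 i); apply: row_sum_delta.
Qed.

Definition dual_basis n M (g : 'I_n -> M) (s : 'I_n -> dual M) : Prop :=
  forall x, x = \sum_i (s i x : R) *: g i.

Lemma projective_dual_basis P : projective P -> fin_gen P ->
  exists n (g : 'I_n -> P) s, dual_basis g s.
Proof.
move=> pP [n [g gP]].
have sg : surjective (lin_comb g).
  move=> x; have [c ->] := gP x; exists (\row_i c i); rewrite lin_combE.
  by apply: eq_bigr => i _; rewrite mxE.
have [s sE] := pP _ _ (lin_comb g) (idh P) sg.
have sl i : linear (fun x => s x 0 i : R^o) by move=> a x y; rewrite linearP !mxE.
by exists n, g, (fun i => mkhom (sl i)) => x; rewrite -[LHS](sE x).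
Qed.

Lemma dual_basis_dual n M (g : 'I_n -> M) s (f : dual M) : dual_basis g s ->
  f = \sum_i (f (g i) : R) *: s i.
Proof.
move=> db; apply: hom_ext => x; rewrite {1}(db x) linear_sum.
rewrite -[RHS]/(@bidual R M x _) linear_sum.
by apply: eq_bigr => i _; rewrite !linearZ [LHS]mulrC.
Qed.

Lemma dual_basis_reflexive n M (g : 'I_n -> M) s : dual_basis g s ->
  reflexive_module M.
Proof.
move=> db; apply/reflexiveP; split=> [x x0|w].
  by rewrite (db x) big1 // => i _; rewrite x0 scale0r.
exists (\sum_i (w (s i) : R) *: g i) => f.
rewrite linear_sum [in LHS](dual_basis_dual f db) linear_sum.
by apply: eq_bigr => i _; rewrite !linearZ [LHS]mulrC.
Qed.

(** Finitely many generators of the dual already separate points; they are the coordinates of an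
    embedding in R^k. *)
Lemma fin_gen_torsionless_syzygy1 M : noetherian R -> fin_gen M ->
  torsionless M -> syzygy1 M.
Proof.
move=> noe fM tl; have [k [f fP]] := dual_fin_gen noe fM.
have [h hE] := row_hom f.
exists 'rV[R]_k, h; split; first exact: projective_rV.
apply/inj_ker0 => x hx; apply: tl => u; have [c ->] := fP u.
rewrite -[LHS]/(@bidual R M x _) linear_sum big1 // => i _.
have fx : f i x = 0 by rewrite -[LHS]hE hx mxE.
by rewrite linearZ /= -[bidual x _]/(f i x) fx scaler0.
Qed.

(* A functional on the image of [P0^*] in [P1^*] is a point of [P0] killed by
   [M^*]; it extends to [P1^*] when it comes from [P1]. *)
Lemma torsionless_dual_onto M P1 P0 (d : hom P1 P0) (aug : hom P0 M) :
  reflexive_module P1 -> reflexive_module P0 -> surjective aug ->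
  exact_at d aug ->
  torsionless M <-> dual_onto (subm_incl (im (dual_map d))).
Proof.
move=> /reflexiveP[tl1 bo1] /reflexiveP[tl0 bo0] sa ex.
set I := im _.
have [e eE] := @subm_lift _ _ I _ (dual_map d) (fun x => ex_intro _ x erefl).
have se : surjective e.
  move=> y; have [x xE] := @subm_incl_mem _ _ I y.
  by exists x; apply: (@subm_incl_inj _ _ I); rewrite eE.
have ker_e f : e f = 0 <-> exists g, f = dual_map aug g.
  split=> [e0|[g ->]]; last first.
    apply: (@subm_incl_inj _ _ I); rewrite eE linear0; apply: hom_ext => x /=.
    by rewrite [aug _](_ : _ = 0) ?linear0 //; apply/ex; exists x.
  have fd x : f (d x) = 0.
    have := congr1 (fun v : subm I => (subm_incl I v : dual P1) x) e0.
    by rewrite eE linear0.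
  have [|g gE] := hom_factor sa (u := f).
    by move=> x /ex[y <-].
  by exists g; apply: hom_ext => x /=; rewrite gE.
split=> [tl u|ext m m0].
  have [p pE] := bo0 (comph u e).
  have : aug p = 0.
    apply: tl => g; rewrite -[LHS]/(dual_map aug g p) -pE /=.
    by rewrite (ker_e _).2 ?linear0 //; exists g.
  move/ex => [q qE]; exists (@bidual R P1 q) => x.
  have [f <-] := se x; rewrite -[RHS]/(comph u e f) pE eE -qE.
  by [].
have [p pE] := sa m.
have [|u uE] := @hom_factor R _ _ _ e (@bidual R P0 p) se.
  by move=> f /ker_e[g ->]; rewrite -[LHS]/(g (aug p)) pE.
have [v vE] := ext u; have [q qE] := bo1 v.
rewrite -pE; apply/ex; exists q; apply/eqP; rewrite -subr_eq0; apply/eqP/tl0 => f.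
rewrite linearB -[f (d q)]/(dual_map d f q) -qE -(eE f) vE uE.
exact: subrr.
Qed.

(** [T] is the quotient of [dual P1] by the image of the transposed presentation, so its vanishing
    Ext^1 lets functionals on that image extend to [dual P1]. *)
Lemma torsionfree1_torsionless M : torsionfree1 M -> torsionless M.
Proof.
move=> [T [P1 [P0 [d [aug [q [[p1 f1] [p0 f0] [sa ex] [sq exq]]]]]]] ET].
have [n1 [g1 [s1 db1]]] := projective_dual_basis p1 f1.
have [n0 [g0 [s0 db0]]] := projective_dual_basis p0 f0.
apply/(torsionless_dual_onto (dual_basis_reflexive db1)
  (dual_basis_reflexive db0) sa ex).
apply: (Ext_vanish_acyclic0 ET (g := q)); split=> //; first exact: subm_incl_inj.
move=> y; rewrite exq; split=> [[x <-]|[x <-]].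
  by apply: subm_inclP; exists x.
exact: (@subm_incl_mem _ _ (im (dual_map d))).
Qed.

Lemma projective_dual P : projective P -> fin_gen P -> projective (dual P).
Proof.
move=> pP fP; have [n [g [s db]]] := projective_dual_basis pP fP.
move=> A B h f sh.
have [a aE] := choice (fun i => sh (f (s i))).
have [r rE] := row_hom (fun i => @bidual R P (g i)).
exists (comph (lin_comb a) r) => u.
rewrite -[LHS]/(h (\sum_i r u 0 i *: a i)) linear_sum.
rewrite [in RHS](dual_basis_dual u db) linear_sum; apply: eq_bigr => i _.
by rewrite !linearZ aE rE.
Qed.

(** The transpose is taken from the given presentation; [dual P1] is a projective cover of it, on
    which Ext^1 can be tested. *)
Lemma torsionless_torsionfree1 M P1 P0 (d : hom P1 P0) (aug : hom P0 M) :
  projective P1 -> fin_gen P1 -> projective P0 -> fin_gen P0 ->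
  surjective aug -> exact_at d aug -> torsionless M -> torsionfree1 M.
Proof.
move=> p1 f1 p0 f0 sa ex tl.
pose I := im (dual_map d); pose q := quot_hom I.
have exq : exact_at (dual_map d) q by move=> y; rewrite quot_hom0.
have sq : surjective q by exact: quot_hom_surj.
exists (quotm I).
  by exists P1, P0, d, aug, q.
apply: acyclic0_Ext_vanish.
have [n1 [g1 [s1 db1]]] := projective_dual_basis p1 f1.
have [n0 [g0 [s0 db0]]] := projective_dual_basis p0 f0.
apply: (dual_acyclic0_proj (f := subm_incl I) (g := q)).
- exact: projective_dual.
- split=> //; first exact: subm_incl_inj.
  move=> y; rewrite quot_hom0; split=> [h|[x <-]]; first exact: subm_inclP.
  exact: subm_incl_mem.
- exact: (torsionless_dual_onto (dual_basis_reflexive db1)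
    (dual_basis_reflexive db0) sa ex).1 tl.
Qed.

End Torsionless.

(** * Rings of depth zero *)

Lemma fin_gen_surj (R : comPzRingType) (M N : lmodType R) (f : hom M N) :
  surjective f -> fin_gen M -> fin_gen N.
Proof.
move=> sf [k [g gM]]; exists k, (f \o g) => y; have [x <-] := sf y.
have [c ->] := gM x; exists c; rewrite linear_sum.
by apply: eq_bigr => i _; rewrite linearZ.
Qed.

Section DepthZero.
Variable R : comPzRingType.
Hypothesis noeR : noetherian R.
Variable c : R.
Hypothesis c_neq0 : c <> 0.
Hypothesis c_socle : forall s : R, ~ is_unit s -> c * s = 0.
Implicit Types B C D N Z : lmodType R.

(** Generators are adjoined to [L] until a single missing one, [g], would give all of [D]. Then
    [l + a *: g] is sent to [c * a]: if [a *: g] lies in [L], then [a] is not a unit, and [c] kills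
    it. *)
Lemma exists_functional D (L : submodule D) : fin_gen D -> ~ (forall x, L x) ->
  exists phi : dual D, (forall x, L x -> phi x = 0) /\ ~ (forall x, phi x = 0).
Proof.
move=> /fin_genP[s sD].
(* Only generation modulo [L] is kept, since generators move from [s] into [L] during the
   induction. *)
have {}sD : forall K : submodule D, (forall x, L x -> K x) ->
    (forall x, x \in s -> K x) -> forall x, K x by move=> K _; apply: sD.
elim: s L sD => [|g s IH] L sD nL; first by case: nL; apply: sD.
have LA x : L x -> adjoin L g x.
  by move=> Lx; exists x, 0; rewrite scale0r addr0.
have Ag : adjoin L g g by exists 0, 1; rewrite scale1r add0r; split=> //; apply: smem0.
have [tot|] := pselect (forall x, adjoin L g x); last first.
  case/IH => [K AK Ks|phi [phi0 nphi]].
    apply: sD => [x /LA /AK //|x]; rewrite in_cons => /orP[/eqP ->|/Ks //].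
    exact: AK.
  by exists phi; split=> // x /LA; apply: phi0.
have ng : ~ L g.
  move=> Lg; apply: nL => x; have [l [a [Ll ->]]] := tot x.
  by apply: smemD => //; apply: smemZ.
have [x|a x y x' y'|y|phi phiE] := @graph_hom R D R^o
    (fun x y => exists l a, [/\ L l, x = l + a *: g & y = c * a]).
- by have [l [a [Ll ->]]] := tot x; exists (c * a), l, a.
- move=> [l [b [Ll -> ->]]] [l' [b' [Ll' -> ->]]].
  exists (a *: l + l'), (a * b + b'); split; first exact: smemP.
    by rewrite scalerDr scalerDl scalerA addrACA.
  by rewrite mulrDr mulrCA.
- move=> [l [a [Ll e ->]]]; apply: c_socle => -[b ab]; apply: ng.
  have -> : g = (- b) *: l.
    apply/eqP; rewrite -subr_eq0 scaleNr opprK addrC.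
    by rewrite -[g in _ + g]scale1r -ab mulrC -scalerA -scalerDr -e scaler0.
  exact: smemZ.
exists phi; split=> [x Lx|/(_ g)].
  by apply: phiE; exists x, 0; rewrite scale0r addr0 mulr0.
rewrite (phiE _ c); first exact: c_neq0.
by exists 0, 1; rewrite scale1r add0r mulr1; split=> //; apply: smem0.
Qed.

(* The cokernel [E] of [B^* -> Z^*] has [E^* = 0], since [Z^** -> B^**] is
   injective; over a ring of depth 0 this forces [E = 0]. *)
Lemma dual_onto_depth0 Z B (f : hom Z B) : injective f -> torsionless B ->
  bidual_onto Z -> fin_gen Z -> dual_onto f.
Proof.
move=> injf tB bZ fZ u; apply: contrapT => nu.
have [|phi [phi0 nphi]] :=
    @exists_functional _ (im (dual_map f)) (dual_fin_gen noeR fZ).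
  by move=> /(_ u)[v vE]; apply: nu; exists v => x; rewrite -vE.
have [z zE] := bZ phi; apply: nphi => g; rewrite zE.
suff -> : z = 0 by rewrite linear0.
apply: injf; rewrite linear0; apply: tB => v.
by rewrite -[LHS](zE (dual_map f v)) phi0 //; exists v.
Qed.

Lemma dual_ses Z B C (f : hom Z B) (g : hom B C) : ses f g -> dual_onto f ->
  ses (dual_map g) (dual_map f).
Proof.
move=> sfg of_; have [injf sg ex] := sfg; split.
- move=> u v e; apply: hom_ext => x; have [y <-] := sg x.
  exact: (congr1 (fun w : dual B => w y) e).
- by move=> u; have [v vE] := of_ u; exists v; apply: hom_ext.
- move=> u; split=> [u0|[v <-]]; last first.
    by apply: hom_ext => x /=; rewrite (ses_comp0 x sfg) linear0.
  have [|v vE] := hom_factor sg (u := u).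
    by move=> x /ex[y <-]; exact: (congr1 (fun w : dual Z => w y) u0).
  by exists v; apply: hom_ext.
Qed.

(** The dual sequence is exact, and Ext^1(Z^*, R) = 0 keeps it exact under a second dualization; the
    rest is the five lemma for the biduality maps. *)
Lemma coker_reflexive Z B C (f : hom Z B) (g : hom B C) : ses f g ->
  dual_onto f -> reflexive_module Z -> reflexive_module B ->
  dual_acyclic 0 (dual Z) -> reflexive_module C.
Proof.
move=> sfg of_ /reflexiveP[_ bZ] /reflexiveP[tB bB] YZ.
have sd := dual_ses sfg of_; have [_ sf _] := sd; have [_ sg ex] := sfg.
apply/reflexiveP; split=> [x x0|w]; last first.
  have [v vE] := YZ _ _ _ _ sd w; have [b bE] := bB v.
  by exists (g b) => h; rewrite -vE bE.
have [b bE] := sg x; have [||v vE] := @hom_factor R _ _ _ (dual_map f) (@bidual R B b).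
- exact: sf.
- move=> u; have [_ _ ->] := sd => -[h <-].
  by rewrite -[LHS]/(h (g b)) bE.
have [z zE] := bZ v.
suff -> : x = g (f z) by rewrite (ses_comp0 _ sfg).
rewrite -bE; congr (g _); apply/eqP; rewrite -subr_eq0; apply/eqP/tB => u.
by rewrite linearB -[u (f z)]/(dual_map f u z) -zE vE subrr.
Qed.

(** The Ext condition is put on the dual: for a cokernel [C] of [Z -> B] the dual of [C] is a
    kernel, and kernels inherit acyclicity by [dual_acyclic_ker]. *)
Definition dual_good Z : Prop :=
  [/\ fin_gen Z, reflexive_module Z & forall i, dual_acyclic i (dual Z)].

Lemma totally_reflexive_good Z : totally_reflexive Z -> dual_good Z.
Proof.
by case=> fZ rZ e; split=> //; apply: Ext_vanish_acyclic => i; case: (e i.+1).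
Qed.

Lemma dual_good_coker Z B C (f : hom Z B) (g : hom B C) : ses f g ->
  dual_good Z -> dual_good B -> dual_good C.
Proof.
move=> sfg [fZ rZ yZ] [fB rB yB]; have [injf sg ex] := sfg.
have of_ : dual_onto f.
  by apply: dual_onto_depth0 => //; [case/reflexiveP: rB|case/reflexiveP: rZ].
split; first exact: fin_gen_surj fB.
  exact: coker_reflexive sfg of_ rZ rB (yZ 0).
by move=> i; apply: dual_acyclic_ker (dual_ses sfg of_) (yB i) (yZ i.+1).
Qed.

(** The image of each differential is the cokernel of the inclusion of the next image, so goodness
    travels from the vanishing end of the resolution down to [N]. *)
Lemma Gdim_good N m : Gdim_le N m -> dual_good N.
Proof.
move=> [G [tr bd]].
have gG i : dual_good (res_mod G i) by apply/totally_reflexive_good/tr.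
pose I i := im (res_d G i).
have [e eE] : exists e : forall i, hom (res_mod G i.+1) (subm (I i)),
    forall i x, subm_incl (I i) (e i x) = res_d G i x.
  suff h i : {e : hom (res_mod G i.+1) (subm (I i)) |
      forall x, subm_incl (I i) (e x) = res_d G i x}.
    by exists (fun i => sval (h i)) => i; apply: (svalP (h i)).
  by apply/cid/subm_lift => x; exists x.
have se i : surjective (e i).
  move=> y; have [x xE] := @subm_incl_mem _ _ (I i) y.
  by exists x; apply: (@subm_incl_inj _ _ (I i)); rewrite eE.
have e0 i x : e i x = 0 <-> res_d G i x = 0.
  rewrite -eE; split=> [->|h]; first by rewrite linear0.
  by apply: (@subm_incl_inj _ _ (I i)); rewrite h linear0.
have H k i : (m <= i + k)%N -> dual_good (subm (I i)).
  elim: k i => [|k IH] i mi.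
    (* Here [res_mod G i.+2] is zero, hence the differential out of it is injective. *)
    apply: (dual_good_coker (f := res_d G i.+1) (g := e i) _ (gG i.+2) (gG i.+1)).
    split=> //.
      by move=> x y _; rewrite (bd i.+2 _ x) ?(bd i.+2 _ y) // !ltnS leqW // -[i]addn0.
    by move=> y; rewrite e0; apply: (@res_exact _ _ G i).
  have gI : dual_good (subm (I i.+1)) by apply: IH; rewrite addSnnS.
  apply: (dual_good_coker (f := subm_incl (I i.+1)) (g := e i) _ gI (gG i.+1)).
  split=> //; first exact: subm_incl_inj.
  move=> y; rewrite e0 (@res_exact _ _ G i); split=> [h|[x <-]].
    exact: (@subm_inclP _ _ (I i.+1)).
  exact: (@subm_incl_mem _ _ (I i.+1)).
apply: (dual_good_coker (f := subm_incl (I 0)) (g := res_aug G) _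
  (H m 0 (leqnn _)) (gG 0)).
split; [exact: subm_incl_inj|exact: res_aug_surj|].
move=> y; rewrite (@res_exact0 _ _ G); split=> [h|[x <-]].
  exact: (@subm_inclP _ _ (I 0)).
exact: (@subm_incl_mem _ _ (I 0)).
Qed.

(** The functional [v] descends to the image of [r], the cokernel of [j]. This image is reflexive
    because [D] is good, so [dual_onto_depth0] extends functionals from it to [F1]. *)
Lemma Gdim_dual_exact D F0 F1 m (j : hom D F0) (r : hom F0 F1) (v : dual F0) :
  Gdim_le D m -> injective j -> exact_at j r -> fin_gen F0 ->
  reflexive_module F0 -> reflexive_module F1 -> (forall x, v (j x) = 0) ->
  exists w : dual F1, forall x, v x = w (r x).
Proof.
move=> /Gdim_good[fD rD yD] injj ex f0 r0 r1 vj.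
have [e eE] := @subm_lift _ _ (im r) _ r (fun x => ex_intro _ x erefl).
have se : surjective e.
  move=> y; have [x xE] := @subm_incl_mem _ _ (im r) y.
  by exists x; apply: (@subm_incl_inj _ _ (im r)); rewrite eE.
have sje : ses j e.
  split=> // y; rewrite -ex -eE; split=> [->|h]; first by rewrite linear0.
  by apply: (@subm_incl_inj _ _ (im r)); rewrite h linear0.
have oj : dual_onto j.
  by apply: dual_onto_depth0 => //; [case/reflexiveP: r0|case/reflexiveP: rD].
have /reflexiveP[_ bI] := coker_reflexive sje oj rD r0 (yD 0).
have [|u uE] := hom_factor se (u := v).
  by move=> x; have [_ _ exj] := sje => /exj[y <-].
have [|w wE] := dual_onto_depth0 (@subm_incl_inj _ _ (im r)) _ bI (fin_gen_surj se f0) u.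
  by case/reflexiveP: r1.
by exists w => x; rewrite -eE wE uE.
Qed.

End DepthZero.

(** * Zero divisors in Noetherian rings *)

Section MaximalAnnihilators.
Variable R : comPzRingType.
Hypothesis noeR : noetherian R.

(** Without a maximal member, choice builds a strictly increasing chain of ideals, while finite
    generation of its union stops the chain. *)
Lemma maximal_submodule (F : submodule R^o -> Prop) : (exists I, F I) ->
  exists I, F I /\ forall J, F J -> (forall x, I x -> J x) -> forall x, J x -> I x.
Proof.
move=> [I0 FI0]; apply: contrapT => nmax.
have step (I : {I | F I}) : exists J : {J | F J},
    (forall x, sval I x -> sval J x) /\ exists2 x, sval J x & ~ sval I x.
  apply: contrapT => n; apply: nmax; exists (sval I); split; first exact: (svalP I).
  move=> J FJ IJ x Jx; apply: contrapT => nx; apply: n.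
  by exists (exist _ J FJ); split=> //; exists x.
have [next nextP] := choice step.
pose I n := sval (iter n next (exist _ I0 FI0)).
have Imono m n x : (m <= n)%N -> I m x -> I n x.
  move=> /subnK <-; elim: (n - m)%N => // d IH /IH.
  by rewrite addSn; apply: (nextP _).1.
have U0 : exists n, I n 0 by exists 0%N; apply: smem0.
have UP (a : R) (x y : R^o) : (exists n, I n x) -> (exists n, I n y) ->
    exists n, I n (a *: x + y).
  move=> [m Ix] [n Iy]; exists (maxn m n).
  by apply: smemP; [apply: Imono Ix; rewrite leq_maxl|apply: Imono Iy; rewrite leq_maxr].
have [s [sU hs]] := fg_ideal noeR (Submodule U0 UP).
have [N IN] : exists N, forall x, x \in s -> I N x.
  elim: s sU {hs} => [|x s IH] sU; first by exists 0%N.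
  have [|N IN] := IH; first by move=> y ys; apply: sU; rewrite in_cons ys orbT.
  have [n Ix] := sU x (mem_head _ _); exists (maxn n N) => y.
  rewrite in_cons => /orP[/eqP ->|/IN]; last exact/Imono/leq_maxr.
  exact: Imono (leq_maxl n N) Ix.
have [_ [x Jx]] := nextP (iter N next (exist _ I0 FI0)); apply.
by apply: hs IN _ _; exists N.+1.
Qed.

Section Module.
Variable M : lmodType R.

Fact ann0 (x : M) : (0 : R) *: x = 0. Proof. exact: scale0r. Qed.
Fact annP (x : M) (a : R) (b c : R^o) :
  (b : R) *: x = 0 -> (c : R) *: x = 0 -> (a *: b + c : R) *: x = 0.
Proof.
by move=> bx cx; rewrite scalerDl cx -scalerA bx scaler0 addr0.
Qed.

Definition ann (x : M) : submodule R^o := Submodule (ann0 x) (annP (x := x)).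

Definition max_ann (K : submodule M) (x : M) : Prop :=
  [/\ K x, x <> 0 & forall y, K y -> y <> 0 ->
    (forall a : R, a *: x = 0 -> a *: y = 0) -> forall a : R, a *: y = 0 -> a *: x = 0].

(** If [b *: x] is nonzero, its annihilator contains that of [x] and so equals it by maximality. *)
Lemma max_ann_prime K x : max_ann K x ->
  exists p : prime_ideal R, forall a, pset p a <-> a *: x = 0.
Proof.
move=> [Kx x0 mx].
have idl : is_ideal (fun a : R => a *: x = 0).
  split=> [|a b ax bx|a b bx]; first exact: scale0r.
    by rewrite scalerDl ax bx addr0.
  by rewrite -scalerA bx scaler0.
have n1 : ~ (1 : R) *: x = 0 by rewrite scale1r.
have pM (a b : R) : (a * b) *: x = 0 -> a *: x = 0 \/ b *: x = 0.
  rewrite -scalerA => abx; have [|bx] := pselect (b *: x = 0); first by right.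
  left; apply: (mx (b *: x)) => // [|d dx]; first exact: smemZ.
  by rewrite scalerA mulrC -scalerA dx scaler0.
by exists (PrimeIdeal idl n1 pM).
Qed.

Lemma exists_max_ann (K : submodule M) y : K y -> y <> 0 ->
  exists x, max_ann K x /\ forall a : R, a *: y = 0 -> a *: x = 0.
Proof.
move=> Ky y0.
have [|I [[x [Kx x0 Ix yx]] mx]] := @maximal_submodule (fun I => exists x,
    [/\ K x, x <> 0, forall a, I a <-> ann x a & forall a : R, a *: y = 0 -> a *: x = 0]).
  by exists (ann y), y.
exists x; split=> //; split=> // z Kz z0 xz a az; apply/Ix.
apply: (mx (ann z)) az => [|b /Ix]; last exact: xz.
by exists z; split=> // b /yx /xz.
Qed.

End Module.

(** A maximal ideal among those spanned by finitely many elements of [A] contains all of [A]. This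
    is what selects finitely many of the maximal annihilators. *)
Lemma finite_span (A : R^o -> Prop) : exists s : seq R^o,
  (forall x, x \in s -> A x) /\
  forall L : submodule R^o, (forall x, x \in s -> L x) -> forall x, A x -> L x.
Proof.
pose sp (s : seq R^o) := span (fun i : 'I_(size s) => s`_i).
have spE s (L : submodule R^o) : (forall x, x \in s -> L x) -> forall x, sp s x -> L x.
  by move=> sL x [c ->]; apply: smem_sum => i; apply/sL/mem_nth.
have sp_mem (s : seq R^o) x : x \in s -> sp s x.
  move=> /(nthP 0)[i si <-].
  exact: (span_gen (fun i : 'I_(size s) => s`_i) (Ordinal si)).
have [|I [[s sA sI] mx]] := @maximal_submodule (fun I => exists2 s : seq R^o,
    forall x, x \in s -> A x & forall x, I x <-> sp s x).
  by exists (sp [::]), [::].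
exists s; split=> // L sL x Ax; apply: (spE s) => //; apply/sI.
apply: (mx (sp (x :: s))); last by apply: sp_mem; rewrite mem_head.
  by exists (x :: s) => // y; rewrite in_cons => /orP[/eqP ->|/sA].
move=> y /sI; apply: spE => z zs; apply: sp_mem.
by rewrite in_cons zs orbT.
Qed.

(** If [x] avoids the primes of [s] but lies in a further prime [P b], it is replaced by [x + z * y]
    with [y] in [I] outside [P b], and [z] in all primes of [s] but not in [P b]. *)
Lemma prime_avoidance (T : Type) (P : T -> prime_ideal R) (I : set R) (s : seq T) :
  is_ideal I ->
  (forall b b', (P b : set R) `<=` P b' -> (P b' : set R) `<=` P b) ->
  (forall b, ~ I `<=` P b) ->
  exists2 x, I x & all (fun b => `[< ~ pset (P b) x >]) s.
Proof.
move=> [I0 ID IM] inc nI; elim: s => [|b s [x Ix xs]]; first by exists 0.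
have [xb|nxb] := pselect (pset (P b) x); last first.
  by exists x => //=; rewrite xs andbT; apply/asboolP.
(* Since [x] is in [P b] and not in [P b'], [inc] forbids that [P b'] lie in [P b]; [z] multiplies
   one witness of this for each [b']. *)
have [z zP] : exists z, ~ pset (P b) z /\
    all (fun b' => `[< pset (P b') z >]) s.
  elim: s xs => [|b' s IH] /=; first by exists 1; split=> //; apply: pset1.
  move=> /andP[/asboolP xb' /IH[z [nz zs]]].
  have [w [wb' wb]] : exists w, pset (P b') w /\ ~ pset (P b) w.
    apply: contrapT => n; apply: xb'; apply: (inc b' b _ x xb) => w wb'.
    by apply: contrapT => nw; apply: n; exists w.
  have [_ _ M'] := pset_ideal (P b').
  exists (z * w); split; first exact: pset_mulN.
  apply/andP; split; first by apply/asboolP/M'.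
  apply: sub_all zs => b'' /asboolP z''; apply/asboolP; rewrite mulrC.
  by have [_ _ M''] := pset_ideal (P b''); apply: M''.
have [y Iy ny] : exists2 y, I y & ~ pset (P b) y.
  apply: contrapT => n; apply: (nI b) => y Iy.
  by apply: contrapT => ny; apply: n; exists y.
case: zP => nz zs.
have sub (p : prime_ideal R) u v : pset p (u + v) -> pset p u -> pset p v.
  have [_ D M'] := pset_ideal p => uv /(M' (-1)) h.
  by have := D _ _ uv h; rewrite mulN1r addrAC subrr add0r.
exists (x + z * y); first by apply: ID => //; apply: IM.
apply/andP; split; first by apply/asboolP => /sub /(_ xb); apply: pset_mulN.
elim: s xs zs {I0} => //= b' s IH /andP[/asboolP xb' xs] /andP[/asboolP zb' zs].
apply/andP; split; last exact: IH.
apply/asboolP => h; apply: xb'; move: h; rewrite addrC => /sub; apply.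
by rewrite mulrC; have [_ _ M'] := pset_ideal (P b'); apply: M'.
Qed.

(* The maximal annihilators of nonzero elements are finitely many primes, whose
   union is the set of zero divisors. *)
Lemma ideal_of_zero_divisors (I : set R) : is_ideal I ->
  (forall a, I a -> exists b : R, b <> 0 /\ a * b = 0) ->
  exists c : R, c <> 0 /\ forall a, I a -> a * c = 0.
Proof.
move=> idI zd; apply: contrapT => nc.
pose K := @Submodule R R^o (fun=> True) Logic.I (fun _ _ _ _ _ => Logic.I).
pose A := max_ann K.
have [s [sA As]] := finite_span A.
pose T := {x | A x}.
have [P PE] := choice (fun x : T => max_ann_prime (svalP x)).
have inc (b b' : T) : (P b : set R) `<=` P b' -> (P b' : set R) `<=` P b.
  move=> h a /PE ha; apply/PE; case: (svalP b) => _ _ mx.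
  case: (svalP b') => Kb' b'0 _; apply: (mx _ Kb' b'0) ha.
  by move=> d /PE /h /PE.
have nI (b : T) : ~ I `<=` P b.
  move=> h; apply: nc; exists (sval b : R); split; first by case: (svalP b).
  by move=> a /h /PE.
have [t tE] : exists t : seq T, [seq (sval x : R^o) | x <- t] = s.
  elim: s sA {As} => [|x s IH] sA; first by exists [::].
  have [|t <-] := IH; first by move=> y ys; apply: sA; rewrite in_cons ys orbT.
  by exists (exist _ x (sA x (mem_head _ _)) :: t).
have [x Ix xt] := prime_avoidance t idI inc nI.
have [b [b0 xb]] := zd x Ix.
have [a [Aa ba]] := exists_max_ann (K := K) (y := (b : R^o)) Logic.I b0.
pose a' : T := exist _ a Aa.
(* [x] kills [a], so it lies in [P a'], but it avoids every [P d]; by [inc] no [P d] is contained in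
   [P a']. *)
have : all (fun b => `[< exists r, pset (P b) r /\ ~ pset (P a') r >]) t.
  elim: t xt {tE} => //= d t IH /andP[/asboolP xd /IH ->]; rewrite andbT.
  apply/asboolP; apply: contrapT => n; apply/xd/(@inc d a').
    by move=> r dr; apply: contrapT => nr; apply: n; exists r.
  exact/PE/ba.
move=> hall.
(* A product of such witnesses kills [s], hence everything spanned by it and in particular [a],
   although it is outside the annihilator [P a'] of [a]. *)
have [r [nr rs]] : exists r, ~ pset (P a') r /\ forall y, y \in s -> ann (y : R^o) r.
  rewrite -tE; elim: t hall {xt tE} => [|d t IH] /=.
    by exists 1; split=> //; apply: pset1.
  move=> /andP[/asboolP[w [wd wa]] /IH[r [nr rs]]]; exists (w * r).
  split; first exact: pset_mulN.
  move=> y; rewrite in_cons => /orP[/eqP ->|/rs yr].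
    by rewrite /= mulrC -scalerA (PE d w).1 ?scaler0.
  by rewrite /= -scalerA [_ *: y]yr scaler0.
have rP (u : R) (x' y' : R^o) : (r : R) *: x' = 0 -> r *: y' = 0 ->
    r *: (u *: x' + y') = 0.
  by move=> rx ry; rewrite scalerDr ry addr0 scalerA mulrC -scalerA rx scaler0.
apply/nr/PE.
exact: (As (@Submodule R R^o (fun y => r *: y = 0) (scaler0 _ r) rP) rs a Aa).
Qed.

End MaximalAnnihilators.

(** * Depth and localization *)

Lemma homZ (R : comPzRingType) (M N : lmodType R) (f : hom M N) a x :
  f (a *: x) = a *: f x.
Proof. exact: linearZ. Qed.

Section Depth.
Variables (R : comPzRingType) (M : lmodType R).

Lemma depth_geS k : depth_ge M k.+1 -> depth_ge M 1.
Proof.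
move=> [x [nx rx]]; exists (fun=> x ord0); split=> // i m; rewrite (ord1 i) /=.
move=> [c]; rewrite big_pred0 // => xm.
have [|d] := rx ord0 m; first by exists (fun=> 0); rewrite big_pred0.
by rewrite big_pred0 // => ->; exists (fun=> 0); rewrite big_pred0.
Qed.

Lemma depth_ge1P :
  depth_ge M 1 <-> exists x : R, ~ is_unit x /\ forall m : M, x *: m = 0 -> m = 0.
Proof.
split=> [[x [nx rx]]|[x [nx rx]]].
  exists (x ord0); split=> // m xm.
  have [|d] := rx ord0 m; first by exists (fun=> 0); rewrite big_pred0.
  by rewrite big_pred0.
exists (fun=> x); split=> // i m; rewrite (ord1 i) /= => -[c].
rewrite big_pred0 // => /rx ->.
by exists (fun=> 0); rewrite big_pred0.
Qed.

Lemma depth_spec : depth M = +oo%E \/ exists k, [/\ depth M = (k%:Z)%:E,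
  depth_ge M k & forall l, depth_ge M l -> (l <= k)%N].
Proof.
rewrite /depth; case: xgetP => [y _|]; last by left.
by move=> [k [hk mk] <-]; right; exists k.
Qed.

Lemma depth_ge0 : (0 <= depth M)%E.
Proof. by case: depth_spec => [->|[k [-> _ _]]]; rewrite ?leey // lee_fin. Qed.

Lemma depth_eq0 : ~ depth_ge M 1 -> depth M = 0%:E.
Proof.
move=> n1; have m0 k : depth_ge M k -> (k <= 0)%N by case: k => // k /depth_geS.
(* The branch of the default value [+oo] is excluded by the empty sequence, of length 0. *)
rewrite /depth; case: xgetP => [y _ [k [hk _] <-]|/(_ 0%:E) []].
  by move: hk => /m0; rewrite leqn0 => /eqP ->.
exists 0%N => //; split=> [|l /m0 //].
by exists (fun=> 0); split=> -[].
Qed.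

Lemma depth_ge1E : (1%:E <= depth M)%E <-> depth_ge M 1.
Proof.
split=> [h|h]; last first.
  case: depth_spec => [->|[k [-> _ mk]]]; rewrite ?leey // lee_fin.
  exact: mk h.
by apply: contrapT => /depth_eq0 d0; move: h; rewrite d0.
Qed.

End Depth.

(** Depths are natural numbers or [+oo], so a comparison capped at 1 only asks for the existence of
    one regular non-unit. *)
Lemma S1_tildeP (R : comPzRingType) (M : lmodType R) : S1_tilde M <->
  forall p : prime_ideal R, depth_ge (loc_ring p)^o 1 -> depth_ge (loc p M) 1.
Proof.
split=> h p; last first.
  have [/h|/depth_eq0 ->] := pselect (depth_ge (loc_ring p)^o 1).
    by move/depth_ge1E; apply: le_trans; rewrite ge_min lexx.
  by apply: le_trans (depth_ge0 _); rewrite ge_min lexx orbT.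
move/depth_ge1E => d1; apply/depth_ge1E; apply: le_trans (h p).
by rewrite le_min lexx.
Qed.

(** * Localization at a prime: exactness, non-units, the Noetherian property *)

Section Localization.
Variables (R : comPzRingType) (q : prime_ideal R).
Implicit Types M N : lmodType R.
Local Notation S := (loc_ring q).

Lemma mkfrac_irr M (m : M) s (h h' : ~ pset q s) : mkfrac m h = mkfrac m h'.
Proof. by congr mkfrac; apply: Prop_irrelevance. Qed.

Lemma mkfrac_eq0 M (m : M) s (hs : ~ pset q s) :
  mkfrac m hs = 0 <-> exists2 u, ~ pset q u & u *: m = 0.
Proof.
rewrite -[0](mkfrac0 _ hs) mkfrac_eq; split=> -[u nu e].
  exists (u * s); first exact: pset_mulN.
  by rewrite -scalerA e !scaler0.
by exists u => //; rewrite !scaler0 scalerA mulrC -scalerA e scaler0.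
Qed.

Definition frac1 M (m : M) : loc q M := mkfrac m (@pset1 R q).

Lemma scale_frac M (a : R) (m : M) s t (hs : ~ pset q s) (ht : ~ pset q t)
  (hst : ~ pset q (s * t)) :
  (mkfrac (a : R^o) hs : S) *: mkfrac m ht = mkfrac (a *: m) hst.
Proof. exact: loc_scaleE. Qed.

Lemma frac1_linear M (a : R) (x y : M) :
  frac1 (a *: x + y) = (frac1 (a : R^o) : S) *: frac1 x + frac1 y.
Proof.
have h : ~ pset q (1 * 1) by rewrite mulr1; apply: pset1.
rewrite (scale_frac _ _ _ _ h) /frac1.
rewrite -mkfracD; congr (_ + _); apply/mkfrac_eq.
by exists 1; rewrite ?mulr1 //; apply: pset1.
Qed.

Lemma frac_split M (m : M) s (hs : ~ pset q s) :
  mkfrac m hs = (mkfrac (1 : R^o) hs : S) *: frac1 m.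
Proof.
have h : ~ pset q (s * 1) by rewrite mulr1.
rewrite (scale_frac _ _ _ _ h) scale1r.
by apply/mkfrac_eq; exists 1; rewrite ?mulr1 //; apply: pset1.
Qed.

Lemma nonunit_frac (a : R) s (hs : ~ pset q s) :
  ~ is_unit (mkfrac (a : R^o) hs : S) <-> pset q a.
Proof.
split=> [nu|qa [b]].
  apply: contrapT => na; apply: nu; exists (mkfrac (s : R^o) na).
  have h : ~ pset q (s * a) by apply: pset_mulN.
  rewrite [LHS](loc_scaleE _ _ _ _ h); apply/mkfrac_eq; exists 1; first exact: pset1.
  by rewrite !scale1r -[RHS]/((s * a) * 1) mulr1 [LHS]mulrC.
elim/mkfrac_ind: b => b t ht.
rewrite [X in X = _ -> _](loc_scaleE _ _ _ _ (pset_mulN hs ht)).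
move/mkfrac_eq => [u nu]; rewrite scale1r => e; apply: (pset_mulN nu (pset_mulN hs ht)).
have [_ _ M'] := pset_ideal q.
have -> : u * (s * t) = u * (b * a).
  by rewrite [b * a]mulrC; apply: esym; rewrite -[s * t]mulr1; apply: e.
by rewrite mulrA; apply: M'.
Qed.

Definition loc_map_fun M N (f : hom M N) (x : loc q M) : loc q N :=
  mkfrac (f (fnum (prop_repr x))) (@fdenP _ _ _ (prop_repr x)).

Lemma loc_map_funE M N (f : hom M N) m s (hs : ~ pset q s) :
  loc_map_fun f (mkfrac m hs) = mkfrac (f m) hs.
Proof.
rewrite /loc_map_fun; have [n [t [ht [-> [u nu e]]]]] := repr_mkfrac m hs.
by apply/mkfrac_eq; exists u => //=; rewrite -!(homZ f) e.
Qed.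

Fact loc_map_linear M N (f : hom M N) : linear (loc_map_fun f : loc q M -> loc q N).
Proof.
move=> a; apply: mkfrac_ind2 => m n s hs; elim/mkfrac_ind: a => a t ht.
have hts := pset_mulN ht hs.
rewrite loc_map_funE (scale_frac _ _ _ _ hts).
rewrite (mkfrac_expand n hs ht hts) mkfracD !loc_map_funE (scale_frac _ _ _ _ hts).
by rewrite mkfracD linearD !(homZ f).
Qed.

Fact loc_map_subproof M N (f : hom M N) :
  {g : hom (loc q M) (loc q N) | g =1 loc_map_fun f}.
Proof. by exists (mkhom (loc_map_linear f)). Qed.

Definition loc_map M N (f : hom M N) : hom (loc q M) (loc q N) :=
  sval (loc_map_subproof f).

Lemma loc_mapE M N (f : hom M N) m s (hs : ~ pset q s) :
  loc_map f (mkfrac m hs) = mkfrac (f m) hs.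
Proof. by rewrite /loc_map (svalP (loc_map_subproof f)) loc_map_funE. Qed.

Lemma loc_map_inj M N (f : hom M N) : injective f -> injective (loc_map f).
Proof.
move=> inj; apply/inj_ker0; elim/mkfrac_ind => m s hs.
rewrite loc_mapE => /mkfrac_eq0[u nu]; rewrite -(homZ f) => e.
apply/mkfrac_eq0; exists u => //; apply: inj; by rewrite e linear0.
Qed.

Lemma loc_map_exact M N P (f : hom M N) (g : hom N P) :
  exact_at f g -> exact_at (loc_map f) (loc_map g).
Proof.
move=> ex y; split=> [|[x <-]]; last first.
  elim/mkfrac_ind: x => m s hs; rewrite !loc_mapE.
  apply/mkfrac_eq0; exists 1; first exact: pset1.
  by rewrite scale1r; apply/ex; exists m.
elim/mkfrac_ind: y => n s hs; rewrite loc_mapE => /mkfrac_eq0[u nu].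
rewrite -(homZ g) => /ex[m mE]; exists (mkfrac m (pset_mulN nu hs)).
rewrite loc_mapE mE; apply/mkfrac_eq; exists 1; first exact: pset1.
by rewrite !scale1r scalerA mulrC.
Qed.

Lemma common_denominator M (s : seq M) :
  (forall x, x \in s -> exists2 u, ~ pset q u & u *: x = 0) ->
  exists2 u, ~ pset q u & forall x, x \in s -> u *: x = 0.
Proof.
elim: s => [|x s IH] h; first by exists 1 => //; apply: pset1.
have [|u nu us] := IH; first by move=> y ys; apply: h; rewrite in_cons ys orbT.
have [v nv vx] := h x (mem_head _ _).
exists (u * v); first exact: pset_mulN.
move=> y; rewrite in_cons => /orP[/eqP ->|ys]; first by rewrite -scalerA vx scaler0.
by rewrite mulrC -scalerA us // scaler0.
Qed.

(** An ideal of [S] is generated by the fractions with denominator 1 in it, and their numerators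
    form an ideal of [R]. *)
Lemma loc_noetherian : noetherian R -> noetherian S.
Proof.
move=> noe I [I0 ID IM].
have idJ : is_ideal (fun a : R => I (frac1 (a : R^o))).
  split=> [|a b Ia Ib|a b Ib].
  - by rewrite [frac1 _](mkfrac0 _ _).
  - have -> : frac1 (a + b : R^o) = frac1 (a : R^o) + frac1 (b : R^o) :> S.
      exact/esym/mkfracD.
    exact: ID.
  - have -> : frac1 (a * b : R^o) = (frac1 (a : R^o) : S) * frac1 (b : R^o) :> S.
      have := frac1_linear a (b : R^o) 0.
      by rewrite addr0 [X in _ = _ + X](mkfrac0 _ _) addr0.
    exact: IM.
have [k [g gE]] := noe _ idJ.
exists k, (fun i => frac1 (g i : R^o)); apply/seteqP; split=> x.
  elim/mkfrac_ind: x => a s hs Ix.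
  have [c cE] : [set a | exists c : 'I_k -> R, a = \sum_(i < k) c i * g i] a.
    rewrite -gE /=.
    have -> : frac1 (a : R^o) = (frac1 (s : R^o) : S) * mkfrac a hs.
      have h : ~ pset q (1 * s) by rewrite mul1r.
      rewrite [RHS](loc_scaleE _ _ _ _ h); apply/mkfrac_eq.
      by exists 1; rewrite ?mul1r ?scale1r //; apply: pset1.
    exact: IM.
  exists (fun i => (mkfrac (1 : R^o) hs : S) * frac1 (c i : R^o)).
  rewrite (frac_split a hs) cE.
  have -> : frac1 (\sum_i (c i * g i : R) : R^o) =
      \sum_i (frac1 (c i : R^o) : S) * (frac1 (g i : R^o) : S) :> S.
    elim/big_rec2: _ => [|i y1 y2 _ <-]; first exact: mkfrac0.
    exact: (frac1_linear (c i) (g i : R^o)).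
  rewrite -[LHS]/((mkfrac (1 : R^o) hs : S) * _) mulr_sumr.
  by apply: eq_bigr => i _; rewrite mulrA.
move=> [c ->]; elim/big_ind: _ => // i _.
apply: IM; have : [set a | exists c : 'I_k -> R, a = \sum_(i < k) c i * g i] (g i).
  exists (fun j => (i == j)%:R); rewrite (bigD1 i) //= eqxx mul1r.
  by rewrite big1 ?addr0 // => j; rewrite eq_sym => /negbTE ->; rewrite mul0r.
by rewrite -gE.
Qed.

(* A local ring of depth 0 has a nonzero socle, so that [q] is associated. *)
Lemma depth0_Ass : noetherian R -> ~ depth_ge S^o 1 -> Ass R q /\
  exists c : S, c <> 0 /\ forall s : S, ~ is_unit s -> c * s = 0.
Proof.
move=> noe d0.
have idn : is_ideal (fun s : S => ~ is_unit s).
  have [q0 qD qM] := pset_ideal q.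
  split=> [|a b|a b].
  - by rewrite -[0](mkfrac0 R^o (@pset1 R q)) nonunit_frac.
  - move: a b; apply: mkfrac_ind2 => a b s hs.
    by rewrite [X in _ -> _ -> ~ is_unit X]mkfracD !nonunit_frac; apply: qD.
  - elim/mkfrac_ind: a => a s hs; elim/mkfrac_ind: b => b t ht.
    rewrite [X in _ -> ~ is_unit X](loc_scaleE _ _ _ _ (pset_mulN hs ht)).
    by rewrite !nonunit_frac; apply: qM.
have [s ns|c [c0 cs]] := ideal_of_zero_divisors (loc_noetherian noe) idn.
  apply: contrapT => n; apply: d0; apply/depth_ge1P; exists s; split=> // m sm.
  by apply: contrapT => m0; apply: n; exists m.
split; last by exists c; split=> // s /cs; rewrite mulrC.
elim/mkfrac_ind: c c0 cs => b t ht c0 cs.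
have [k [g gE]] := noe _ (pset_ideal q).
have qg i : pset q (g i).
  rewrite gE; exists (fun j => (i == j)%:R); rewrite (bigD1 i) //= eqxx mul1r.
  by rewrite big1 ?addr0 // => j; rewrite eq_sym => /negbTE ->; rewrite mul0r.
(* One [u] outside [q] kills [g i * b] for all generators of [q] at once; the annihilator of [u * b]
   is then exactly [q]. *)
have [|u nu ug] := @common_denominator R^o [seq (g i : R) *: (b : R^o) | i <- enum 'I_k].
  move=> x /mapP[i _ ->].
  have /cs : ~ is_unit (frac1 (g i : R^o) : S) by apply/nonunit_frac.
  have h : ~ pset q (1 * t) by rewrite mul1r.
  by rewrite [X in X = 0 -> _](loc_scaleE _ _ _ _ h) => /mkfrac_eq0.
exists (u * b); apply/seteqP; split=> a /=.
  rewrite gE => -[c ->]; rewrite mulr_suml big1 // => i _.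
  have e : u * (g i * b) = 0 by apply: ug; apply: map_f; rewrite mem_enum.
  by rewrite -mulrA [g i * _]mulrCA e mulr0.
move=> e; apply: contrapT => na; apply: c0; apply/mkfrac_eq0.
by exists (a * u); [apply: pset_mulN | rewrite -[LHS]/((a * u) * (b : R)) -mulrA].
Qed.

End Localization.

(** * The equivalence for a presented module *)

Section LocalizedFree.
Variables (R : comPzRingType) (q : prime_ideal R).
Local Notation S := (loc_ring q).

(** The localized module of [R^o] and the regular module [S^o] have the same elements and action but
    different types; functionals must take values in the latter. *)
Fact loc_regular_linear : linear (fun x : loc q R^o => x : S^o).
Proof. by []. Qed.
Definition loc_regular : hom (loc q R^o) S^o := mkhom loc_regular_linear.

Fact loc_dual_subproof (M : lmodType R) (f : dual M) :
  {g : dual (loc q M) | g =1 comph loc_regular (loc_map q f)}.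
Proof. by exists (comph loc_regular (loc_map q f)). Qed.

Definition loc_dual (M : lmodType R) (f : dual M) : dual (loc q M) :=
  sval (loc_dual_subproof f).

Lemma loc_dualE (M : lmodType R) (f : dual M) m s (hs : ~ pset q s) :
  loc_dual f (mkfrac m hs) = mkfrac (f m) hs.
Proof.
by rewrite /loc_dual (svalP (loc_dual_subproof f)); apply: loc_mapE.
Qed.

Fact coord_linear n (i : 'I_n) : linear (fun x : 'rV[R]_n => x 0 i : R^o).
Proof. by move=> a x y; rewrite !mxE. Qed.
Definition coord n (i : 'I_n) : dual 'rV[R]_n := mkhom (coord_linear i).

(** This dual basis supplies reflexivity, finite generation and coordinates for the localized free
    module. *)
Lemma loc_dual_basis n :
  dual_basis (fun i : 'I_n => frac1 q (delta_mx 0 i : 'rV[R]_n))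
    (fun i => loc_dual (coord i)).
Proof.
elim/mkfrac_ind => x s hs.
have hs1 : ~ pset q (s * 1) by rewrite mulr1.
under eq_bigr => i _ do rewrite loc_dualE (scale_frac _ _ _ _ hs1).
have -> : mkfrac x hs = mkfrac x hs1.
  by apply/mkfrac_eq; exists 1; rewrite ?mulr1 //; apply: pset1.
rewrite {1}(row_sum_delta x).
elim/big_rec2: _ => [|i y1 y2 _ <-]; first exact: mkfrac0.
by rewrite mkfracD.
Qed.

Lemma loc_rV_reflexive n : reflexive_module (loc q 'rV[R]_n).
Proof. exact: dual_basis_reflexive (@loc_dual_basis n). Qed.

Lemma loc_rV_fin_gen n : fin_gen (loc q 'rV[R]_n).
Proof.
exists n, (fun i => frac1 q (delta_mx 0 i : 'rV[R]_n)) => x.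
by exists (fun i => loc_dual (coord i) x); apply: loc_dual_basis.
Qed.

End LocalizedFree.

(** * Finitely presented modules whose dual is a kernel of the transposed relations *)

Section Presentation.
Variables (R : comPzRingType) (M D : lmodType R).
Hypothesis noeR : noetherian R.
Variables (a b : nat) (aug : hom 'rV[R]_b M) (rho : 'I_a -> 'rV[R]_b).
Hypothesis aug_surj : surjective aug.
Hypothesis aug_exact : exact_at (lin_comb rho) aug.
(* [D] is the dual of [M], presented as the kernel of the transpose of [rho]. *)
Variables (j : hom D 'rV[R]_b) (tau : hom 'rV[R]_b 'rV[R]_a).
Hypothesis tauE : forall x k, tau x 0 k = \sum_i rho k 0 i * x 0 i.
Hypothesis j_inj : injective j.
Hypothesis j_exact : exact_at j tau.

Fact dot_linear n (v : 'rV[R]_n) :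
  linear (fun x : 'rV[R]_n => \sum_i v 0 i * x 0 i : R^o).
Proof.
move=> c x y; rewrite scaler_sumr -big_split; apply: eq_bigr => i _ /=.
by rewrite !mxE mulrDr mulrCA.
Qed.
Definition dot n (v : 'rV[R]_n) : dual 'rV[R]_n := mkhom (dot_linear v).

Lemma dotC n (v x : 'rV[R]_n) : dot v x = dot x v.
Proof. by apply: eq_bigr => i _; rewrite mulrC. Qed.

Lemma dot_delta n (v : 'rV[R]_n) i : dot v (delta_mx 0 i) = v 0 i.
Proof.
rewrite /= (bigD1 i) //= mxE !eqxx mulr1 big1 ?addr0 // => k ki.
by rewrite mxE (negbTE ki) andbF mulr0.
Qed.

(** The row [j y] is orthogonal to all relations, so pairing with it descends to a functional on
    [M], which vanishes at [aug v]. *)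
Lemma torsion_dot v y : (forall f : dual M, f (aug v) = 0) -> dot v (j y) = 0.
Proof.
move=> v0; have tj : tau (j y) = 0 by apply/j_exact; exists y.
have [|f fE] := hom_factor aug_surj (u := dot (j y)).
  move=> x /aug_exact[w <-]; rewrite lin_combE linear_sum big1 // => k _.
  rewrite homZ dotC -[dot _ _]tauE tj mxE; exact: scaler0.
by rewrite dotC -fE v0.
Qed.

(** A lift [v] of [x] is read as a functional [dot v] on the free module containing [D]. It vanishes
    on [D], so at [q] it factors through [tau]. *)
Lemma torsion_killed (q : prime_ideal R) m x : Gdim_le (loc q D) m ->
  ~ depth_ge (loc_ring q)^o 1 -> (forall f : dual M, f x = 0) ->
  exists2 u, ~ pset q u & u *: x = 0.
Proof.
move=> gD d0; have [v <-] := aug_surj x; move=> v0.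
have [_ [c [c0 cs]]] := depth0_Ass noeR d0.
have [|w wE] := Gdim_dual_exact (loc_noetherian noeR) c0 cs (v := loc_dual q (dot v))
  gD (loc_map_inj j_inj) (loc_map_exact j_exact) (@loc_rV_fin_gen _ _ b)
  (@loc_rV_reflexive _ _ b) (@loc_rV_reflexive _ _ a).
  elim/mkfrac_ind => y s hs; rewrite loc_mapE loc_dualE torsion_dot //.
  exact: mkfrac0.
apply/(mkfrac_eq0 _ (@pset1 R q)).
pose W k : loc_ring q := w (frac1 q (delta_mx 0 k : 'rV[R]_a)).
(* Since [tau] is the transpose of [rho], the factorization through [tau] says in coordinates that
   [v] is, at [q], a combination of the relations with coefficients [W k]. *)
suff e : frac1 q v = \sum_k W k *: frac1 q (rho k).
  rewrite -loc_mapE -/(frac1 q v) e linear_sum big1 // => k _.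
  rewrite homZ loc_mapE [X in _ *: X](_ : _ = 0) ?scaler0 //.
  apply/mkfrac_eq0; exists 1; first exact: pset1.
  rewrite scale1r; apply/aug_exact; exists (delta_mx 0 k).
  exact: lin_comb_delta.
rewrite [LHS](@loc_dual_basis _ q b) [RHS](@loc_dual_basis _ q b).
apply: eq_bigr => i _; congr (_ *: _).
rewrite linear_sum loc_dualE.
have -> : mkfrac (coord R i v) (@pset1 R q) =
    loc_dual q (dot v) (frac1 q (delta_mx 0 i)) :> loc_ring q.
  by rewrite loc_dualE dot_delta.
rewrite wE loc_mapE [X in w X](@loc_dual_basis _ q a) linear_sum.
apply: eq_bigr => k _; rewrite (homZ w) (homZ (loc_dual q (coord R i))).
rewrite [loc_dual q (coord R k) _]loc_dualE [loc_dual q (coord R i) _]loc_dualE.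
rewrite [RHS]mulrC (_ : coord R k _ = coord R i (rho k)) //.
by rewrite -[LHS]/(tau _ 0 k) tauE; apply: dot_delta.
Qed.

Lemma S1_tilde_torsionless : locally_finite_Gdim_on (Ass R) D -> S1_tilde M ->
  torsionless M.
Proof.
move=> gD /S1_tildeP S1 y y0; apply: contrapT => ny.
have K0 (f : dual M) : f 0 = 0 by exact: linear0.
have KP (c : R) (x z : M) : (forall f : dual M, f x = 0) ->
    (forall f : dual M, f z = 0) -> forall f : dual M, f (c *: x + z) = 0.
  by move=> x0 z0 f; rewrite linearP x0 z0 scaler0 addr0.
have [x [mx _]] := exists_max_ann noeR (K := Submodule K0 KP) y0 ny.
have [q qE] := max_ann_prime mx; have [x0 nx _] := mx.
have d0 : ~ depth_ge (loc_ring q)^o 1.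
  move=> /S1/depth_ge1P[s [ns rs]].
  (* The numerator of the non-unit [s] lies in [q], the annihilator of [x]. Regularity of [s] on the
     localization of [M] then gives a multiplier outside [q] that kills [x]. *)
  have /rs /mkfrac_eq0[u nu ux] : s *: frac1 q x = 0.
    elim/mkfrac_ind: s ns {rs} => c s hs /nonunit_frac /qE cx.
    have hs1 : ~ pset q (s * 1) by rewrite mulr1.
    by rewrite (scale_frac _ _ _ _ hs1) cx; apply: mkfrac0.
  exact/nu/qE.
have [qA _] := depth0_Ass noeR d0.
have [m gm] : exists m, Gdim_le (loc q D) m.
  (* Finiteness excludes the default value [+oo] of [Gdim], so a bounded resolution exists. *)
  have := gD q qA; rewrite /Gdim; case: xgetP => [z _ [m [gm _] _] _|_].
    by exists m.
  by rewrite ltxx.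
by have [u nu /qE] := torsion_killed gm d0 x0.
Qed.

(** A regular element of the local ring stays regular on the localization of [M]: if it kills m / t,
    the values of all functionals at [m] become zero at [q]. The dual being finitely generated, one
    denominator works for all of them. *)
Lemma torsionless_S1_tilde : torsionless M -> S1_tilde M.
Proof.
move=> tl; apply/S1_tildeP => q /depth_ge1P[s [ns rs]].
apply/depth_ge1P; exists s; split=> //; elim/mkfrac_ind => m t ht.
elim/mkfrac_ind: s ns rs => c s hs ns rs.
rewrite (scale_frac _ _ _ _ (pset_mulN hs ht)) => /mkfrac_eq0[u nu ucm].
have fM : fin_gen M by apply: fin_gen_surj aug_surj (@fin_gen_rV R b).
have [k [f fP]] := dual_fin_gen noeR fM.
have [|v nv vf] := @common_denominator R q R^o [seq f i m | i <- enum 'I_k].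
  move=> y /mapP[i _ ->].
  have := rs (frac1 q (f i m)).
  have hs1 : ~ pset q (s * 1) by rewrite mulr1.
  rewrite [X in X = _ -> _](loc_scaleE _ _ _ _ hs1) mkfrac_eq0 => h.
  have /h/mkfrac_eq0 // : exists2 u : R, ~ pset q u & u *: (c *: f i m) = 0.
  by exists u => //; rewrite -!(homZ (f i)) ucm linear0.
apply/mkfrac_eq0; exists v => //; apply: tl => g; rewrite (homZ g).
have [d ->] := fP g; rewrite -[X in _ *: X]/(@bidual R M m _) linear_sum.
rewrite scaler_sumr big1 // => i _; rewrite (homZ (@bidual R M m)) scalerA mulrC -scalerA.
have e : v *: (f i m : R^o) = 0.
  by apply: vf; apply/mapP; exists i; rewrite ?mem_enum.
by rewrite -[bidual m _]/(f i m) e scaler0.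
Qed.

Theorem torsionfree1_syzygy1_S1_tilde : locally_finite_Gdim_on (Ass R) D ->
  (torsionfree1 M <-> syzygy1 M) /\ (syzygy1 M <-> S1_tilde M).
Proof.
move=> gD; have fM : fin_gen M := fin_gen_surj aug_surj (@fin_gen_rV R b).
have tf_tl : torsionfree1 M <-> torsionless M.
  split; first exact: torsionfree1_torsionless.
  by apply: torsionless_torsionfree1 aug_surj aug_exact;
    [apply: projective_rV|apply: fin_gen_rV|apply: projective_rV|apply: fin_gen_rV].
have sy_tl : syzygy1 M <-> torsionless M.
  by split; [apply: syzygy1_torsionless|apply: fin_gen_torsionless_syzygy1].
have s1_tl : S1_tilde M <-> torsionless M.
  by split; [apply: S1_tilde_torsionless|apply: torsionless_S1_tilde].
by rewrite tf_tl sy_tl s1_tl.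
Qed.

End Presentation.

(** * Stalks of locally Noetherian schemes *)

Section StalkNoetherian.
Variables (A : comPzRingType) (X : ringedSpace) (j : rsMorphism (Spec A) X).
Hypothesis j_open : open_immersion j.
Hypothesis noeA : noetherian A.

Let j_inj : injective j. Proof. by case: j_open. Qed.

Let image_open (U : opens (Spec A)) : opens X :=
  Opens (let: And3 _ o _ := j_open in o U).

Let Rg : opens X := image_open (opensT (Spec A)).

Let sharp_bij (V : opens X) : V `<=` Rg -> bijective (@msharp _ _ j V).
Proof.
move=> h; case: j_open => _ _; apply.
by move=> y /h[q _ <-]; exists q.
Qed.

Lemma sharp_inj (V : opens X) (s t : sec V) : V `<=` Rg ->
  (forall q (hq : oset (preim (mcont j) V) q),
     spec_val (msharp j s) hq = spec_val (msharp j t) hq) -> s = t.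
Proof.
by move=> /sharp_bij /bij_inj inj e; apply: inj; apply: spec_sec_ext => q hq.
Qed.

Lemma sharp_surj (V : opens X) (f : spec_sec (preim (mcont j) V)) : V `<=` Rg ->
  exists s : sec V, msharp j s = f.
Proof. by move=> /sharp_bij[g _ gK]; exists (g f). Qed.

Lemma frac_sec (U : opens (Spec A)) (a b : A) :
  (forall q, oset U q -> ~ pset q b) -> exists s : spec_sec U,
  forall q (hq : oset U q), exists hb : ~ pset q b,
    spec_val s hq = mkfrac (a : A^o) hb.
Proof.
move=> nb; pose f : prime_family U := fun q hq => mkfrac (a : A^o) (nb q hq).
have fP : f \in @spec_pred A U.
  apply/asboolP => q hq; exists U, (@subset_refl _ _), a, b; split=> // r hr.
  by exists (nb r hr); apply: mkfrac_irr.
by exists (SpecSec fP) => q hq; exists (nb q hq).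
Qed.

Lemma sharp_restr (V W : opens X) (h : W `<=` V) (s : sec V) q
  (hq : oset (preim (mcont j) W) q) (hq' : oset (preim (mcont j) V) q) :
  spec_val (msharp j (restr h s)) hq = spec_val (msharp j s) hq'.
Proof.
have k : preim (mcont j) W `<=` preim (mcont j) V by move=> r /h.
rewrite -(msharp_nat h k) /= /prime_family_res.
by congr (spec_val _ _); apply: Prop_irrelevance.
Qed.

(** The germ [th a] of the section a / 1 defines a map from [A] to the stalk; every element of the
    stalk becomes some [th a] after multiplication by an invertible [th b]. Hence every ideal of the
    stalk is generated by images of elements of [A]. *)
Lemma stalk_noetherian x : range j x -> noetherian (stalk x).
Proof.
move=> [p _ jp].
have hx : oset Rg x by exists p.
have const a : exists s : sec Rg, forall q (hq : oset (preim (mcont j) Rg) q),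
    spec_val (msharp j s) hq = frac1 q (a : A^o).
  have [q _|f fE] := @frac_sec (preim (mcont j) Rg) a 1; first exact: pset1.
  have [s sE] := sharp_surj f (@subset_refl _ _).
  by exists s => q hq; rewrite sE; have [hb ->] := fE q hq; apply: mkfrac_irr.
have [t tE] := choice const.
have tD a b : t (a + b) = t a + t b.
  apply: sharp_inj (@subset_refl _ _) _ => q hq; rewrite tE rmorphD.
  by rewrite -[RHS]/(spec_val _ hq + spec_val _ hq) !tE; apply/esym/mkfracD.
have fracM q (a b : A) : frac1 q (a * b : A^o) =
    (frac1 q (a : A^o) : loc_ring q) * frac1 q (b : A^o) :> loc_ring q.
  have h : ~ pset q (1 * 1) by rewrite mulr1; apply: pset1.
  rewrite [RHS](loc_scaleE _ _ _ _ h); apply/mkfrac_eq; exists 1; first exact: pset1.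
  by rewrite mulr1.
have tM a b : t (a * b) = t a * t b.
  apply: sharp_inj (@subset_refl _ _) _ => q hq; rewrite tE rmorphM.
  by rewrite -[RHS]/(spec_val _ hq * spec_val _ hq) !tE.
pose th a : stalk x := rgerm hx (t a).
have thD a b : th (a + b) = th a + th b by rewrite /th tD rgermD.
have thM a b : th (a * b) = th a * th b by rewrite /th tM rgermM.
have th0 : th 0 = 0 by apply: (addIr (th 0)); rewrite -thD !add0r.
(* Near [p] the section is a fraction a / b with [b] outside every prime of [V'], so that 1 / b is a
   section there and its germ inverts [th b]. *)
have frac z : exists a b y, th b * y = 1 /\ z * th b = th a.
  elim/rgerm_ind: z => U hU s.
  pose V1 := opensI U Rg.
  have pV1 : oset (preim (mcont j) V1) p by rewrite /= jp; split.
  have /asboolP/(_ p pV1)[V' [hV' [a [b [Vp ab]]]]] :=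
    spec_valP (msharp j (restr (@opensIl _ U Rg) s : sec V1)).
  pose W := image_open V'.
  have WV1 : W `<=` V1 by move=> _ [q /hV' h <-].
  have WU : W `<=` U := subset_trans WV1 (@opensIl _ _ _).
  have WR : W `<=` Rg := subset_trans WV1 (@opensIr _ _ _).
  have Wx : oset W x by exists p.
  have WV' q : oset (preim (mcont j) W) q -> oset V' q.
    by move=> [r Vr /j_inj <-].
  have [q /WV' /ab[] //|e eE] := @frac_sec (preim (mcont j) W) 1 b.
  have [y yE] := sharp_surj e WR.
  exists a, b, (rgerm Wx y); split.
    rewrite /th -(rgerm_res WR hx Wx) -rgermM.
    rewrite [_ * y](_ : _ = 1) ?rgerm_one //; apply: (sharp_inj WR) => q hq.
    rewrite rmorphM rmorph1 -[LHS]/(spec_val _ hq * spec_val _ hq).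
    rewrite (sharp_restr WR _ hq (WR _ hq)) tE yE; have [hb ->] := eE q hq.
    have h : ~ pset q (1 * b) by rewrite mul1r.
    rewrite [LHS](loc_scaleE _ _ _ _ h); apply/mkfrac_eq; exists 1; first exact: pset1.
    by rewrite !scale1r mul1r.
  rewrite /th -(rgerm_res WU hU Wx) -!(rgerm_res WR hx Wx) -rgermM; congr (rgerm Wx _).
  apply: (sharp_inj WR) => q hq; rewrite rmorphM -[LHS]/(spec_val _ hq * spec_val _ hq).
  rewrite !(sharp_restr WR _ hq (WR _ hq)) !tE.
  have -> : spec_val (msharp j (restr WU s)) hq =
      spec_val (msharp j (restr (@opensIl _ U Rg) s : sec V1)) (hV' q (WV' q hq)).
    rewrite -(sharp_restr WV1 _ hq); congr (spec_val (msharp j _) hq).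
    by rewrite (restr_comp _ _ WU).
  have [hb ->] := ab q (WV' q hq).
  have h : ~ pset q (b * 1) by rewrite mulr1.
  rewrite [LHS](loc_scaleE _ _ _ _ h); apply/mkfrac_eq; exists 1; first exact: pset1.
  by rewrite !scale1r mulr1 [RHS]mulrC.
move=> I [I0 ID IM].
have idJ : is_ideal (fun a => I (th a)).
  by split=> [|a b|a b]; rewrite ?th0 ?thD ?thM //; [apply: ID|apply: IM].
have [k [g gE]] := noeA idJ.
exists k, (th \o g); apply/seteqP; split=> z; last first.
  move=> [c ->]; elim/big_ind: _ => // i _; apply: IM.
  have : [set a | exists c : 'I_k -> A, a = \sum_(i < k) c i * g i] (g i).
    exists (fun l => (i == l)%:R); rewrite (bigD1 i) //= eqxx mul1r.
    by rewrite big1 ?addr0 // => l; rewrite eq_sym => /negbTE ->; rewrite mul0r.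
  by rewrite -gE.
move=> Iz; have [a [b [y [by1 zb]]]] := frac z.
have [c cE] : [set a | exists c : 'I_k -> A, a = \sum_(i < k) c i * g i] a.
  by rewrite -gE /= -zb mulrC; apply: IM.
exists (fun i => y * th (c i)).
have -> : z = y * th a by rewrite -zb mulrCA [y * _]mulrC by1 mulr1.
rewrite cE; under [RHS]eq_bigr do rewrite -mulrA -thM.
by rewrite -mulr_sumr; congr (_ * _); elim/big_rec2: _ => // i y1 y2 _ <-; rewrite thD.
Qed.

End StalkNoetherian.

Lemma scheme_stalk_noetherian (X : scheme) (x : X) : locally_noetherian X ->
  noetherian (stalk x).
Proof.
by move=> /(_ x)[A [j [noeA oj jx]]]; apply: (stalk_noetherian oj).
Qed.

(** * Stalks of coherent modules *)

Section RingedSpace.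
Variable X : ringedSpace.

(** Both [s] and [t] glue the local restrictions of [s], and gluing is unique. *)
Lemma sec_separated (V : opens X) (s t : sec V) :
  (forall y, oset V y -> exists (W : opens X) (h : W `<=` V),
    oset W y /\ restr h s = restr h t) -> s = t.
Proof.
move=> loc_eq; pose I := {y | oset V y}.
have [W hW] := choice (fun y : I => loc_eq (sval y) (svalP y)).
pose h i := sval (cid (hW i)).
have hP i : oset (W i) (sval i) /\ restr (h i) s = restr (h i) t.
  exact: svalP (cid (hW i)).
have cov : V `<=` \bigcup_i W i.
  by move=> y hy; exists (exist _ y hy) => //; have [] := hP (exist _ y hy).
have [|u [_ uniq]] := @sec_glue X V I W h cov (fun i => restr (h i) s).
  by move=> i k Z hi hk; rewrite !(restr_comp _ _ (subset_trans hi (h i))).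
rewrite -(uniq s) // -(uniq t) // => i; exact/esym/(hP i).2.
Qed.

Section Module.
Variable F : presheafMod X.

Lemma mres_sum (U V : opens X) (h : V `<=` U) k (c : 'I_k -> sec U)
  (m : 'I_k -> msec F U) :
  mres F h (\sum_i c i *: m i) = \sum_i restr h (c i) *: mres F h (m i).
Proof.
elim/big_rec2: _ => [|i y1 y2 _ <-]; first exact: mres0.
by rewrite mresD mresZ.
Qed.

Lemma germ_sum x (U : opens X) (hU : oset U x) k (c : 'I_k -> sec U)
  (m : 'I_k -> msec F U) :
  germ hU (\sum_i c i *: m i) = \sum_i rgerm hU (c i) *: germ hU (m i).
Proof.
elim/big_rec2: _ => [|i y1 y2 _ <-]; first exact: germ0.
by rewrite germZ germD.
Qed.

Lemma germ_eq0 x (U : opens X) (hU : oset U x) (m : msec F U) : germ hU m = 0 ->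
  exists (W : opens X) (h : W `<=` U), oset W x /\ mres F h m = 0.
Proof.
rewrite -[0](germ0 F hU) => /germ_eq[W [h [h' [Wx e]]]].
by exists W, h; rewrite e mres0.
Qed.

Lemma common_open x (U : opens X) k (P : 'I_k -> opens X -> Prop) : oset U x ->
  (forall i (W V : opens X), V `<=` W -> P i W -> P i V) ->
  (forall i, exists W, oset W x /\ P i W) ->
  exists W : opens X, [/\ W `<=` U, oset W x & forall i, P i W].
Proof.
move=> Ux mono ex.
suff [W [WU Wx PW]] : exists W : opens X,
    [/\ W `<=` U, oset W x & forall i, i \in enum 'I_k -> P i W].
  by exists W; split=> // i; apply: PW; rewrite mem_enum.
elim: (enum _) => [|i s [W [WU Wx PW]]]; first by exists U; split.
have [V [Vx PV]] := ex i.
exists (opensI W V); split=> // [y [/WU]|l] //; rewrite in_cons => /orP[/eqP ->|/PW].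
  by apply: mono PV; apply: opensIr.
by apply: mono; apply: opensIl.
Qed.

End Module.

Lemma common_sections x (U : opens X) k (v : 'I_k -> stalk x) : oset U x ->
  exists (W : opens X) (Wx : oset W x) (a : 'I_k -> sec W),
    W `<=` U /\ forall i, v i = rgerm Wx (a i).
Proof.
move=> Ux.
have [||W [WU Wx h]] := @common_open x U k
    (fun i W => forall Wx : oset W x, exists a : sec W, v i = rgerm Wx a) Ux.
- move=> i W V VW h Vx; have [a ->] := h (VW _ Vx).
  by exists (restr VW a); rewrite (rgerm_res VW (VW _ Vx)).
- move=> i; elim/rgerm_ind: (v i) => V Vx a; exists V; split=> // Vx'.
  by exists a; rewrite (Prop_irrelevance Vx Vx').
have [a aE] := choice (fun i => h i Wx).
by exists W, Wx, a.
Qed.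

Lemma common_vanishing x (U : opens X) (Ux : oset U x) k (b : 'I_k -> sec U) :
  (forall i, rgerm Ux (b i) = 0) ->
  exists (W : opens X) (h : W `<=` U), oset W x /\ forall i, restr h (b i) = 0.
Proof.
move=> b0.
have [||W [WU Wx h]] := @common_open x U k
    (fun i W => exists h : W `<=` U, restr h (b i) = 0) Ux.
- move=> i W V VW [h e]; exists (subset_trans VW h).
  by rewrite -(restr_comp h VW) e rmorph0.
- move=> i; have /germ_eq0[W [h [Wx e]]] := b0 i.
  by exists W; split=> //; exists h.
exists W, WU; split=> // i; have [h' <-] := h i.
by rewrite (Prop_irrelevance WU h').
Qed.

End RingedSpace.

(** * From a local presentation of a module to its stalk and the stalk of its dual *)

Section LocalPresentation.
Variables (X : ringedSpace) (F : presheafMod X) (x : X).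
Variables (U : opens X) (k : nat) (g : 'I_k -> msec F U).
Hypothesis Ux : oset U x.
Hypothesis gen : forall (V : opens X) (hV : V `<=` U) (s : msec F V) (y : X),
  oset V y -> exists (W : opens X) (hW : W `<=` V) (hWU : W `<=` U)
    (c : 'I_k -> sec W), oset W y /\
    mres F hW s = \sum_(i < k) c i *: mres F hWU (g i).
Variables (V0 : opens X) (hV0 : V0 `<=` U) (a : nat).
Variable r : 'I_a -> 'I_k -> sec V0.
Hypothesis V0x : oset V0 x.
Hypothesis rel0 : forall l, \sum_(i < k) r l i *: mres F hV0 (g i) = 0.
Hypothesis rel_gen :
  forall (W : opens X) (hW : W `<=` V0) (hWU : W `<=` U) (c : 'I_k -> sec W),
  \sum_(i < k) c i *: mres F hWU (g i) = 0 -> forall y, oset W y ->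
  exists (T : opens X) (hT : T `<=` W) (hTV : T `<=` V0) (e : 'I_a -> sec T),
    oset T y /\ forall i, restr hT (c i) = \sum_(l < a) e l * restr hTV (r l i).

Local Notation R := (stalk x).
Local Notation M := (stalk_mod x F).
Local Notation O := (structureMod X).
Local Notation D := (stalk_mod x (sheafHom F O)).

Definition stalk_gen : hom 'rV[R]_k M := lin_comb (fun i => germ Ux (g i) : M).
Definition stalk_rel (l : 'I_a) : 'rV[R]_k := \row_i rgerm V0x (r l i).

Lemma stalk_gen_germ (W : opens X) (Wx : oset W x) (hWU : W `<=` U)
  (c : 'I_k -> sec W) (v : 'rV[R]_k) : (forall i, v 0 i = rgerm Wx (c i)) ->
  stalk_gen v = germ Wx (\sum_i c i *: mres F hWU (g i)).
Proof.
move=> vE; rewrite germ_sum; apply: eq_bigr => i _.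
by rewrite vE (germ_res hWU Ux Wx).
Qed.

Lemma stalk_gen_surj : surjective stalk_gen.
Proof.
elim/germ_ind => V Vx s; have Wx : oset (opensI V U) x by [].
have [T [hT [hTU [c [Tx cE]]]]] := gen (@opensIr _ V U)
  (mres F (@opensIl _ V U) s) Wx.
exists (\row_i rgerm Tx (c i)).
rewrite (@stalk_gen_germ _ Tx hTU c) => [|i]; last by rewrite mxE.
by rewrite -cE (germ_res _ Wx Tx) (germ_res _ Vx Wx).
Qed.

(** The finitely many coefficients of a relation between germs live on one neighbourhood, and the
    relation itself holds on a smaller one, where [rel_gen] applies. *)
Lemma stalk_gen_exact : exact_at (lin_comb stalk_rel) stalk_gen.
Proof.
move=> v; split=> [v0|[w <-]]; last first.
  rewrite lin_combE linear_sum big1 // => l _; rewrite (homZ stalk_gen).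
  rewrite (@stalk_gen_germ _ V0x hV0 (r l)) => [|i]; last by rewrite mxE.
  by rewrite rel0 germ0; apply: scaler0.
have [W [Wx [c [WV cE]]]] := common_sections (fun i => v 0 i) V0x.
have WU := subset_trans WV hV0.
have /germ_eq0[W' [h [W'x e]]] :
    germ Wx (\sum_i c i *: mres F WU (g i)) = 0.
  by rewrite -(@stalk_gen_germ _ Wx WU c v).
have W'U := subset_trans h WU.
have [|T [hT [hTV [d [Tx dE]]]]] :=
    @rel_gen W' (subset_trans h WV) W'U (fun i => restr h (c i)) _ x W'x.
  rewrite -[RHS]e mres_sum; apply: eq_bigr => i _.
  by rewrite (mres_comp _ _ W'U).
exists (\row_l rgerm Tx (d l)); apply/rowP => i.
rewrite lin_combE summxE cE -(rgerm_res h Wx W'x) -(rgerm_res hT W'x Tx) dE.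
rewrite (big_morph (rgerm Tx) (@rgermD _ _ _ Tx) (germ0 O Tx)).
apply: eq_bigr => l _; rewrite !mxE rgermM; congr (_ * _).
exact/esym/rgerm_res.
Qed.

Lemma shom_map_irr (Z : opens X) (d : shom F O Z) (V : opens X) (h h' : V `<=` Z) s :
  shom_map d h s = shom_map d h' s.
Proof. by congr (shom_map d _ s); apply: Prop_irrelevance. Qed.

Lemma shom_map0 (Z : opens X) (d : shom F O Z) (V : opens X) (h : V `<=` Z) :
  shom_map d h 0 = 0.
Proof.
have := shom_linear d h 1 0 0; rewrite !scale1r addr0 => /eqP.
by rewrite -subr_eq0 opprD addNKr oppr_eq0 => /eqP.
Qed.

Lemma shom_map_sum (Z : opens X) (d : shom F O Z) (V : opens X) (h : V `<=` Z) n
  (c : 'I_n -> sec V) (m : 'I_n -> msec F V) :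
  shom_map d h (\sum_i c i *: m i) = \sum_i c i *: shom_map d h (m i).
Proof.
elim/big_rec2: _ => [|i y1 y2 _ <-]; first exact: shom_map0.
exact: shom_linear.
Qed.

(* [y] is the family of germs of the values at [g] of a homomorphism with germ [z]. *)
Definition eval_rel (z : D) (y : 'rV[R]_k) : Prop :=
  exists (W : opens X) (hWU : W `<=` U) (Wx : oset W x) (d : shom F O W),
    z = germ (F := sheafHom F O) Wx d /\
    forall i, y 0 i = rgerm Wx (shom_map d (@subset_refl _ _) (mres F hWU (g i))).

Lemma eval_rel_res (W W' : opens X) (h : W' `<=` W) (hWU : W `<=` U)
  (hWU' : W' `<=` U) (d : shom F O W) i :
  shom_map (shom_restr h d) (@subset_refl _ _) (mres F hWU' (g i)) =
  restr h (shom_map d (@subset_refl _ _) (mres F hWU (g i))).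
Proof.
rewrite /= -[RHS](shom_res d h (@subset_refl _ _) h) (mres_comp _ _ hWU').
exact: shom_map_irr.
Qed.

Lemma eval_rel_shrink (W W' : opens X) (h : W' `<=` W) (hWU : W `<=` U)
  (Wx : oset W x) (W'x : oset W' x) (d : shom F O W) (y : 'rV[R]_k) :
  (forall i, y 0 i = rgerm Wx (shom_map d (@subset_refl _ _) (mres F hWU (g i)))) ->
  forall (hWU' : W' `<=` U) i, y 0 i =
    rgerm W'x (shom_map (shom_restr h d) (@subset_refl _ _) (mres F hWU' (g i))).
Proof.
by move=> yE hWU' i; rewrite (eval_rel_res h hWU) (rgerm_res h Wx W'x).
Qed.

Lemma eval_rel_total z : exists y, eval_rel z y.
Proof.
elim/germ_ind: z => V Vx d; have Wx : oset (opensI V U) x by [].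
pose d' := shom_restr (@opensIl _ V U) d.
exists (\row_i rgerm Wx (shom_map d' (@subset_refl _ _) (mres F (@opensIr _ V U) (g i)))).
exists (opensI V U), (@opensIr _ V U), Wx, d'; split; last by move=> i; rewrite mxE.
by rewrite -(@germ_res _ _ (sheafHom F O) _ _ (@opensIl _ V U) Vx Wx).
Qed.

Lemma eval_rel_linear c z y z' y' : eval_rel z y -> eval_rel z' y' ->
  eval_rel (c *: z + z') (c *: y + y').
Proof.
move=> [W [hW [Wx [d [-> yE]]]]] [W' [hW' [W'x [d' [-> yE']]]]].
elim/rgerm_ind: c => V Vx c.
pose T := opensI (opensI W W') V.
have TW : T `<=` W by move=> t [[]].
have TW' : T `<=` W' by move=> t [[]].
have TV : T `<=` V by move=> t [].
have Tx : oset T x by [].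
have TU := subset_trans TW hW.
exists T, TU, Tx, (restr TV c *: shom_restr TW d + shom_restr TW' d').
split.
  rewrite -(rgerm_res TV Vx Tx) -(@germ_res _ _ (sheafHom F O) _ _ TW Wx Tx).
  by rewrite -(@germ_res _ _ (sheafHom F O) _ _ TW' W'x Tx) germZ germD.
move=> i; rewrite !mxE (eval_rel_shrink TW Tx yE TU) (eval_rel_shrink TW' Tx yE' TU).
rewrite -(rgerm_res TV Vx Tx) -rgermM -rgermD; congr (rgerm Tx _).
rewrite [in RHS]/shom_map /=; congr (_ * _ + _).
by rewrite restr_id.
Qed.

(** Sections are combinations of the generators only locally, so vanishing is concluded from the
    separatedness of the structure sheaf. *)
Lemma shom_eq0 (W : opens X) (hWU : W `<=` U) (d : shom F O W) :
  (forall i, shom_map d (@subset_refl _ _) (mres F hWU (g i)) = 0) -> d = 0.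
Proof.
move=> d0; apply: shom_ext => V hV s.
rewrite [RHS](_ : _ = 0) //; apply: sec_separated => y Vy.
have [T [hT [hTU [c [Ty cE]]]]] := gen (subset_trans hV hWU) s Vy.
exists T, hT; split=> //; rewrite rmorph0.
have hTW := subset_trans hT hV.
rewrite -[LHS](shom_res d hT hV hTW) cE shom_map_sum big1 // => i _.
have -> : mres F hTU (g i) = mres F hTW (mres F hWU (g i)).
  by rewrite (mres_comp _ _ hTU).
by rewrite (shom_res d hTW (@subset_refl _ _)) d0 mres0 scaler0.
Qed.

Lemma eval_rel_inj z y : eval_rel z y -> y = 0 -> z = 0.
Proof.
move=> [W [hWU [Wx [d [-> yE]]]]] y0.
have [|W' [h [W'x b0]]] := @common_vanishing X x W Wx k
    (fun i => shom_map d (@subset_refl _ _) (mres F hWU (g i))).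
  by move=> i; rewrite -yE y0 mxE.
have W'U := subset_trans h hWU.
rewrite -(@germ_res _ _ (sheafHom F O) _ _ h Wx W'x).
rewrite [mres _ _ _](_ : _ = 0) ?germ0 //; apply: (@shom_eq0 _ W'U) => i.
exact: etrans (eval_rel_res h hWU W'U d i) (b0 i).
Qed.

(** * Homomorphisms prescribed on local generators *)

Section Extension.
Variables (W : opens X) (WV0 : W `<=` V0) (b : 'I_k -> sec W).
Hypothesis b_rel : forall l, \sum_i restr WV0 (r l i) * b i = 0.

Definition represents (V : opens X) (hVU : V `<=` U) (hVW : V `<=` W)
  (c : 'I_k -> sec V) (s : msec F V) (t : sec V) : Prop :=
  s = \sum_i c i *: mres F hVU (g i) /\ t = \sum_i c i * restr hVW (b i).

Lemma represents_res (V V' : opens X) (h : V' `<=` V) hVU hVW hVU' hVW' c s t :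
  @represents V hVU hVW c s t ->
  @represents V' hVU' hVW' (fun i => restr h (c i)) (mres F h s) (restr h t).
Proof.
move=> [-> ->]; split.
  by rewrite mres_sum; apply: eq_bigr => i _; rewrite (mres_comp _ _ hVU').
rewrite rmorph_sum; apply: eq_bigr => i _.
by rewrite rmorphM (restr_comp _ _ hVW').
Qed.

(** Two expressions of [s] differ by a relation between the generators, locally a combination of the
    [r l], and these are satisfied by [b]. *)
Lemma represents_uniq (V : opens X) hVU hVW hVU' hVW' c c' s t t' :
  @represents V hVU hVW c s t -> @represents V hVU' hVW' c' s t' -> t = t'.
Proof.
rewrite (Prop_irrelevance hVU' hVU) (Prop_irrelevance hVW' hVW).
move=> [-> ->] [e ->]; apply/eqP; rewrite -subr_eq0; apply/eqP.
have hVV0 := subset_trans hVW WV0.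
have e0 : \sum_i (c i - c' i) *: mres F hVU (g i) = 0.
  under eq_bigr do rewrite scalerBl.
  by rewrite sumrB -e subrr.
have -> : \sum_i c i * restr hVW (b i) - \sum_i c' i * restr hVW (b i) =
    \sum_i (c i - c' i) * restr hVW (b i).
  by rewrite -sumrB; apply: eq_bigr => i _; rewrite mulrBl.
apply: sec_separated => y Vy.
have [T [hT [hTV [d [Ty dE]]]]] := rel_gen hVV0 e0 Vy.
exists T, hT; split=> //; rewrite rmorph0 rmorph_sum.
have hTW := subset_trans hT hVW.
under eq_bigr => i _ do rewrite rmorphM dE (restr_comp _ _ hTW) mulr_suml.
rewrite exchange_big big1 //= => l _.
under eq_bigr do rewrite -mulrA.
rewrite -mulr_sumr [X in _ * X](_ : _ = 0) ?mulr0 //.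
rewrite -[RHS](rmorph0 (restr hTW)) -(b_rel l) rmorph_sum.
by apply: eq_bigr => i _; rewrite rmorphM (restr_comp _ _ hTV).
Qed.

(** The value at [s] of the homomorphism sending each [g i] to [b i], as a relation: [s] need not be
    a combination of the generators on all of [V]. *)
Definition locally_represents (V : opens X) (s : msec F V) (t : sec V) : Prop :=
  forall y, oset V y -> exists (T : opens X) (h : T `<=` V) (hTU : T `<=` U)
    (hTW : T `<=` W) (c : 'I_k -> sec T),
    oset T y /\ represents hTU hTW c (mres F h s) (restr h t).

Lemma locally_represents_uniq (V : opens X) (s : msec F V) t t' :
  locally_represents s t -> locally_represents s t' -> t = t'.
Proof.
move=> rt rt'; apply: sec_separated => y Vy.
have [T [h [hU [hW [c [Ty e]]]]]] := rt y Vy.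
have [T' [h' [hU' [hW' [c' [T'y e']]]]]] := rt' y Vy.
pose Z := opensI T T'.
have ZT : Z `<=` T := @opensIl _ _ _; have ZT' : Z `<=` T' := @opensIr _ _ _.
have ZV := subset_trans ZT h.
exists Z, ZV; split=> //.
have ZU := subset_trans ZT hU; have ZW := subset_trans ZT hW.
have := represents_uniq (represents_res ZT ZU ZW e).
move=> /(_ ZU ZW (fun i => restr ZT' (c' i)) (restr ZT' (restr h' t'))).
rewrite !(restr_comp _ _ ZV); apply.
have := represents_res ZT' ZU ZW e'.
by rewrite !(mres_comp _ _ ZV) !(restr_comp _ _ ZV).
Qed.

(** The local values agree on overlaps by [represents_uniq] and are glued in the structure sheaf;
    [F] itself may be a mere presheaf. *)
Lemma locally_represents_ex (V : opens X) (hVW : V `<=` W) (s : msec F V) :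
  exists t, locally_represents s t.
Proof.
have hVU := subset_trans hVW (subset_trans WV0 hV0).
pose I := {y | oset V y}.
have [T tP] := choice (fun y : I => gen hVU s (svalP y)).
pose hT y := sval (cid (tP y)).
have hTP1 y := svalP (cid (tP y)); pose hTU y := sval (cid (hTP1 y)).
have hTP2 y := svalP (cid (hTP1 y)); pose c y := sval (cid (hTP2 y)).
have hTP y : oset (T y) (sval y) /\
    mres F (hT y) s = \sum_i c y i *: mres F (hTU y) (g i).
  exact: svalP (cid (hTP2 y)).
have hTW y : T y `<=` W := subset_trans (hT y) hVW.
pose t y := \sum_i c y i * restr (hTW y) (b i).
have rep y : represents (hTU y) (hTW y) (c y) (mres F (hT y) s) (t y).
  by split=> //; case: (hTP y).
have cov : V `<=` \bigcup_i T i.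
  by move=> y hy; exists (exist _ y hy) => //; have [] := hTP (exist _ y hy).
have [|u [uE _]] := @sec_glue X V I T hT cov t.
  move=> y z Z hy hz.
  have ZU := subset_trans hy (hTU y); have ZW := subset_trans hy (hTW y).
  have := represents_uniq (represents_res hy ZU ZW (rep y)).
  move=> /(_ ZU ZW (fun i => restr hz (c z i))); apply.
  have := represents_res hz ZU ZW (rep z).
  by rewrite !(mres_comp _ _ (subset_trans hy (hT y))).
exists u => y hy; pose y' : I := exist _ y hy.
exists (T y'), (hT y'), (hTU y'), (hTW y'), (c y'); split; first by case: (hTP y').
by rewrite uE; apply: rep.
Qed.

Lemma locally_represents_res (V V' : opens X) (h : V' `<=` V) s t :
  locally_represents s t -> locally_represents (mres F h s) (restr h t).
Proof.
move=> rt y Vy; have [T [hT [hU [hW [c [Ty e]]]]]] := rt y (h y Vy).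
pose Z := opensI T V'.
have ZT : Z `<=` T := @opensIl _ _ _; have ZV' : Z `<=` V' := @opensIr _ _ _.
have ZU := subset_trans ZT hU; have ZW := subset_trans ZT hW.
exists Z, ZV', ZU, ZW, (fun i => restr ZT (c i)); split=> //.
have := represents_res ZT ZU ZW e.
by rewrite !(mres_comp _ _ (subset_trans ZV' h)) !(restr_comp _ _ (subset_trans ZV' h)).
Qed.

Lemma locally_representsP (V : opens X) (d : sec V) s t s' t' :
  locally_represents s t -> locally_represents s' t' ->
  locally_represents (d *: s + s') (d * t + t').
Proof.
move=> rt rt' y Vy; have [T [h [hU [hW [c [Ty e]]]]]] := rt y Vy.
have [T' [h' [hU' [hW' [c' [T'y e']]]]]] := rt' y Vy.
pose Z := opensI T T'.
have ZT : Z `<=` T := @opensIl _ _ _; have ZT' : Z `<=` T' := @opensIr _ _ _.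
have ZV := subset_trans ZT h.
have ZU := subset_trans ZT hU; have ZW := subset_trans ZT hW.
have := represents_res ZT' ZU ZW e'.
have := represents_res ZT ZU ZW e.
rewrite !(mres_comp _ _ ZV) !(restr_comp _ _ ZV) => -[es et] [es' et'].
exists Z, ZV, ZU, ZW, (fun i => restr ZV d * restr ZT (c i) + restr ZT' (c' i)).
split=> //; split.
  rewrite mresD mresZ es es' scaler_sumr -big_split; apply: eq_bigr => i _ /=.
  by rewrite scalerDl scalerA.
rewrite rmorphD rmorphM et et' mulr_sumr -big_split; apply: eq_bigr => i _ /=.
by rewrite mulrDl mulrA.
Qed.

Lemma locally_represents_gen (WU : W `<=` U) i :
  locally_represents (mres F WU (g i)) (b i).
Proof.
move=> y Wy; exists W, (@subset_refl _ _), WU, (@subset_refl _ _), (fun l => (i == l)%:R).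
split=> //; rewrite mres_id restr_id; split.
  rewrite (bigD1 i) //= eqxx scale1r big1 ?addr0 // => l.
  by rewrite eq_sym => /negbTE ->; rewrite scale0r.
rewrite (bigD1 i) //= eqxx mul1r restr_id big1 ?addr0 // => l.
by rewrite eq_sym => /negbTE ->; rewrite mul0r.
Qed.

Lemma shom_extension (WU : W `<=` U) : exists d : shom F O W,
  forall i, shom_map d (@subset_refl _ _) (mres F WU (g i)) = b i.
Proof.
pose f (V : opens X) (h : V `<=` W) (s : msec F V) : msec O V :=
  sval (cid (locally_represents_ex h s)).
have fP V h s : locally_represents s (@f V h s).
  exact: svalP (cid (locally_represents_ex h s)).
have lin (V : opens X) (h : V `<=` W) c s t :
    @f V h (c *: s + t) = c *: @f V h s + @f V h t.
  apply: locally_represents_uniq (fP _ _ _) _.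
  exact: locally_representsP.
have res (V V' : opens X) (h : V' `<=` V) hV hV' s :
    @f V' hV' (mres F h s) = mres O h (@f V hV s).
  apply: locally_represents_uniq (fP _ _ _) _.
  exact: locally_represents_res.
exists (Shom lin res) => i; apply: locally_represents_uniq (fP _ _ _) _.
exact: locally_represents_gen.
Qed.

End Extension.

(** Here [j] takes the germs of the values at the generators. A vector orthogonal to the relations
    has representatives still orthogonal to them on a neighbourhood, where [shom_extension] turns
    them into a homomorphism. *)
Lemma stalk_dual_exact : exists (j : hom D 'rV[R]_k) (tau : hom 'rV[R]_k 'rV[R]_a),
  [/\ injective j, exact_at j tau &
    forall y l, tau y 0 l = \sum_i stalk_rel l 0 i * y 0 i].
Proof.
have [|c z y z' y'|y [W [hWU [Wx [d [e yE]]]]]|j jP] := @graph_hom _ D 'rV[R]_k eval_rel.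
- exact: eval_rel_total.
- exact: eval_rel_linear.
- have /esym/germ_eq0[W' [h [W'x d0]]] := e.
  apply/rowP => i; rewrite mxE.
  rewrite (eval_rel_shrink h W'x yE (subset_trans h hWU)).
  have d0' : shom_restr h d = 0 by exact: d0.
  by rewrite d0'; apply: (germ0 O).
have [tau tauE] := row_hom (fun l => dot (stalk_rel l)).
have jE z : eval_rel z (j z).
  by have [y zy] := eval_rel_total z; rewrite (jP _ _ zy).
exists j, tau; split=> //.
- by apply/inj_ker0 => z; apply: eval_rel_inj.
- move=> y; split=> [ty|[z <-]].
    have [W [Wx [b [WV0 bE]]]] := common_sections (fun i => y 0 i) V0x.
    have [l|W' [h [W'x e]]] := @common_vanishing X x W Wx a
        (fun l => \sum_i restr WV0 (r l i) * b i).
      rewrite (big_morph (rgerm Wx) (@rgermD _ _ _ Wx) (germ0 O Wx)).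
      have <- : tau y 0 l = 0 by rewrite ty mxE.
      rewrite tauE; apply: eq_bigr => i _.
      by rewrite rgermM bE mxE (rgerm_res WV0 V0x Wx).
    have W'V0 := subset_trans h WV0; have W'U := subset_trans W'V0 hV0.
    have [l|d dE] := @shom_extension W' W'V0 (fun i => restr h (b i)) _ W'U.
      rewrite -[RHS](e l) rmorph_sum; apply: eq_bigr => i _.
      by rewrite rmorphM (restr_comp _ _ W'V0).
    exists (germ (F := sheafHom F O) W'x d); apply: jP.
    exists W', W'U, W'x, d; split=> // i.
    by rewrite dE bE (rgerm_res h Wx W'x).
  have [W [hWU [Wx [d [_ yE]]]]] := jE z.
  pose T := opensI W V0.
  have TW : T `<=` W := @opensIl _ _ _; have TV : T `<=` V0 := @opensIr _ _ _.
  have Tx : oset T x by []; have TU := subset_trans TW hWU.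
  apply/rowP => l; rewrite tauE mxE.
  transitivity (rgerm Tx (shom_map d TW (mres F TV (\sum_i r l i *: mres F hV0 (g i))))).
    rewrite mres_sum shom_map_sum.
    rewrite (big_morph (rgerm Tx) (@rgermD _ _ _ Tx) (germ0 O Tx)).
    apply: eq_bigr => i _; rewrite mxE (eval_rel_shrink TW Tx yE TU).
    rewrite -(rgerm_res TV V0x Tx) -rgermM (mres_comp _ _ TU).
    congr (rgerm Tx (_ * _)).
    exact: shom_map_irr (subset_trans (@subset_refl _ T) TW) TW _.
  by rewrite rel0 mres0 shom_map0; apply: (germ0 O).
Qed.

End LocalPresentation.

Lemma coherent_stalk_presentation (X : ringedSpace) (F : presheafMod X) (x : X) :
  coherent F -> exists (a k : nat) (aug : hom 'rV[stalk x]_k (stalk_mod x F))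
    (rho : 'I_a -> 'rV[stalk x]_k)
    (j : hom (stalk_mod x (sheafHom F (structureMod X))) 'rV[stalk x]_k)
    (tau : hom 'rV[stalk x]_k 'rV[stalk x]_a),
  [/\ surjective aug, exact_at (lin_comb rho) aug, injective j, exact_at j tau &
    forall y l, tau y 0 l = \sum_i rho l 0 i * y 0 i].
Proof.
move=> [ft rels]; have [U [k [g [Ux gen]]]] := ft x.
have [V0 [hV0 [a [r [V0x rel0 rel_gen]]]]] := rels U k g x Ux.
have [j [tau [j_inj j_exact tauE]]] := stalk_dual_exact Ux gen V0x rel0 rel_gen.
exists a, k, (stalk_gen g Ux), (stalk_rel r V0x), j, tau; split=> //.
  exact: stalk_gen_surj.
exact: (stalk_gen_exact Ux V0x rel0 rel_gen).
Qed.

Theorem corollary8p2 (X Y : scheme) (phi : schMorphism X Y)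
  (hX : locally_noetherian X) (hY : locally_noetherian Y)
  (n : nat) (hn : (1 <= n)%N)
  (XX : fiberProduct phi phi)
  (hOmega : coherent (Omega XX n)) (hDer : coherent (Der XX n))
  (x : X) (y : Y) (hxy : y = phi x)
  (hOmega_x : exists w : stalk_mod x (Omega XX n), w <> 0)
  (hDer_x : exists d : stalk_mod x (Der XX n), d <> 0)
  (hG : locally_finite_Gdim_on (@Ass (stalk x)) (stalk_mod x (Der XX n))) :
  (torsionfree1 (stalk_mod x (Omega XX n)) <->
     syzygy1 (stalk_mod x (Omega XX n))) /\
  (syzygy1 (stalk_mod x (Omega XX n)) <->
     S1_tilde (stalk_mod x (Omega XX n))).
Proof.
have [a [k [aug [rho [j [tau [augS augE jI jE tauE]]]]]]] :=
  coherent_stalk_presentation x hOmega.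
exact: (torsionfree1_syzygy1_S1_tilde (scheme_stalk_noetherian hX)
  augS augE tauE jI jE hG).
Qed.
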